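(* Let $e\ge3$, let $I\subseteq\mathbb Z$ be a union of $c$ congruence classes modulo $e$ with $1\le c\le e-1$, put $\bar c=e-c$, fix a large integer $n$ divisible by $e$ and an integer $0\le u\le n$. Let $\alpha,\beta,\gamma$ be partitions with $\beta$ $c$-restricted and $\gamma$ $\bar c$-restricted. Define $(u,I)$-partitions $\lambda$ and $\mu$ by \[\lambda_I=\beta,\quad \lambda_{\bar I}=\alpha\,\|_{\bar c}\,\gamma,\quad \mu_I=\alpha'\,\|_c\,\mathrm m_c(\beta'),\quad \mu_{\bar I}=\mathrm m_{\bar c}(\gamma').\] If $\lambda$ and $\mu$ are both $I$-separated, then $\mathrm m_e(\lambda')=\mu$.
   Context: $\bar I=\mathbb Z\setminus I$; $\lambda'$ is the conjugate partition. Abacus displays have $n$ beads: the display of $\lambda$ is the set of occupied positions $\{\lambda_r+r-1:1\le r\le n\}\subseteq\mathbb Z_{\ge0}$, and a set of $N$ occupied positions $b_1>\dots>b_N$ determines the partition with parts $b_r+r-N$. Discarding positions not in $I$ and relabelling the remaining ones $0,1,2,\dots$ in increasing order gives the display of a partition $\lambda_I$; discarding positions in $I$ gives $\lambda_{\bar I}$. $\lambda$ is a $(u,I)$-partition if exactly $u$ beads lie in $I$; such a partition is uniquely determined by the pair $(\lambda_I,\lambda_{\bar I})$, and every pair of partitions arises. $\lambda$ is $I$-separated if the first empty position in $I$ comes after the last occupied position in $\bar I$. For partitions $\alpha,\beta$: $\alpha\,\|_{\bar c}\,\beta=(\bar c\alpha_1+\beta_1,\bar c\alpha_2+\beta_2,\dots)$,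 and $\alpha\,\|_c\,\beta$ consists of the parts of $\beta$ together with $c$ copies of each part of $\alpha$, in decreasing order. A partition is $k$-regular if it has no $k$ equal positive parts and $k$-restricted if $\lambda_r-\lambda_{r+1}<k$ for all $r$. For $k\ge2$, $\mathrm m_k$ is the Mullineux map: the involution on $k$-regular partitions describing the effect of tensoring with the sign representation on simple modules of (Iwahori--Hecke algebras of) symmetric groups in (quantum) characteristic $k$, equivalently the unique signed automorphism of the crystal of $k$-regular partitions; by convention $\mathrm m_1(\varnothing)=\varnothing$ (the only $1$-regular or $1$-restricted partition is $\varnothing$). *)

(* Defs.v *)
From mathcomp Require Import all_boot all_order all_algebra.
Set Implicit Arguments. Unset Strict Implicit. Unset Printing Implicit Defensive.

Definition is_part (l : seq nat) : bool := sorted geq l && all (fun x => 0 < x) l.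

Definition part (l : seq nat) (r : nat) : nat := nth 0 l r.

Definition conj (l : seq nat) : seq nat :=
  [seq count (fun x => j < x) l | j <- iota 0 (head 0 l)].

Definition regular (k : nat) (l : seq nat) : bool :=
  all (fun x => count_mem x l < k) l.

Definition restricted (k : nat) (l : seq nat) : bool :=
  all (fun r => part l r - part l r.+1 < k) (iota 0 (size l)).

Definition join_bar (cb : nat) (a b : seq nat) : seq nat :=
  mkseq (fun r => cb * part a r + part b r) (maxn (size a) (size b)).

Definition join_copies (c : nat) (a b : seq nat) : seq nat :=
  sort geq (b ++ flatten [seq nseq c x | x <- a]).

(* display of l on an abacus with n beads: positions lambda_r + n - r (r = 1..n) *)
Definition display (n : nat) (l : seq nat) : seq nat :=
  [seq part l r + n - r.+1 | r <- iota 0 n].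

(* partition determined by a set of N distinct occupied positions
   b_1 > ... > b_N: parts b_r + r - N *)
Definition part_of_beads (b : seq nat) : seq nat :=
  let s := sort geq b in
  [seq x <- [seq nth 0 s r - (size s - r.+1) | r <- iota 0 (size s)] | 0 < x].

Definition rank_in (J : pred nat) (p : nat) : nat := count J (iota 0 p).

Definition sub_part (J : pred nat) (n : nat) (l : seq nat) : seq nat :=
  part_of_beads [seq rank_in J p | p <- display n l & J p].

Definition posI (I : int -> bool) : pred nat := fun p => I (Posz p).
Definition posIc (I : int -> bool) : pred nat := fun p => ~~ I (Posz p).

Definition uI_partition (I : int -> bool) (n u : nat) (l : seq nat) : bool :=
  count (posI I) (display n l) == u.

Definition I_separated (I : int -> bool) (n : nat) (l : seq nat) : Prop :=
  forall p q : nat, p \in display n l -> ~~ I (Posz p) ->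
    I (Posz q) -> q \notin display n l -> p < q.

(* residue of the node in row r, column c (0-indexed): (c - r) mod e *)
Definition res (e r c : nat) : nat := (c + e.-1 * r) %% e.

Definition remI (e i : nat) (l : seq nat) (r : nat) : bool :=
  [&& r < size l, part l r.+1 < part l r & res e r (part l r).-1 == i].

Definition addI (e i : nat) (l : seq nat) (r : nat) : bool :=
  [&& r <= size l, (r == 0) || (part l r < part l r.-1) & res e r (part l r) == i].

(* removable i-node A in row r is normal: for every addable i-node B above A
   there are more removable i-nodes strictly between than addable ones *)
Definition normal (e i : nat) (l : seq nat) (r : nat) : bool :=
  remI e i l r &&
  all (fun b => count (addI e i l) (index_iota b r) <=
                count (remI e i l) (index_iota b.+1 r)) (iota 0 r).

(* addable i-node B in row r is conormal: for every removable i-node A below B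
   there are more addable i-nodes strictly between than removable ones *)
Definition conormal (e i : nat) (l : seq nat) (r : nat) : bool :=
  addI e i l r &&
  all (fun b => count (remI e i l) (index_iota r.+1 b.+1) <=
                count (addI e i l) (index_iota r.+1 b)) (index_iota r.+1 (size l).+1).

Definition good_row (e i : nat) (l : seq nat) : option nat :=
  let rs := [seq r <- iota 0 (size l) | normal e i l r] in
  if rs is [::] then None else Some (last 0 rs).

Definition cogood_row (e i : nat) (l : seq nat) : option nat :=
  let rs := [seq r <- iota 0 (size l).+1 | conormal e i l r] in
  if rs is r :: _ then Some r else None.

Definition etilde (e i : nat) (l : seq nat) : seq nat :=
  if good_row e i l is Some r then
    [seq x <- set_nth 0 l r (part l r).-1 | 0 < x]
  else l.

Definition ftilde (e i : nat) (l : seq nat) : seq nat :=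
  if cogood_row e i l is Some r then incr_nth l r else l.

(* Mullineux map m_e: m_e(empty) = empty and, if i has a good node in l,
   m_e(l) = f~_{-i} (m_e (e~_i l)).  (Kleshchev / Brundan: m_e is the unique
   signed crystal automorphism, i -> -i.) *)
Fixpoint mull_aux (e fuel : nat) (l : seq nat) : seq nat :=
  match fuel with
  | 0 => [::]
  | k.+1 =>
    match [seq i <- iota 0 e | good_row e i l != None] with
    | i :: _ => ftilde e ((e - i) %% e) (mull_aux e k (etilde e i l))
    | [::] => [::]
    end
  end.

Definition mullineux (e : nat) (l : seq nat) : seq nat := mull_aux e (sumn l) l.

(* Main.v *)
(** Write a partition as a Maya diagram (its abacus display continued to the left). The map
    lambda |-> m_e(lambda') is then the isomorphism from the crystal of e-restricted partitions to
    that of e-regular ones. Its existence (that m_e does not depend on the path of good nodes) is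
    proved by odd reflections: reading rows as letters of one kind and columns as letters of
    another, the rows-only word of a restricted partition is turned into the columns-only word of
    a regular one by local exchanges that commute with all crystal operators.

    Let lambda be I-separated. If x is in I and x + 1 is not, only additions are possible between
    these two runners, so applying the crystal operator as often as possible exchanges them, which
    changes I but not (lambda_I, lambda_{I^c}). After enough such reflections a crystal operator of
    lambda_I (or of lambda_{I^c}) is a crystal operator of lambda. It commutes with adding c times
    a partition to the rows, because contents are unchanged modulo c. As the same happens for mu,
    this reduces the theorem to beta = gamma = 0. Then reflecting backwards as far as possible
    brings the last bead outside I next to the first gap of I; moving it across removes the first
    row of alpha for lambda and the first column of alpha' for mu. When alpha is empty too,
    lambda = mu is an e-core, which is obtained from the empty partition by reflections. *)

Require Import Defs.
From mathcomp Require Import all_boot all_order all_algebra.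
From mathcomp Require Import zify.
From Stdlib Require Import FunctionalExtensionality.
Set Implicit Arguments. Unset Strict Implicit. Unset Printing Implicit Defensive.
Import Order.TTheory GRing.Theory Num.Theory.

(** * Maya diagrams of partitions *)

Arguments part : simpl never.

(** Everything is phrased through one relation, [reach], on restricted diagrams: the partner of
    lambda is the conjugate of its image, so both sides live in the same crystal with opposite
    residues and the relation is symmetric. This lets beta and gamma be handled by one lemma, with I
    and its complement exchanged. The recursion defining m_e follows one particular path of good
    nodes, whereas the theorem builds lambda along other paths, some of them descending. So
    uniqueness of partners comes first: words have a fixed length, and one list of odd reflections,
    chosen for the empty partition, serves all partitions. The recursion then only supplies
    existence, and both together give compatibility with removing nodes. Removal is essential:
    moving a bead across to I shortens alpha but enlarges lambda, so the induction on alpha has to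
    come back down. I and its complement are kept as increasing enumerations [a], [b], not as sets:
    a reflection composes both with the same exchange of runners, and the diagrams pulled back along
    them stay literally the same. *)

Definition bead (h : seq nat) (r : nat) : int := ((part h r)%:Z - 1 - r%:Z)%R.

(* [h] is continued by infinitely many zero rows, so every position far to the left is
   occupied; the n-bead display is this set shifted by n and cut off at 0. *)
Definition maya (h : seq nat) (x : int) : bool :=
  (x < - (size h)%:Z)%R || (x \in [seq bead h r | r <- iota 0 (size h)]).

Definition vacuum (x : int) : bool := (x < 0)%R.

Definition mirror (B : int -> bool) (x : int) : bool := ~~ B (- 1 - x)%R.

Definition swap (x : int) (B : int -> bool) (y : int) : bool :=
  if y == x then B (x + 1)%R else if y == (x + 1)%R then B x else B y.

Lemma part_default h r : size h <= r -> part h r = 0.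
Proof. by move=> ?; rewrite /part nth_default. Qed.

Lemma bead_default h r : size h <= r -> bead h r = (- 1 - r%:Z)%R.
Proof. by move=> ?; rewrite /bead part_default //; lia. Qed.

Lemma mayaP h x : reflect (exists r, x = bead h r) (maya h x).
Proof.
apply: (iffP orP) => [[lt_x|/mapP[r _ ->]]|[r ->]]; last 2 first.
- by exists r.
- have [le_r|lt_r] := leqP (size h) r.
    by left; rewrite bead_default //; lia.
  by right; apply: map_f; rewrite mem_iota.
exists (`|(- 1 - x)%R|); rewrite bead_default; lia.
Qed.

Lemma maya_bead h r : maya h (bead h r).
Proof. by apply/mayaP; exists r. Qed.

Lemma maya_vacuum : maya [::] = vacuum.
Proof. by apply: functional_extensionality => x; rewrite /maya /vacuum /= orbF; lia. Qed.

Lemma mirrorK B : mirror (mirror B) = B.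
Proof.
apply: functional_extensionality => x; rewrite /mirror negbK; congr B; lia.
Qed.

Lemma mirror_vacuum : mirror vacuum = vacuum.
Proof. by apply: functional_extensionality => x; rewrite /mirror /vacuum; lia. Qed.

Lemma swapK x B : swap x (swap x B) = B.
Proof.
apply: functional_extensionality => y; rewrite /swap.
by do ![case: eqP => ?] => //; congr B; lia.
Qed.

Lemma swap_mirror x B : swap (- 2 - x)%R (mirror B) = mirror (swap x B).
Proof.
apply: functional_extensionality => y; rewrite /swap /mirror.
by do ![case: eqP => ?] => //; try (exfalso; lia); congr (~~ B _); lia.
Qed.

Lemma swap_l x B : swap x B x = B (x + 1)%R.
Proof. by rewrite /swap eqxx. Qed.

Lemma swap_r x B : swap x B (x + 1)%R = B x.
Proof. by rewrite /swap eqxx ifF //; lia. Qed.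

Lemma swap_ne x B y : y != x -> y != (x + 1)%R -> swap x B y = B y.
Proof. by rewrite /swap => /negbTE-> /negbTE->. Qed.

Lemma is_part_le h r : is_part h -> part h r.+1 <= part h r.
Proof.
case/andP=> /(sortedP 0) srt _.
have [lt_r|ge_r] := ltnP r.+1 (size h); first exact: srt.
by rewrite (part_default ge_r).
Qed.

Lemma is_part_mono h r s : is_part h -> r <= s -> part h s <= part h r.
Proof.
move=> hp /subnK <-; elim: (s - r) => // n IHn.
by rewrite addSn; apply: leq_trans IHn; apply: is_part_le.
Qed.

Lemma is_part_gt0 h r : is_part h -> (0 < part h r) = (r < size h).
Proof.
case/andP=> _ /all_nthP gt0; have [lt_r|ge_r] := ltnP r (size h).
  by rewrite /part gt0.
by rewrite part_default.
Qed.

Lemma is_partP h : (forall r, part h r.+1 <= part h r) ->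
  (forall r, r < size h -> 0 < part h r) -> is_part h.
Proof.
move=> le gt0; apply/andP; split; first by apply/(sortedP 0) => i _; apply: le.
by apply/(all_nthP 0) => i lt_i; apply: gt0.
Qed.

Lemma is_part_inj h k : is_part h -> is_part k -> part h =1 part k -> h = k.
Proof.
move=> hp kp eq_p.
have sz r : (r < size h) = (r < size k) by rewrite -!is_part_gt0 // eq_p.
have eq_sz : size h = size k.
  by have := sz (size h); have := sz (size k); rewrite !ltnn; lia.
by apply: (@eq_from_nth _ 0).
Qed.

Lemma bead_lt h r s : is_part h -> r < s -> (bead h s < bead h r)%R.
Proof. by move=> hp lt; have := is_part_mono hp (ltnW lt); rewrite /bead; lia. Qed.

Lemma bead_ltE h r s : is_part h -> (bead h s < bead h r)%R = (r < s).
Proof.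
move=> hp; case: (ltngtP r s) => [lt|lt|->].
- by rewrite bead_lt.
- by have := bead_lt hp lt; lia.
- by lia.
Qed.

Lemma bead_leE h r s : is_part h -> (bead h s <= bead h r)%R = (r <= s).
Proof. by move=> hp; have := bead_ltE s r hp; lia. Qed.

Lemma bead_inj h : is_part h -> injective (bead h).
Proof.
move=> hp r s eq_rs; apply/eqP.
by rewrite eqn_leq -!(bead_leE _ _ hp) eq_rs lexx.
Qed.

(** By strong induction the r-th largest beads agree: each is a bead of the other diagram, and its
    index there is at least r because the smaller indices are already matched. *)
Lemma maya_inj h k : is_part h -> is_part k -> maya h = maya k -> h = k.
Proof.
move=> hp kp eq_m; apply: is_part_inj => // r.
suff: bead h r = bead k r by rewrite /bead; lia.
elim/ltn_ind: r => r IHr.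
have [s es] : exists s, bead h r = bead k s by apply/mayaP; rewrite -eq_m maya_bead.
have [t et] : exists t, bead k r = bead h t by apply/mayaP; rewrite eq_m maya_bead.
have le_s : r <= s.
  rewrite leqNgt; apply/negP=> lt; have := es; rewrite -IHr //.
  by move/(bead_inj hp); lia.
have le_t : r <= t.
  rewrite leqNgt; apply/negP=> lt; have := et; rewrite IHr //.
  by move/(bead_inj kp); lia.
have := bead_leE r s kp; have := bead_leE r t hp; lia.
Qed.

Lemma count_gt_part h j r : is_part h -> (r < count (fun x => j < x) h) = (j < part h r).
Proof.
elim: h r => [|x h IHh] r hp; first by rewrite part_default.
have hp' : is_part h.
  apply: is_partP => s; first exact: (is_part_le s.+1 hp).
  by move=> lt_s; have := is_part_gt0 s.+1 hp; rewrite /= ltnS lt_s.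
have mono := is_part_mono hp (leq0n r); have mono1 := is_part_mono hp (leq0n 1).
rewrite /=; case: (ltnP j x) => le_x.
  by case: r mono => [|r] _ //=; rewrite add1n ltnS IHh.
have /eqP-> : count (fun x => j < x) h == 0.
  rewrite -leqn0 leqNgt IHh // -leqNgt; exact: leq_trans mono1 le_x.
by apply/esym/negbTE; rewrite -leqNgt; apply: leq_trans mono le_x.
Qed.

Lemma part_conj h s : is_part h -> part (conj h) s = count (fun x => s < x) h.
Proof.
move=> hp; rewrite /conj; set f := fun j : nat => count (fun x => j < x) h.
have [lt_s|ge_s] := ltnP s (head 0 h).
  by rewrite /part (nth_map 0) ?size_iota // nth_iota.
rewrite part_default ?size_map ?size_iota //; apply/esym/eqP.
by rewrite -leqn0 leqNgt count_gt_part // -leqNgt /part nth0.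
Qed.

Lemma ltn_part_conj h r s : is_part h -> (r < part (conj h) s) = (s < part h r).
Proof. by move=> hp; rewrite part_conj // count_gt_part. Qed.

Lemma is_part_conj h : is_part h -> is_part (conj h).
Proof.
move=> hp; apply: is_partP => s.
  by have := ltn_part_conj (part (conj h) s) s hp; have := ltn_part_conj (part (conj h) s) s.+1 hp; lia.
by rewrite size_map size_iota ltn_part_conj // /part nth0.
Qed.

Lemma conjK h : is_part h -> conj (conj h) = h.
Proof.
move=> hp; have hp' := is_part_conj hp.
apply: is_part_inj; rewrite ?is_part_conj // => r.
apply/eqP; rewrite eqn_leq; apply/andP; split; rewrite leqNgt.
  by rewrite ltn_part_conj // ltn_part_conj // ltnn.
by rewrite -ltn_part_conj // -ltn_part_conj // ltnn.
Qed.

(** The boundary path of a partition read backwards: [ltn_part_conj] says exactly that no bead of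
    [conj h] is the reflection of a bead of [h]. *)
Lemma maya_conj h : is_part h -> maya (conj h) = mirror (maya h).
Proof.
move=> hp; apply: functional_extensionality => x; rewrite /mirror.
apply/mayaP/idP => [[s ->]|].
  apply/mayaP => -[r]; rewrite /bead; have := ltn_part_conj r s hp.
  by case: (ltnP s) => ? /=; lia.
move=> nB.
(* Conversely, let r be the number of beads beyond the gap -1 - x. This gap is the boundary step
   under column s = -1 - x + r, whose length is r. *)
have ex : exists r, (bead h r <= - 1 - x)%R.
  by exists (size h + `|x|%N); rewrite bead_default; lia.
case: (ex_minnP ex) => r ler min_r.
have ltr : (bead h r < - 1 - x)%R.
  rewrite lt_neqAle ler andbT; apply: contra nB => /eqP <-; exact: maya_bead.
have ge0 : (0 <= - 1 - x + r%:Z)%R by move: ltr; rewrite /bead; lia.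
exists `|(- 1 - x + r%:Z)%R|; move: ge0; case E: (- 1 - x + r%:Z)%R => [s|] // _.
rewrite absz_nat.
suff -> : bead (conj h) s = (r%:Z - 1 - s%:Z)%R by lia.
suff <- : part (conj h) s = r by [].
apply/eqP; rewrite eqn_leq; apply/andP; split.
  by rewrite leqNgt ltn_part_conj // -leqNgt; move: ltr; rewrite /bead; lia.
case: r ler min_r ltr E => [//|r] ler min_r ltr E; rewrite ltn_part_conj //.
by have := contraNN (@min_r r); rewrite ltnn => /(_ isT); rewrite /bead; lia.
Qed.

(** * Addable and removable nodes as moves of beads *)

Definition addable (B : int -> bool) (x : int) : bool := B x && ~~ B (x + 1)%R.
Definition removable (B : int -> bool) (x : int) : bool := ~~ B x && B (x + 1)%R.

Lemma addable_swap B x : addable (swap x B) x = removable B x.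
Proof. by rewrite /addable /removable swap_l swap_r andbC. Qed.

Lemma removable_swap B x : removable (swap x B) x = addable B x.
Proof. by rewrite /addable /removable swap_l swap_r andbC. Qed.

Lemma addable_mirror B x : addable (mirror B) (- 2 - x)%R = addable B x.
Proof.
rewrite /addable /mirror negbK andbC; congr (B _ && ~~ B _); lia.
Qed.

Lemma removable_mirror B x : removable (mirror B) (- 2 - x)%R = removable B x.
Proof.
rewrite /removable /mirror negbK andbC; congr (~~ B _ && B _); lia.
Qed.

Lemma addable_bead h r : is_part h ->
  addable (maya h) (bead h r) = (r == 0) || (part h r < part h r.-1).
Proof.
move=> hp; rewrite /addable maya_bead /=; case: r => [|r] /=.
  apply/mayaP => -[s /eqP]; rewrite gt_eqF //.
  by have := is_part_mono hp (leq0n s); rewrite /bead; lia.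
have le := is_part_le r hp; apply/idP/idP => [|lt].
  apply: contraR => nlt; apply/mayaP; exists r; rewrite /bead; move: nlt le; lia.
apply/mayaP => -[s es].
have lt_r : r < s by rewrite -(bead_ltE _ _ hp); move: es lt; rewrite /bead; lia.
have lt_s : s < r.+1 by rewrite -(bead_ltE _ _ hp); lia.
lia.
Qed.

Lemma removable_bead h r : is_part h ->
  removable (maya h) (bead h r - 1)%R = (part h r.+1 < part h r).
Proof.
move=> hp; rewrite /removable subrK maya_bead andbT.
have le := is_part_le r hp; apply/idP/idP => [|lt].
  apply: contraR => nlt; apply/mayaP; exists r.+1; rewrite /bead; lia.
apply/mayaP => -[s es].
have lt_r : r < s by rewrite -(bead_ltE _ _ hp); lia.
have lt_s : s < r.+1 by rewrite -(bead_ltE _ _ hp); move: es lt; rewrite /bead; lia.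
lia.
Qed.

Lemma addable_posP h x : is_part h -> addable (maya h) x -> exists r, x = bead h r.
Proof. by move=> _ /andP[/mayaP]. Qed.

Lemma removable_posP h x : is_part h -> removable (maya h) x -> exists r, x = (bead h r - 1)%R.
Proof. by move=> _ /andP[_ /mayaP[r rE]]; exists r; rewrite -rE addrK. Qed.

Lemma part_incr h r s : part (incr_nth h r) s = part h s + (s == r).
Proof. by rewrite /part nth_incr_nth addnC eq_sym. Qed.

Lemma addable_row_le h r : is_part h -> addable (maya h) (bead h r) -> r <= size h.
Proof.
move=> hp; rewrite addable_bead //; case: r => [//|r] /= lt.
by rewrite -is_part_gt0 //; lia.
Qed.

Lemma sumn_incr h r : sumn (incr_nth h r) = (sumn h).+1.
Proof.
elim: h r => [|x h IHh] [|r] //=; last by rewrite IHh addnS.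
by rewrite add0n; elim: r.
Qed.

Lemma is_part_incr h r : is_part h -> addable (maya h) (bead h r) -> is_part (incr_nth h r).
Proof.
move=> hp A; have le_r := addable_row_le hp A; rewrite addable_bead // in A.
apply: is_partP => s; rewrite ?part_incr.
  have := is_part_le s hp; case: (s.+1 =P r) A => [<- /=|_ _]; last by lia.
  by case: eqP; lia.
rewrite size_incr_nth; case: (s =P r) => [_|]; first by lia.
by case: (ltnP r (size h)) => H1 H2 H3; rewrite addn0 is_part_gt0 //; lia.
Qed.

Lemma swap_add_node h r : is_part h -> addable (maya h) (bead h r) ->
  swap (bead h r) (maya h) = maya (incr_nth h r).
Proof.
move=> hp A; have hp' := is_part_incr hp A.
have posE s : bead (incr_nth h r) s = (bead h s + (s == r)%:Z)%R.
  by rewrite /bead part_incr; lia.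
case/andP: A => _ A; apply: functional_extensionality => y; rewrite /swap.
case: eqP => [->|ne]; last case: eqP => [->|ne1].
- rewrite (negbTE A); apply/esym/mayaP => -[s]; rewrite posE => /eqP.
  case: (s =P r) => [->|sr]; first by lia.
  by rewrite addr0 => /eqP/(bead_inj hp)/esym.
- by rewrite maya_bead; apply/esym/mayaP; exists r; rewrite posE eqxx.
apply/mayaP/mayaP=> -[s sE]; exists s; rewrite posE in sE *.
  by case: eqP => [E|_] /=; [subst s; case: ne | lia].
by case: eqP sE => [->|] /=; lia.
Qed.

(** In a weakly decreasing sequence the zeros form the tail, so deleting them shifts no index. *)
Lemma nth_filter_gt0 l s : sorted geq l -> nth 0 [seq x <- l | 0 < x] s = nth 0 l s.
Proof.
elim: l s => [//|x l IHl] s /= srt.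
have srt' := path_sorted srt.
case: x srt => [|x] srt /=; last by case: s => //= s; apply: IHl.
have /eq_in_filter-> : {in l, (fun x => 0 < x) =1 pred0}.
  move=> y yl; apply/negbTE; rewrite -leqNgt.
  have trg : transitive geq by move=> ? ? ? /=; lia.
  by have /allP/(_ y yl) := order_path_min trg srt.
rewrite filter_pred0 nth_nil; case: s => [//|s] /=.
have [lt_s|?] := ltnP s (size l); last by rewrite nth_default.
have trg : transitive geq by move=> ? ? ? /=; lia.
have /allP/(_ _ (mem_nth 0 lt_s)) := order_path_min trg srt.
by rewrite /geq /=; lia.
Qed.

Definition remove_node (h : seq nat) (r : nat) : seq nat :=
  [seq x <- set_nth 0 h r (part h r).-1 | 0 < x].

Lemma part_filter_gt0 l : (forall s, nth 0 l s.+1 <= nth 0 l s) ->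
  part [seq x <- l | 0 < x] =1 part l.
Proof. by move=> le s; apply: nth_filter_gt0; apply/(sortedP 0) => i _; apply: le. Qed.

Lemma is_part_filter l : (forall s, nth 0 l s.+1 <= nth 0 l s) ->
  is_part [seq x <- l | 0 < x].
Proof.
move=> le; rewrite /is_part filter_all andbT sorted_filter //.
  by move=> ? ? ? /=; lia.
by apply/(sortedP 0) => i _; apply: le.
Qed.

Section RemoveNode.
Variables (h : seq nat) (r : nat).
Hypotheses (hp : is_part h) (R : removable (maya h) (bead h r - 1)%R).

Lemma remove_node_le s :
  nth 0 (set_nth 0 h r (part h r).-1) s.+1 <= nth 0 (set_nth 0 h r (part h r).-1) s.
Proof.
have := R; rewrite removable_bead // => lt; rewrite !nth_set_nth /= -!/(part _ _).
have := is_part_le s hp.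
by case: (s.+1 =P r) => [eq1|_]; case: (s =P r) => [eq2|_] //=; subst; lia.
Qed.

Lemma is_part_remove_node : is_part (remove_node h r).
Proof. exact: is_part_filter remove_node_le. Qed.

Lemma part_remove_node s : part (remove_node h r) s = part h s - (s == r).
Proof.
rewrite /remove_node part_filter_gt0; last exact: remove_node_le.
by rewrite /part nth_set_nth /=; case: eqP => [->|_]; rewrite ?subn0 ?subn1.
Qed.

Lemma incr_remove_node : incr_nth (remove_node h r) r = h.
Proof.
have := R; rewrite removable_bead // => lt0.
have A : addable (maya (remove_node h r)) (bead (remove_node h r) r).
  rewrite addable_bead ?is_part_remove_node // !part_remove_node; case: (r) lt0 => //= s lt.
  by have := is_part_le s hp; rewrite !eqxx; lia.
apply: is_part_inj => // [|s]; first exact: is_part_incr is_part_remove_node A.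
by rewrite part_incr part_remove_node; case: eqP => [->|]; lia.
Qed.

Lemma bead_remove_node : bead (remove_node h r) r = (bead h r - 1)%R.
Proof. by move: R; rewrite removable_bead // => R'; rewrite /bead part_remove_node eqxx; lia. Qed.

Lemma addable_remove_node : addable (maya (remove_node h r)) (bead h r - 1)%R.
Proof.
rewrite -bead_remove_node addable_bead ?is_part_remove_node // !part_remove_node; move: R; rewrite removable_bead //.
by case: (r) => //= s lt; have := is_part_le s hp; rewrite !eqxx; lia.
Qed.

Lemma swap_remove_node : swap (bead h r - 1)%R (maya h) = maya (remove_node h r).
Proof.
rewrite -{2}incr_remove_node -swap_add_node ?is_part_remove_node ?bead_remove_node ?swapK //; exact: addable_remove_node.
Qed.

Lemma sumn_remove_node : sumn h = (sumn (remove_node h r)).+1.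
Proof. by rewrite -{1}incr_remove_node sumn_incr. Qed.

End RemoveNode.

Definition ismaya (B : int -> bool) : Prop := exists2 h, is_part h & B = maya h.

Lemma ismaya_swapA B x : ismaya B -> addable B x -> ismaya (swap x B).
Proof.
move=> [h hp ->] A; have [r xE] := addable_posP hp A; subst x.
by rewrite swap_add_node //; exists (incr_nth h r) => //; apply: is_part_incr.
Qed.

Lemma ismaya_swapR B x : ismaya B -> removable B x -> ismaya (swap x B).
Proof.
move=> [h hp ->] R; have [r xE] := removable_posP hp R; subst x.
by rewrite swap_remove_node //; exists (remove_node h r) => //; apply: is_part_remove_node.
Qed.

Lemma ismaya_mirror B : ismaya B -> ismaya (mirror B).
Proof. by case=> h hp ->; exists (conj h); rewrite ?is_part_conj ?maya_conj. Qed.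

Definition congz (e : nat) (x y : int) : bool := (e %| (x - y)%R)%Z.

Lemma congzP e x y : reflect (exists k : int, x = y + k * e%:Z)%R (congz e x y).
Proof.
by apply: (iffP dvdzP) => -[k kE]; exists k; rewrite -?kE ?kE; lia.
Qed.

Lemma congz_refl e x : congz e x x.
Proof. by rewrite /congz subrr dvdz0. Qed.

Lemma congz_sym e x y : congz e x y = congz e y x.
Proof. by rewrite /congz -opprB rpredN. Qed.

Lemma congz_trans e y x z : congz e x y -> congz e y z -> congz e x z.
Proof.
move=> xy yz; rewrite /congz (_ : x - z = (x - y) + (y - z))%R; last by lia.
by rewrite rpredD.
Qed.

Lemma congz_small e x y : congz e x y -> (`|x - y| < e%:Z)%R -> x = y.
Proof.
case/congzP=> k -> lt; suff -> : k = 0%R by rewrite mul0r addr0.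
by move: lt; rewrite addrC addKr normrM; case: k => [[|k]|k] //= lt; nia.
Qed.

Lemma congzDr e x y z : congz e (x + z) (y + z) = congz e x y.
Proof. by rewrite /congz; congr (_ %| _)%Z; lia. Qed.

Lemma congzN e x y : congz e (- x) (- y) = congz e x y.
Proof. by rewrite /congz -opprD rpredN. Qed.

Lemma congz_shift e x (j : nat) : congz e (x + (e * j)%:Z)%R x.
Proof. by apply/congzP; exists (j%:Z)%R; lia. Qed.

Lemma congz_shiftN e x (j : nat) : congz e (x - (e * j)%:Z)%R x.
Proof. by apply/congzP; exists (- j%:Z)%R; lia. Qed.

Lemma congz_gt e x y : 0 < e -> congz e y x -> (x < y)%R ->
  exists2 j, 0 < j & y = (x + (e * j)%:Z)%R.
Proof.
move=> e0 /congzP[k ->] lt; case: k lt => k lt; last by exfalso; nia.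
by exists k; [case: k lt => //; lia | lia].
Qed.

Lemma congz_lt e x y : 0 < e -> congz e y x -> (y < x)%R ->
  exists2 j, 0 < j & y = (x - (e * j)%:Z)%R.
Proof.
move=> e0 xy lt; have [||j j0 jE] := @congz_gt e y x e0; rewrite ?(congz_sym e x) //.
by exists j => //; lia.
Qed.

(** * Crystal operators on Maya diagrams *)

Definition count_up (e : nat) (P : int -> bool) (x : int) (m : nat) : nat :=
  count (fun j : nat => P (x + (e * j)%:Z)%R) (iota 1 m).
Definition count_dn (e : nat) (P : int -> bool) (x : int) (m : nat) : nat :=
  count (fun j : nat => P (x - (e * j)%:Z)%R) (iota 1 m).

Definition up_le e P Q x : Prop := forall m, count_up e P x m <= count_up e Q x m.
Definition dn_le e P Q x : Prop := forall m, count_dn e P x m <= count_dn e Q x m.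

Lemma count_upS e P x m : count_up e P x m.+1 = count_up e P x m + P (x + (e * m.+1)%:Z)%R.
Proof. by rewrite /count_up -[m.+1]addn1 iotaD count_cat /= addn0 [1 + m]addnC. Qed.

Lemma count_dnS e P x m : count_dn e P x m.+1 = count_dn e P x m + P (x - (e * m.+1)%:Z)%R.
Proof. by rewrite /count_dn -[m.+1]addn1 iotaD count_cat /= addn0 [1 + m]addnC. Qed.

Lemma eq_count_up e P Q x y m :
  (forall j, 0 < j -> P (x + (e * j)%:Z)%R = Q (y + (e * j)%:Z)%R) ->
  count_up e P x m = count_up e Q y m.
Proof.
by move=> eqPQ; apply: eq_in_count => j; rewrite mem_iota => /andP[j0 _]; apply: eqPQ.
Qed.

Lemma eq_count_dn e P Q x y m :
  (forall j, 0 < j -> P (x - (e * j)%:Z)%R = Q (y - (e * j)%:Z)%R) ->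
  count_dn e P x m = count_dn e Q y m.
Proof.
by move=> eqPQ; apply: eq_in_count => j; rewrite mem_iota => /andP[j0 _]; apply: eqPQ.
Qed.

Lemma count_up_opp e P x m : count_up e P (- x)%R m = count_dn e (fun y => P (- y)%R) x m.
Proof. by apply: eq_count => j; congr P; lia. Qed.

Lemma count_dn_opp e P x m : count_dn e P (- x)%R m = count_up e (fun y => P (- y)%R) x m.
Proof. by apply: eq_count => j; congr P; lia. Qed.

Lemma count_up_count_dn e P z x M k : x = (z + (e * (M + k).+1)%:Z)%R ->
  count_up e P z M + count_dn e P x k = count_dn e P x (M + k).
Proof.
elim: M k => [|M IHM] k xE; first by rewrite /count_up.
rewrite count_upS addSnnS -IHM; last by rewrite xE; congr (_ + _)%R; lia.
rewrite count_dnS -!addnA; congr addn; rewrite addnC; congr (_ + nat_of_bool (P _)); nia.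
Qed.

Lemma count_upD e P z m k :
  count_up e P z (m + k) = count_up e P z m + count_up e P (z + (e * m)%:Z)%R k.
Proof.
elim: k => [|k IHk]; first by rewrite /count_up /= !addn0.
rewrite addnS !count_upS IHk addnA; congr (_ + nat_of_bool (P _)); nia.
Qed.

(** From the lower position up to just below x, [P] exceeds [Q]: the lower position itself
    contributes one, and [up_le] there controls the positions in between. This contradicts [dn_le]
    at x, so the two halves of [balanced] single out at most one node of a class. *)
Lemma up_dn_exclusive e (P Q : int -> bool) x j : 0 < j -> P (x - (e * j)%:Z)%R -> ~~ Q (x - (e * j)%:Z)%R ->
  up_le e Q P (x - (e * j)%:Z)%R -> dn_le e P Q x -> False.
Proof.
case: j => [//|j] _ Px nQx u d.
have := d j.+1; rewrite !count_dnS Px (negbTE nQx).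
have E T : count_up e T (x - (e * j.+1)%:Z)%R j = count_dn e T x j.
  by have := @count_up_count_dn e T (x - (e * j.+1)%:Z)%R x j 0; rewrite !addn0 => ->; lia.
by have := u j; rewrite !E; lia.
Qed.

(** At the first failure of [dn_le] below x there is a position satisfying [P], and it would satisfy
    [up_le] as well, contrary to the choice of x as the lowest such position. *)
Lemma lowest_dn e (P Q : int -> bool) x : P x -> ~~ Q x -> up_le e Q P x ->
  (forall j, 0 < j -> P (x - (e * j)%:Z)%R -> ~ up_le e Q P (x - (e * j)%:Z)%R) ->
  dn_le e P Q x.
Proof.
move=> Px nQx u low m; rewrite leqNgt; apply/negP => viol.
have ex : exists m, count_dn e Q x m < count_dn e P x m by exists m.
case: (ex_minnP ex) => -[//|k] {m viol ex} viol min_k.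
have le_k i : i <= k -> count_dn e P x i <= count_dn e Q x i.
  by move=> le; rewrite leqNgt; apply/negP => /min_k; lia.
have lek := le_k k (leqnn k); rewrite !count_dnS in viol.
have Pk : P (x - (e * k.+1)%:Z)%R by move: viol; case: (P _) => //; lia.
apply: (low k.+1) => // M.
(* An interval ending below x is controlled by minimality of the failure; one reaching x or beyond
   also uses [up_le] at x, where x itself adds one to [P]. *)
have [lt_M|ge_M] := leqP M k.
  have E T : count_up e T (x - (e * k.+1)%:Z)%R M + count_dn e T x (k - M) = count_dn e T x k.
    by rewrite (@count_up_count_dn _ _ _ _ _ (k - M)) subnKC //; lia.
  have := E P; have := E Q; have := le_k (k - M); rewrite leq_subr => /(_ isT).
  by move: viol lek; case: (P _); case: (Q _); lia.
have E T : count_up e T (x - (e * k.+1)%:Z)%R M =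
    count_dn e T x k + T x + count_up e T x (M - k.+1).
  have -> : M = k.+1 + (M - k.+1) by lia.
  rewrite count_upD count_upS subrK addKn; congr (_ + _ + _).
  by have := @count_up_count_dn e T (x - (e * k.+1)%:Z)%R x k 0; rewrite !addn0 => ->; lia.
rewrite !E Px (negbTE nQx); have := u (M - k.+1); lia.
Qed.

(** This is [lowest_dn] for the reflection y -> -y with [P] and [Q] exchanged. *)
Lemma highest_up e (P Q : int -> bool) x : Q x -> ~~ P x -> dn_le e P Q x ->
  (forall j, 0 < j -> Q (x + (e * j)%:Z)%R -> ~ dn_le e P Q (x + (e * j)%:Z)%R) ->
  up_le e Q P x.
Proof.
move=> Qx nPx d high.
pose P' y := P (- y)%R; pose Q' y := Q (- y)%R.
have {}d : up_le e P' Q' (- x)%R.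
  move=> m; rewrite !count_up_opp; move: (d m).
  by congr (_ <= _); apply: eq_count_dn => j _; rewrite /P' /Q' opprK.
have : dn_le e Q' P' (- x)%R.
  apply: lowest_dn => //; rewrite /P' /Q' ?opprK // => j j0.
  rewrite (_ : - (- x - (e * j)%:Z) = x + (e * j)%:Z)%R; last by lia.
  move=> Qj u; apply: (high j j0 Qj) => m; move: (u m).
  rewrite (_ : - x - (e * j)%:Z = - (x + (e * j)%:Z))%R; last by lia.
  by rewrite !count_up_opp; congr (_ <= _); apply: eq_count_dn => i _; rewrite /P' /Q' opprK.
move=> u m; move: (u m); rewrite !count_dn_opp.
by congr (_ <= _); apply: eq_count_up => i _; rewrite /P' /Q' opprK.
Qed.

(* Moving a bead from x to x + 1 adds a node of residue x + 1 mod e. [balanced] says that this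
   node survives the cancellation of the signature read from low to high positions, so that
   [fstep] (resp. [estep]) locates the cogood (resp. good) node in the crystal of restricted
   partitions. Under [mirror] it becomes the crystal of regular partitions, residues negated. *)
Definition balanced e B x : Prop := up_le e (removable B) (addable B) x /\ dn_le e (addable B) (removable B) x.
Definition fstep e x B : Prop := addable B x /\ balanced e B x.
Definition estep e x B : Prop := removable B x /\ balanced e B x.

Lemma addable_removable B x : addable B x -> ~~ removable B x.
Proof. by rewrite /addable /removable => /andP[->]. Qed.

Lemma removable_addable B x : removable B x -> ~~ addable B x.
Proof. by rewrite /addable /removable => /andP[/negbTE->]. Qed.

Lemma balanced_swap e x B : 1 < e -> balanced e B x -> balanced e (swap x B) x.
Proof.
move=> e1 [u d]; split=> m.
  have E j : 0 < j -> swap x B (x + (e * j)%:Z)%R = B (x + (e * j)%:Z)%R /\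
      swap x B (x + (e * j)%:Z + 1)%R = B (x + (e * j)%:Z + 1)%R.
    by move=> j0; split; apply: swap_ne; nia.
  by have := u m; congr (_ <= _); apply: eq_count_up => j j0; rewrite /addable /removable; case: (E j j0) => -> ->.
have E j : 0 < j -> swap x B (x - (e * j)%:Z)%R = B (x - (e * j)%:Z)%R /\
    swap x B (x - (e * j)%:Z + 1)%R = B (x - (e * j)%:Z + 1)%R.
  by move=> j0; split; apply: swap_ne; nia.
by have := d m; congr (_ <= _); apply: eq_count_dn => j j0; rewrite /addable /removable; case: (E j j0) => -> ->.
Qed.

Lemma fstep_swap e x B : 1 < e -> fstep e x B -> estep e x (swap x B).
Proof. by move=> e1 [A o]; split; [rewrite removable_swap | apply: balanced_swap]. Qed.

Lemma estep_swap e x B : 1 < e -> estep e x B -> fstep e x (swap x B).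
Proof. by move=> e1 [A o]; split; [rewrite addable_swap | apply: balanced_swap]. Qed.

Lemma fstep_uniq e x y B : 0 < e -> fstep e x B -> fstep e y B -> congz e x y -> x = y.
Proof.
wlog lt : x y / (x < y)%R.
  move=> W e0 sx sy xy; case: (ltgtP x y) => // lt; first exact: W.
  by apply/esym/W => //; rewrite congz_sym.
move=> e0 [Ax [ux _]] [Ay [_ dy]] xy.
have [j j0 xE] := congz_lt e0 xy lt; exfalso; subst x.
by apply: (@up_dn_exclusive e (addable B) (removable B) y j) => //; apply: addable_removable.
Qed.

Lemma estep_uniq e x y B : 0 < e -> estep e x B -> estep e y B -> congz e x y -> x = y.
Proof.
wlog lt : x y / (x < y)%R.
  move=> W e0 sx sy xy; case: (ltgtP x y) => // lt; first exact: W.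
  by apply/esym/W => //; rewrite congz_sym.
move=> e0 [Ax [ux _]] [Ay [_ dy]]; rewrite congz_sym => xy.
have [j j0 yE] := congz_gt e0 xy lt; exfalso; subst y.
case: j j0 {xy lt} Ay dy => [//|j] _ Ay dy.
have := ux j.+1; rewrite !count_upS Ay (negbTE (removable_addable Ay)).
have E T : count_up e T x j = count_dn e T (x + (e * j.+1)%:Z)%R j.
  by have := @count_up_count_dn e T x (x + (e * j.+1)%:Z)%R j 0; rewrite !addn0 => ->.
by have := dy j; rewrite -!E; lia.
Qed.

(** Consecutive beads are at distance at most e, that is, consecutive parts differ by less than e.
    This form mentions no rows, so it can be followed through [swap]. *)
Definition restrictedM (e : nat) (B : int -> bool) : Prop :=
  forall p, B p -> exists2 j : nat, 0 < j <= e & B (p - j%:Z)%R.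

(** The only bead endangered by moving x + 1 down to x is x + 1 + e, if its neighbour was x + 1. One
    step of [up_le] then forces a bead at x + e, since the node there would otherwise be removable
    and uncancelled. *)
Lemma restrictedM_estep e x B : 1 < e -> restrictedM e B -> estep e x B -> restrictedM e (swap x B).
Proof.
move=> e1 rB [R [u _]] p; have /andP[nx x1] := R.
have [->|px] := eqVneq p x.
  move=> _; have [j j_e Bj] := rB _ x1.
  have j1 : j != 1%N by apply: contraNneq nx => jE; move: Bj; rewrite jE addrK.
  by exists j.-1; [lia | rewrite swap_ne; [move: Bj; congr B| |]; lia].
have [->|px1] := eqVneq p (x + 1)%R; first by rewrite swap_r (negbTE nx).
rewrite swap_ne // => Bp; have [j j_e Bj] := rB _ Bp.
have [jx|jx] := eqVneq (p - j%:Z)%R (x + 1)%R; last first.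
  have [jx'|jx'] := eqVneq (p - j%:Z)%R x; first by move: nx; rewrite -jx' Bj.
  by exists j => //; rewrite swap_ne.
have [lt_j|ge_j] := ltnP j e.
  exists j.+1 => //; rewrite (_ : (p - j.+1%:Z = x)%R) ?swap_l //; lia.
have ej : j = e by lia.
have := u 1; rewrite /count_up /= muln1 !addn0 /removable /addable.
rewrite (_ : x + e%:Z + 1 = p)%R; last by lia.
rewrite Bp andbT andbF; case: (boolP (B _)) => //= Bx _.
exists 1%N; first by lia.
by rewrite swap_ne; [move: Bx; congr B| |]; lia.
Qed.

(** Here the moved bead itself is endangered, when its next bead is x - e; one step of [dn_le]
    forces a bead at x - e + 1. *)
Lemma restrictedM_step e x B : 1 < e -> restrictedM e B -> fstep e x B -> restrictedM e (swap x B).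
Proof.
move=> e1 rB [A [_ d]] p; have /andP[Bx nx1] := A.
have [->|px] := eqVneq p x; first by rewrite swap_l (negbTE nx1).
have [->|px1] := eqVneq p (x + 1)%R.
  move=> _; have [j j_e Bj] := rB _ Bx.
  have [lt_j|ge_j] := ltnP j e.
    by exists j.+1 => //; rewrite swap_ne; [move: Bj; congr B| |]; lia.
  have ej : j = e by lia.
  have := d 1; rewrite /count_dn /= muln1 !addn0 /removable /addable -ej Bj /=.
  case: (boolP (B _)) => //= Bx1 _; exists j; first by lia.
  by rewrite swap_ne; [move: Bx1; congr B| |]; lia.
rewrite swap_ne // => Bp; have [j j_e Bj] := rB _ Bp.
have [jx|jx] := eqVneq (p - j%:Z)%R x; last first.
  have [jx'|jx'] := eqVneq (p - j%:Z)%R (x + 1)%R; first by move: nx1; rewrite -jx' Bj.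
  by exists j => //; rewrite swap_ne.
have j1 : j != 1%N by apply: contraNneq px1 => j1; move: jx; rewrite j1; lia.
exists j.-1; first by lia.
by rewrite (_ : p - j.-1%:Z = x + 1)%R ?swap_r //; lia.
Qed.

(** * Signature words and odd reflections *)

(* [(true, z)] is a row whose addable node has content z and whose removable node has content
   z - 1; [(false, z)] is a column whose addable node has content z and whose removable node has
   content z + 1. Letters are unconstrained: the nodes that do not exist in the partition cancel
   in the signature. *)
Notation letter := (bool * int)%type.

Definition letter_add (e : nat) (i : int) (L : letter) : bool := congz e L.2 i.
Definition letter_rem (e : nat) (i : int) (L : letter) : bool :=
  congz e (if L.1 then L.2 - 1 else L.2 + 1)%R i.
(* An addable letter cancels a removable letter to its right; [eps] counts the removable letters
   that survive. *)
Definition eps_step e i L n := if letter_add e i L then n.-1 else if letter_rem e i L then n.+1 else n.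
Definition eps e i (w : seq letter) := foldr (eps_step e i) 0 w.
Definition advance (L : letter) : letter := (L.1, if L.1 then L.2 + 1 else L.2 - 1)%R.

Fixpoint word_f e i (w : seq letter) : option (seq letter) :=
  if w is L :: w' then
    if letter_add e i L && (eps e i w' == 0) then Some (advance L :: w')
    else omap (cons L) (word_f e i w')
  else None.

(* The crystal isomorphism from (column) (x) (row) to (row) (x) (column): the odd reflection
   underlying Brundan and Kujawa's proof of the Mullineux conjecture. *)
Fixpoint odd_swap e (n : nat) (w : seq letter) : seq letter :=
  match n, w with
  | n'.+1, L :: w' => L :: odd_swap e n' w'
  | 0, (false, x) :: (true, y) :: w' =>
      if congz e y (x + 1) then (true, y + 1)%R :: (false, x + 1)%R :: w'
      else (true, y) :: (false, x) :: w'
  | _, _ => w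
  end.

Lemma congz_excl e x i : 1 < e -> congz e x i -> congz e (x + 1)%R i = false.
Proof.
move=> e1 xi; apply/negP => x1i; have := congz_trans x1i; rewrite congz_sym in xi.
by move/(_ _ xi)/congz_small => H; have := H ltac:(lia); lia.
Qed.

Lemma congz_congr e x y i : congz e x y -> congz e x i = congz e y i.
Proof.
move=> xy; apply/idP/idP; last exact: congz_trans.
by apply: congz_trans; rewrite congz_sym.
Qed.

(** A column x has residues x (addable) and x + 1 (removable), a row y has y and y - 1. If y is not
    congruent to x + 1, no addable residue of one is a removable residue of the other, so the order
    does not affect [eps]. If it is, the nodes of residue x cancel and those of residue x + 1 stay
    as removable, addable; raising both letters while exchanging them keeps this pattern and makes
    the nodes of residue x + 2 cancel instead. The two cases turn into each other when [word_f] acts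
    on the pair, for instance when both letters are addable of the same residue. *)
Lemma odd_swap_pair e i x y w : 1 < e ->
  eps e i (odd_swap e 0 [:: (false, x), (true, y) & w]) =
    eps e i [:: (false, x), (true, y) & w] /\
  word_f e i (odd_swap e 0 [:: (false, x), (true, y) & w]) =
    omap (odd_swap e 0) (word_f e i [:: (false, x), (true, y) & w]).
Proof.
move=> e1.
have xx := @congz_excl e x i e1; have xx1 := @congz_excl e (x + 1)%R i e1.
have yy := @congz_excl e (y - 1)%R i e1; rewrite subrK in yy.
have yy1 := @congz_excl e y i e1.
have swx : word_f e i w = None \/ exists w', word_f e i w = Some w'.
  by case: (word_f e i w) => [w'|]; [right; exists w' | left].
rewrite /=; case: (boolP (congz e y (x + 1)%R)) => yx.
  have c1 : congz e y i = congz e (x + 1)%R i by apply: congz_congr.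
  have c2 : congz e (y - 1)%R i = congz e x i.
    by apply: congz_congr; rewrite -(congzDr _ _ _ 1%R) subrK.
  have c3 : congz e (y + 1)%R i = congz e (x + 1 + 1)%R i by apply: congz_congr; rewrite congzDr.
  have n1 : congz e (y + 1)%R (x + 1)%R = false by apply: congz_excl.
  rewrite /eps_step /letter_add /letter_rem /=; rewrite /eps_step /letter_add /letter_rem /=; rewrite !addrK c1 c2 c3.
  split.
    move: xx xx1; case: (congz e x i); case: (congz e (x + 1)%R i);
      case: (congz e (x + 1 + 1)%R i) => /= A B;
      by [|have := A isT|have := B isT].
  case: (boolP (congz e x i)) => cx.
    rewrite (xx cx) /=; case: (congz e (x + 1 + 1)%R i) => /=;
    by case: swx => [->|[w' ->]] //=; rewrite yx.
  rewrite /=; case: (boolP (congz e (x + 1)%R i)) => cx1.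
    rewrite (xx1 cx1) /= /advance /= addrK.
    by case: eqP => _ /=; rewrite ?n1 //; case: swx => [->|[w' ->]] //=; rewrite yx.
  rewrite /=; case: (boolP (congz e (x + 1 + 1)%R i)) => cx2 /=;
  by case: swx => [->|[w' ->]] //=; rewrite yx.
have nad : congz e x i -> congz e (y - 1)%R i = false.
  move=> cx; apply: contraNF yx => cy; rewrite -(congzDr _ _ _ (-1)%R) addrK.
  by apply: congz_trans cy _; rewrite congz_sym.
have nbc : congz e (x + 1)%R i -> congz e y i = false.
  move=> cx; apply: contraNF yx => cy.
  by apply: congz_trans cy _; rewrite congz_sym.
have cyx : congz e x i -> congz e y x = congz e y i.
  by move=> cx; rewrite congz_sym (congz_sym _ y); apply: congz_congr.
rewrite /eps_step /letter_add /letter_rem /=; rewrite /eps_step /letter_add /letter_rem /=.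
split.
  move: xx yy nad nbc; case: (congz e x i); case: (congz e (x + 1)%R i);
    case: (congz e y i); case: (congz e (y - 1)%R i) => /= A B C D;
    by [|have := A isT|have := B isT|have := C isT|have := D isT].
case: (boolP (congz e x i)) => cx /=.
  rewrite (nad cx); case: (boolP (congz e y i)) => cy /=.
    case: eqP => [_|n0] /=; first by rewrite /advance /= subrK cyx // cy.
    have -> : (eps e i w == 0) = false by lia.
    by case: swx => [->|[w' ->]] //=; rewrite (negbTE yx).
  case: eqP => _ /=; rewrite /advance /= ?subrK ?cyx ?(negbTE cy) //.
  by case: swx => [->|[w' ->]] //=; rewrite (negbTE yx).
case: (boolP (congz e y i)) => cy /=; last first.
  by case: swx => [->|[w' ->]] //=; rewrite (negbTE yx).
have nb : congz e (x + 1)%R i = false by apply: contraTF cy => /nbc->.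
rewrite nb; case: eqP => _ /=.
  rewrite /advance /= congzDr ifF //; apply: contraNF cx => cyx'.
  by rewrite -(congz_congr _ cyx').
by case: swx => [->|[w' ->]] //=; rewrite (negbTE yx).
Qed.

Lemma word_f_kind e i w w' : word_f e i w = Some w' -> map fst w' = map fst w.
Proof.
elim: w w' => [//|L w IHw] w' /=; case: ifP => _; first by case=> <-.
by case E: (word_f e i w) => [w1|] //= [<-] /=; rewrite (IHw w1).
Qed.

Lemma odd_swap0_id e w : take 2 (map fst w) != [:: false; true] -> odd_swap e 0 w = w.
Proof. by case: w => [|[[] x] [|[[] y] w]] //=; rewrite take0. Qed.

Lemma odd_swap_equiv e i n w : 1 < e ->
  eps e i (odd_swap e n w) = eps e i w /\ word_f e i (odd_swap e n w) = omap (odd_swap e n) (word_f e i w).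
Proof.
move=> e1; elim: n w => [|n IHn] w.
  have [kd|kd] := boolP (take 2 (map fst w) != [:: false; true]).
    rewrite odd_swap0_id //; split=> //; case E: (word_f e i w) => [w'|] //.
    by apply/esym/(congr1 Some)/odd_swap0_id; rewrite (word_f_kind E).
  by case: w kd => [|[[] x] [|[[] y] w]] // _; apply: odd_swap_pair.
case: w => [//|L w] /=.
have [IH1 IH2] := IHn w; rewrite /eps /= -!/(eps _ _ _) IH1 IH2; split=> //.
by case: ifP => //= _; case: (word_f e i w).
Qed.

Definition odd_swaps e (ns : seq nat) (w : seq letter) := foldl (fun w n => odd_swap e n w) w ns.

Lemma odd_swaps_f e i ns w : 1 < e ->
  word_f e i (odd_swaps e ns w) = omap (odd_swaps e ns) (word_f e i w).
Proof.
move=> e1; elim: ns w => [|n ns IHns] w /=; first by case: (word_f _ _ _).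
by rewrite IHns (odd_swap_equiv i n w e1).2; case: (word_f e i w).
Qed.

Definition mirror_letter (L : letter) : letter := (~~ L.1, (- L.2)%R).

Lemma letter_add_neg e i L : letter_add e (- i) (mirror_letter L) = letter_add e i L.
Proof. by rewrite /letter_add /= congzN. Qed.

Lemma letter_rem_neg e i L : letter_rem e (- i) (mirror_letter L) = letter_rem e i L.
Proof.
rewrite /letter_rem; case: L => [[] x] /=.
  by rewrite (_ : (- x + 1 = - (x - 1))%R) ?congzN //; lia.
by rewrite (_ : (- x - 1 = - (x + 1))%R) ?congzN //; lia.
Qed.

Lemma eps_neg e i w : eps e (- i) (map mirror_letter w) = eps e i w.
Proof.
by rewrite /eps; elim: w => [//|L w IHw] /=; rewrite IHw /eps_step letter_add_neg letter_rem_neg.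
Qed.

Lemma advance_neg L : advance (mirror_letter L) = mirror_letter (advance L).
Proof. by case: L => [[] x]; rewrite /advance /mirror_letter /=; congr pair; lia. Qed.

Lemma word_f_neg e i w : word_f e (- i) (map mirror_letter w) = omap (map mirror_letter) (word_f e i w).
Proof.
elim: w => [//|L w IHw] /=; rewrite letter_add_neg eps_neg IHw advance_neg.
by case: ifP => _ //=; case: (word_f e i w).
Qed.

Lemma rev_iota_map T (f : nat -> T) n :
  [seq f s | s <- rev (iota 0 n)] = [seq f (n.-1 - j) | j <- iota 0 n].
Proof.
rewrite map_rev; apply: (@eq_from_nth _ (f 0)); rewrite size_rev !size_map size_iota //.
move=> i lt_i; rewrite nth_rev size_map size_iota //.
by rewrite !(nth_map 0) ?size_iota ?nth_iota //; [congr f|..]; lia.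
Qed.

(* The a rows of h, from bottom to top, preceded by b empty columns starting below them. *)
Definition row_word (a b : nat) (h : seq nat) : seq letter :=
  [seq (false, (s%:Z - a%:Z)%R) | s <- rev (iota 0 b)] ++
  [seq (true, ((part h r)%:Z - r%:Z)%R) | r <- rev (iota 0 a)].

(* The b rows of h become columns, preceded by a empty rows starting to the right of them. *)
Definition column_word (a b : nat) (h : seq nat) : seq letter := map mirror_letter (row_word b a h).

Lemma odd_swaps_cat e ns1 ns2 w : odd_swaps e (ns1 ++ ns2) w = odd_swaps e ns2 (odd_swaps e ns1 w).
Proof. exact: foldl_cat. Qed.

Lemma odd_swap_cat e pre n w : odd_swap e (size pre + n) (pre ++ w) = pre ++ odd_swap e n w.
Proof. by elim: pre => //= L pre ->. Qed.

(** Every swap is exceptional: it raises the column by one, which makes it exceptional for the next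
    row too. *)
Lemma odd_swaps_pass e k pre (c : int) tl : exists ns,
  odd_swaps e ns (pre ++ (false, c) :: [seq (true, (c + 1 + j%:Z)%R) | j <- iota 0 k] ++ tl)
  = pre ++ [seq (true, (c + 1 + 1 + j%:Z)%R) | j <- iota 0 k] ++ (false, (c + k%:Z)%R) :: tl.
Proof.
elim: k pre c => [|k IHk] pre c /=; first by exists [::]; rewrite /= addr0.
have [ns nsE] := IHk (rcons pre (true, (c + 1 + 1)%R)) (c + 1)%R.
exists (size pre :: ns) => /=.
rewrite -{1}(addn0 (size pre)) odd_swap_cat /= addr0 congz_refl.
have sh (d : int) : [seq (true, (d + j%:Z)%R) | j <- iota 1 k]
    = [seq (true, (d + 1 + j%:Z)%R) | j <- iota 0 k].
  rewrite (iotaDl 1 0) -map_comp; apply: eq_map => j /=; congr pair; lia.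
rewrite !sh; move: nsE; rewrite !cat_rcons /= => ->.
by rewrite addr0 (_ : c + 1 + k%:Z = c + k.+1%:Z)%R //; lia.
Qed.

Lemma odd_swaps_block e b k (c : int) tl : exists ns,
  odd_swaps e ns ([seq (false, (c + s%:Z)%R) | s <- rev (iota 0 b)]
     ++ [seq (true, (c + 1 + j%:Z)%R) | j <- iota 0 k] ++ tl)
  = [seq (true, (c + 1 + b%:Z + j%:Z)%R) | j <- iota 0 k]
     ++ [seq (false, (c + k%:Z + s%:Z)%R) | s <- rev (iota 0 b)] ++ tl.
Proof.
elim: b c tl => [|b IHb] c tl.
  by exists [::]; rewrite /= addr0.
have sh (d : int) : [seq (false, (d + s%:Z)%R) | s <- rev (iota 0 b.+1)]
    = rcons [seq (false, (d + 1 + s%:Z)%R) | s <- rev (iota 0 b)] (false, d).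
  rewrite /= rev_cons map_rcons addr0; congr rcons.
  rewrite (iotaDl 1 0) -map_rev -map_comp; apply: eq_map => j /=; congr pair; lia.
have [ns1 E1] := odd_swaps_pass e k [seq (false, (c + 1 + s%:Z)%R) | s <- rev (iota 0 b)] c tl.
have [ns2 E2] := IHb (c + 1)%R ((false, (c + k%:Z)%R) :: tl).
(* The column next to the rows passes first. It leaves all rows raised by one, which is the
   exceptional position for the next column, whose content is one larger. *)
exists (ns1 ++ ns2); rewrite odd_swaps_cat !sh !cat_rcons E1 E2.
congr (_ ++ (_ ++ _)); apply: eq_map => j; congr pair; lia.
Qed.

(** Fixes the list of swaps. It involves no partition except the empty one, which is why it can
    later be applied to every [row_word a b h]. *)
Lemma odd_swaps_vacuum e a b : exists ns, odd_swaps e ns (row_word a b [::]) = column_word a b [::].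
Proof.
have [ns nsE] := odd_swaps_block e b a (- a%:Z) [::]; exists ns.
move: nsE; rewrite !cats0 /row_word /column_word /row_word map_cat -!map_comp.
have E1 : [seq (false, (- a%:Z + s%:Z)%R) | s <- rev (iota 0 b)] =
   [seq (false, (s%:Z - a%:Z)%R) | s <- rev (iota 0 b)].
  by apply: eq_map => s; congr pair; lia.
have E2 : [seq (true, (- a%:Z + 1 + j%:Z)%R) | j <- iota 0 a] =
   [seq (true, ((part [::] r)%:Z - r%:Z)%R) | r <- rev (iota 0 a)].
  rewrite rev_iota_map; apply/eq_in_map => j; rewrite mem_iota => jb.
  by rewrite part_default //; congr pair; lia.
rewrite E1 E2 => ->; congr cat.
  rewrite rev_iota_map; apply/eq_in_map => j; rewrite mem_iota => jb.
  by rewrite /mirror_letter /=; congr pair; lia.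
by apply: eq_map => s; rewrite /mirror_letter /= part_default //; congr pair; lia.
Qed.

(** * Signatures read off rows *)

Lemma count_bij (S1 S2 : eqType) (V : eqType) (s : seq S1) (t : seq S2)
    (P : pred S1) (Q : pred S2) (f : S1 -> V) (g : S2 -> V) :
  uniq s -> uniq t -> injective f -> injective g ->
  (forall v, (exists2 x, x \in s & P x /\ v = f x) <->
             (exists2 y, y \in t & Q y /\ v = g y)) ->
  count P s = count Q t.
Proof.
move=> us ut fI gI E; rewrite -!size_filter -(size_map f) -(size_map g (filter Q t)).
apply/perm_size/uniq_perm; rewrite ?map_inj_uniq ?filter_uniq // => v.
apply/mapP/mapP => -[x]; rewrite mem_filter => /andP[Px xs] vE.
  have /E[y yt [Qy vE']] : exists2 x, x \in s & P x /\ v = f x by exists x.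
  by exists y => //; rewrite mem_filter Qy.
have /E[y yt [Qy vE']] : exists2 y, y \in t & Q y /\ v = g y by exists x.
by exists y => //; rewrite mem_filter Qy.
Qed.

Section RowCount.
Variables (e : nat) (h : seq nat) (x0 : int).
Hypotheses (e1 : 1 < e) (hp : is_part h).
Let B := maya h.

(* s = 0 selects pairs by their left bead, s = 1 by their right bead. *)
Definition count_rows (s : nat) (T : int -> bool) (ra rb : nat) : nat :=
  count (fun r => congz e (bead h r - s%:Z)%R x0 && T (bead h r - s%:Z)%R) (index_iota ra rb).

Lemma count_rows_up s (T : int -> bool) ra rb m :
  (forall r, congz e (bead h r - s%:Z)%R x0 -> T (bead h r - s%:Z)%R ->
    (ra <= r < rb) = (x0 < bead h r - s%:Z <= x0 + (e * m)%:Z)%R) ->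
  count_rows s T ra rb = count_up e (fun y => T y && B (y + s%:Z)%R) x0 m.
Proof.
move=> H; apply: (@count_bij _ _ _ _ _ _ _ (fun r => (bead h r - s%:Z)%R)
   (fun j : nat => (x0 + (e * j)%:Z)%R)); rewrite ?iota_uniq //.
- by move=> r r' E; apply: (bead_inj hp); lia.
- by move=> j j' /addrI E; nia.
move=> v; split=> -[].
  move=> r; rewrite mem_index_iota => rr [/andP[c Tr] ->].
  rewrite H // in rr; have [||j j0 jE] := @congz_gt e x0 _ _ c; try by lia.
  exists j; first by rewrite mem_iota; nia.
  by rewrite -jE Tr subrK /B maya_bead.
move=> j; rewrite mem_iota => jm [/andP[Tj /mayaP[r rE]] ->].
have E : (bead h r - s%:Z = x0 + (e * j)%:Z)%R by lia.
have c : congz e (bead h r - s%:Z)%R x0 by rewrite E congz_shift.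
exists r; last by rewrite c E Tj.
by rewrite mem_index_iota (H r c) E; [nia | exact: Tj].
Qed.

Lemma count_rows_dn s (T : int -> bool) ra rb m :
  (forall r, congz e (bead h r - s%:Z)%R x0 -> T (bead h r - s%:Z)%R ->
    (ra <= r < rb) = (x0 - (e * m)%:Z <= bead h r - s%:Z < x0)%R) ->
  count_rows s T ra rb = count_dn e (fun y => T y && B (y + s%:Z)%R) x0 m.
Proof.
move=> H; apply: (@count_bij _ _ _ _ _ _ _ (fun r => (bead h r - s%:Z)%R)
   (fun j : nat => (x0 - (e * j)%:Z)%R)); rewrite ?iota_uniq //.
- by move=> r r' E; apply: (bead_inj hp); lia.
- by move=> j j' /addrI E; nia.
move=> v; split=> -[].
  move=> r; rewrite mem_index_iota => rr [/andP[c Tr] ->].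
  rewrite H // in rr; have [||j j0 jE] := @congz_lt e x0 _ _ c; try by lia.
  exists j; first by rewrite mem_iota; nia.
  by rewrite -jE Tr subrK /B maya_bead.
move=> j; rewrite mem_iota => jm [/andP[Tj /mayaP[r rE]] ->].
have E : (bead h r - s%:Z = x0 - (e * j)%:Z)%R by lia.
have c : congz e (bead h r - s%:Z)%R x0 by rewrite E congz_shiftN.
exists r; last by rewrite c E Tj.
by rewrite mem_index_iota (H r c) E; [nia | exact: Tj].
Qed.

Lemma congz_excl1 x : congz e x x0 -> congz e (x - 1)%R x0 -> false.
Proof. by move=> c c'; have := congz_excl e1 c'; rewrite subrK c. Qed.

Lemma row_le (y : int) : exists r, forall s, (r <= s) = (bead h s <= y)%R.
Proof.
have ex : exists r, (bead h r <= y)%R.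
  by exists (size h + `|y|%N); rewrite bead_default; lia.
case: (ex_minnP ex) => r ler min_r; exists r => s; apply/idP/idP => [le|/min_r //].
by apply: le_trans ler; rewrite bead_leE.
Qed.

Section Up.
Variable r0 : nat.
Hypothesis H0 : forall r, (r < r0) = (x0 + 1 < bead h r)%R.

(** One cut of the rows, at bead x0 + e m + 1, serves both kinds of pairs. For pairs selected by
    their left bead it is off by one at either end, but beads at x0 + 1 and x0 + e m + 1 are not in
    the class of x0. *)
Lemma up_rows m (T0 T1 : int -> bool) : exists2 r1, r1 <= r0 &
  [/\ count_rows 0 T0 r1 r0 = count_up e (fun y => T0 y && B y) x0 m,
      count_rows 1 T1 r1 r0 = count_up e (fun y => T1 y && B (y + 1)%R) x0 m &
      forall r, r < r0 -> (r1 <= r) = (bead h r <= x0 + (e * m)%:Z + 1)%R].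
Proof.
have [r1 r1P] := row_le (x0 + (e * m)%:Z + 1)%R; exists (minn r1 r0).
  exact: geq_minr.
have r1P' r : (minn r1 r0 <= r < r0) = (bead h r <= x0 + (e * m)%:Z + 1)%R && (x0 + 1 < bead h r)%R.
  by have := r1P r; have := H0 r; lia.
split; last by (move=> r lt_r; have := r1P' r; have := H0 r; lia).
all: rewrite (@count_rows_up _ _ _ _ m); do ?[by apply: eq_count_up => j _; rewrite addr0];
  do ?[by apply: eq_count_up => j _].
  move=> r c _; rewrite r1P'; rewrite subr0 in c *.
  case: (bead h r =P x0 + 1)%R => [E|]; first by have := congz_excl1 c; rewrite E addrK congz_refl => /(_ isT).
  case: (bead h r =P x0 + (e * m)%:Z + 1)%R => [E|]; last by lia.
  by have := congz_excl1 c; rewrite E addrK congz_shift => /(_ isT).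
by move=> r c _; rewrite r1P'; lia.
Qed.

Lemma up_rows_signs r1 : r1 <= r0 -> exists m,
  count_rows 0 (fun y => ~~ B (y + 1)%R) r1 r0 = count_up e (addable B) x0 m /\
  count_rows 1 (fun y => ~~ B y) r1 r0 = count_up e (removable B) x0 m.
Proof.
move=> le_r.
have [->|ne_r] := eqVneq r1 r0.
  by exists 0; rewrite /count_rows /index_iota subnn.
have lt_r : r1 < r0 by lia.
pose d := `|(bead h r1 - x0)%R|%N; exists (d %/ e).
have dE : (bead h r1 = x0 + d%:Z)%R by move: lt_r; rewrite H0 /d; lia.
have := leq_trunc_div d e; have := ltn_ceil d (ltnW e1); move: (d %/ e) => m m1 m2.
split; rewrite (@count_rows_up _ _ _ _ m).
- by apply: eq_count_up => j _; rewrite /addable addr0 andbC.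
- move=> r; rewrite subr0 => c _; have := H0 r; rewrite -(bead_leE r1 r hp) => ->.
  have [lt|le] := ltrP x0 (bead h r); last by lia.
  have [j j0 jE] := congz_gt (ltnW e1) c lt; rewrite jE dE.
  case: (bead h r =P x0 + 1)%R => [E|]; first by have := congz_excl1 c; rewrite E addrK congz_refl => /(_ isT).
  have jm : (e * j <= d) = (j <= m) by apply/idP/idP => ?; nia.
  have jm' : (e * j <= e * m) = (j <= m) by rewrite leq_pmul2l //; lia.
  by lia.
- by apply: eq_count_up => j _; rewrite /removable.
move=> r c nB; have := H0 r; rewrite -(bead_leE r1 r hp) => ->.
(* The cut is now given by a row, and the two kinds of pairs could need different m only if row r
   has its bead just above that of row r1. Then its node is not removable and is not counted. *)
case: (bead h r =P bead h r1 + 1)%R => [E|ne].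
  by move: nB; rewrite E addrK /B maya_bead.
have [lt|le] := ltrP x0 (bead h r - 1%:Z)%R; last by lia.
have [j j0 jE] := congz_gt (ltnW e1) c lt.
have jm : (e * j < d) = (j <= m).
  by case: (e * j =P d) => [E|?]; [case: ne; rewrite dE; lia | apply/idP/idP => ?; nia].
have jm' : (e * j <= e * m) = (j <= m) by rewrite leq_pmul2l //; lia.
by lia.
Qed.

End Up.

Section Down.
Variable r0 : nat.
Hypothesis H0 : forall r, (r0 < r) = (bead h r < x0)%R.

Lemma dn_rows m (T0 T1 : int -> bool) : exists2 r1, r0 < r1 &
  count_rows 0 T0 r0.+1 r1 = count_dn e (fun y => T0 y && B y) x0 m /\
  count_rows 1 T1 r0.+1 r1 = count_dn e (fun y => T1 y && B (y + 1)%R) x0 m.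
Proof.
have [r1 r1P] := row_le (x0 - (e * m)%:Z - 1)%R; exists (maxn r1 r0.+1).
  exact: leq_maxr.
have r1P' r : (r0 < r < maxn r1 r0.+1) = (x0 - (e * m)%:Z <= bead h r)%R && (bead h r < x0)%R.
  by have := r1P r; have := H0 r; lia.
split; rewrite (@count_rows_dn _ _ _ _ m); do ?[by apply: eq_count_dn => j _; rewrite addr0];
  do ?[by apply: eq_count_dn => j _].
  by move=> r c _; rewrite r1P' subr0.
move=> r c _; rewrite r1P'.
case: (bead h r =P x0)%R => [E|].
  by have := @congz_excl1 (bead h r); rewrite c {1}E congz_refl => /(_ isT isT).
case: (bead h r =P x0 - (e * m)%:Z)%R => [E|]; last by lia.
by have := @congz_excl1 (bead h r); rewrite c {1}E congz_shiftN => /(_ isT isT).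
Qed.

Lemma dn_rows_signs r1 : r0 < r1 -> exists m,
  count_rows 0 (fun y => ~~ B (y + 1)%R) r0.+1 r1 = count_dn e (addable B) x0 m /\
  count_rows 1 (fun y => ~~ B y) r0.+1 r1 = count_dn e (removable B) x0 m.
Proof.
case: r1 => // r1; rewrite ltnS => le_r.
have [->|ne_r] := eqVneq r1 r0.
  by exists 0; rewrite /count_rows /index_iota subnn.
have lt_r : r0 < r1 by lia.
pose d := `|(bead h r1 - 1 - x0)%R|%N; exists (d %/ e).
have dE : (bead h r1 = x0 - d%:Z + 1)%R by move: lt_r; rewrite H0 /d; lia.
have := leq_trunc_div d e; have := ltn_ceil d (ltnW e1); move: (d %/ e) => m m1 m2.
split; rewrite (@count_rows_dn _ _ _ _ m).
- by apply: eq_count_dn => j _; rewrite /addable addr0 andbC.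
- move=> r; rewrite subr0 => c nB; have := H0 r; rewrite ltnS -(bead_leE r r1 hp) => ->.
  case: (bead h r =P bead h r1 - 1)%R => [E|ne].
    by move: nB; rewrite E subrK /B maya_bead.
  have [lt|le] := ltrP (bead h r) x0; last by lia.
  have [j j0 jE] := congz_lt (ltnW e1) c lt.
  have jm : (e * j < d) = (j <= m).
    by case: (e * j =P d) => [E|?]; [case: ne; rewrite dE; lia | apply/idP/idP => ?; nia].
  have jm' : (e * j <= e * m) = (j <= m) by rewrite leq_pmul2l //; lia.
  by lia.
- by apply: eq_count_dn => j _; rewrite /removable.
move=> r c nB; have := H0 r; rewrite ltnS -(bead_leE r r1 hp) => ->.
case: (bead h r =P x0)%R => [E|ne].
  by have := @congz_excl1 (bead h r); rewrite c {1}E congz_refl => /(_ isT isT).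
have [lt|le] := ltrP (bead h r - 1%:Z)%R x0; last by lia.
have [j j0 jE] := congz_lt (ltnW e1) c lt.
have jm : (e * j <= d) = (j <= m) by apply/idP/idP => ?; nia.
have jm' : (e * j <= e * m) = (j <= m) by rewrite leq_pmul2l //; lia.
by lia.
Qed.

End Down.
End RowCount.

(** [eps] is the maximum, over prefixes, of the number of removable minus the number of addable
    letters. The bound n varies because the first letter shifts it by one. *)
Lemma eps_leP e i w n : 1 < e -> (eps e i w <= n) <->
  (forall k, count (letter_rem e i) (take k w) <= count (letter_add e i) (take k w) + n).
Proof.
move=> e1; elim: w n => [|L w IHw] n; first by split.
have disj : letter_add e i L -> letter_rem e i L = false.
  case: L => [[] x]; rewrite /letter_add /letter_rem /= => c; last exact: congz_excl c.
  by apply/negP => c'; have := congz_excl e1 c'; rewrite subrK c.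
rewrite /eps /= -/(eps _ _ _) /eps_step; split=> H.
  case=> [//|k] /=; case: (letter_add _ _ _) H disj => H disj.
    have /IHw/(_ k) : eps e i w <= n.+1 by lia.
    by rewrite disj //; lia.
  case: (letter_rem _ _ _) H => H; last by have /IHw/(_ k) := H; lia.
  have /IHw/(_ k) : eps e i w <= n.-1 by lia.
  by lia.
have {H} [H H0] := (fun k => H k.+1, H 0); move: H => /=.
case: (letter_add _ _ _) disj => disj H.
  suff /IHw : forall k, count (letter_rem e i) (take k w) <= count (letter_add e i) (take k w) + n.+1 by lia.
  by move=> k; have := H k; rewrite disj //; lia.
case: (letter_rem _ _ _) H => H; last by apply/IHw => k; have := H k; lia.
have n0 : 0 < n by have := H 0; rewrite !take0 /=; lia.
suff /IHw : forall k, count (letter_rem e i) (take k w) <= count (letter_add e i) (take k w) + n.-1 by lia.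
by move=> k; have := H k; lia.
Qed.

Lemma eps_congr e i i' w : congz e i i' -> eps e i w = eps e i' w.
Proof.
move=> c; have E x : congz e x i = congz e x i'.
  by rewrite ![congz e x _]congz_sym; apply: congz_congr.
by rewrite /eps; elim: w => [//|L w IHw] /=; rewrite IHw /eps_step /letter_add /letter_rem !E.
Qed.

Definition row_letter (h : seq nat) (r : nat) : letter := (true, ((part h r)%:Z - r%:Z)%R).
Definition row_letters (h : seq nat) (n : nat) := [seq row_letter h r | r <- rev (iota 0 n)].

Lemma rowsS h n : row_letters h n.+1 = row_letter h n :: row_letters h n.
Proof. by rewrite /row_letters -addn1 iotaD rev_cat /= add0n. Qed.

Lemma letter_add_row e h r x : letter_add e (x + 1)%R (row_letter h r) = congz e (bead h r) x.
Proof. by rewrite /letter_add /= -(congzDr e _ x 1%R) /bead; congr congz; lia. Qed.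

Lemma letter_rem_row e h r x : letter_rem e (x + 1)%R (row_letter h r) = congz e (bead h r - 1)%R x.
Proof. by rewrite /letter_rem /= -(congzDr e _ x 1%R) /bead; congr congz; lia. Qed.

Lemma take_rows h n k : k <= n ->
  take k (row_letters h n) = [seq row_letter h r | r <- rev (index_iota (n - k) n)].
Proof.
move=> le; rewrite /row_letters -map_take take_rev size_iota /index_iota.
by rewrite drop_iota add0n.
Qed.

Lemma eps_rowsP e h r0 x : 1 < e -> eps e (x + 1)%R (row_letters h r0) = 0 <->
  (forall r1, r1 <= r0 -> count_rows e h x 1 xpredT r1 r0 <= count_rows e h x 0 xpredT r1 r0).
Proof.
move=> e1; have := eps_leP (x + 1)%R (row_letters h r0) 0 e1; rewrite leqn0.
have E k : k <= r0 -> count (letter_rem e (x + 1)%R) (take k (row_letters h r0))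
    = count_rows e h x 1 xpredT (r0 - k) r0 /\
    count (letter_add e (x + 1)%R) (take k (row_letters h r0)) = count_rows e h x 0 xpredT (r0 - k) r0.
  move=> le; rewrite take_rows // !count_map !count_rev; split; apply: eq_count => r /=.
    by rewrite letter_rem_row andbT.
  by rewrite letter_add_row andbT subr0.
move=> [H1 H2]; split=> [/eqP/H1 H r1 le|H].
  have := H (r0 - r1); case: (E (r0 - r1)); first by lia.
  by move=> -> ->; rewrite subKn // addn0.
apply/eqP/H2 => k; rewrite addn0; have [le|lt] := leqP k r0.
  by case: (E k le) => -> ->; apply: H; lia.
have sz : size (row_letters h r0) = r0 by rewrite size_map size_rev size_iota.
rewrite take_oversize ?sz; last by lia.
have [] := E r0 (leqnn _); rewrite take_oversize ?sz // => -> ->.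
by apply: H; lia.
Qed.

Lemma count_rows_mono e h x s T r1 r1' r0 : r1 <= r1' <= r0 ->
  count_rows e h x s T r1' r0 <= count_rows e h x s T r1 r0.
Proof.
move=> /andP[le1 le2]; rewrite /count_rows [in leqRHS]/index_iota.
have -> : r0 - r1 = (r1' - r1) + (r0 - r1') by lia.
by rewrite iotaD count_cat subnKC // leq_addl.
Qed.

(** The nonexistent nodes of the row letters come from adjacent pairs of beads; each such pair
    enters both counts of letters, so the differences agree with those of genuine nodes. *)
Lemma count_up_addable_removable e B x m :
  count_up e (removable B) x m + count_up e B x m = count_up e (addable B) x m + count_up e (fun y => B (y + 1)%R) x m.
Proof.
rewrite /count_up; elim: (iota 1 m) => //= j s IHs.
by rewrite /addable /removable in IHs *; move: IHs; case: (B _); case: (B _) => /=; lia.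
Qed.

Section RowSignature.
Variables (e : nat) (h : seq nat).
Hypotheses (e1 : 1 < e) (hp : is_part h).

Lemma rows_above_addable r0 : ~~ maya h (bead h r0 + 1)%R ->
  forall r, (r < r0) = (bead h r0 + 1 < bead h r)%R.
Proof.
move=> nB r; rewrite -(bead_ltE _ _ hp).
case: (bead h r =P bead h r0 + 1)%R => [E|]; last by lia.
by rewrite -E maya_bead in nB.
Qed.

Lemma eps_rows_up r0 : eps e (bead h r0 + 1)%R (row_letters h r0) = 0 <->
  addable (maya h) (bead h r0) /\ up_le e (removable (maya h)) (addable (maya h)) (bead h r0).
Proof.
rewrite eps_rowsP //; split=> [H|[A U] r1 le].
  (* Otherwise the row just above has the same length, and its removable letter has the residue in
     question with nothing before it to cancel it. *)
  have nB : ~~ maya h (bead h r0 + 1)%R.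
    apply/mayaP => -[r rE].
    have lt : r < r0 by rewrite -(bead_ltE _ _ hp); lia.
    have rr : r0 = r.+1.
      apply/eqP; rewrite eqn_leq lt andbT leqNgt; apply/negP => lt'.
      by have := bead_lt hp lt'; have := bead_lt hp (ltnSn r); lia.
    subst r0; have := H r (leqnSn r); rewrite /count_rows /index_iota subSnn /= -rE.
    rewrite addrK congz_refl subr0.
    by rewrite (_ : congz _ _ _ = false) //; apply: congz_excl; rewrite ?congz_refl.
  split; first by rewrite /addable maya_bead.
  move=> m; have [r1 le [E0 E1 _]] := up_rows e1 hp (rows_above_addable nB) m xpredT xpredT.
  have {}E0 : count_rows e h (bead h r0) 0 xpredT r1 r0 = count_up e (maya h) (bead h r0) m := E0.
  have {}E1 : count_rows e h (bead h r0) 1 xpredT r1 r0 =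
    count_up e (fun y => maya h (y + 1)%R) (bead h r0) m := E1.
  by have := H r1 le; rewrite E0 E1; have := count_up_addable_removable e (maya h) (bead h r0) m; lia.
have nB : ~~ maya h (bead h r0 + 1)%R by case/andP: A.
have [->|ne_r] := eqVneq r1 r0; first by rewrite /count_rows /index_iota subnn.
have lt_r : r1 < r0 by lia.
have H0 := rows_above_addable nB.
pose d := `|(bead h r1 - bead h r0 - 1)%R|%N.
have dE : (bead h r1 = bead h r0 + d%:Z + 1)%R by move: lt_r; rewrite H0 /d; lia.
have := leq_trunc_div d e; have := ltn_ceil d (ltnW e1).
move: (d %/ e) dE => m dE m1 m2.
(* The removable letters of rows r1 to r0 are those of m full steps. The addable letters of m steps
   fill only rows r2 to r0, possibly fewer rows, which is the harmless direction. *)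
have [r2 le2 [E0 _ r2P]] := up_rows e1 hp H0 m xpredT xpredT.
have r12 : r1 <= r2.
  rewrite leqNgt; apply/negP => lt21; have := r2P r2; rewrite leqnn.
  move=> /(_ (ltn_trans lt21 lt_r))/esym; have := bead_lt hp lt21; lia.
have E1 : count_rows e h (bead h r0) 1 xpredT r1 r0 =
    count_up e (fun y => maya h (y + 1)%R) (bead h r0) m.
  apply: count_rows_up => // r c _; rewrite (H0 r) -(bead_leE r1 r hp).
  have [lt|le'] := ltrP (bead h r0) (bead h r - 1%:Z)%R; last by lia.
  have [j j0 jE] := congz_gt (ltnW e1) c lt.
  have jm : (e * j <= d) = (j <= m) by apply/idP/idP => ?; nia.
  have jm' : (e * j <= e * m) = (j <= m) by rewrite leq_pmul2l //; lia.
  by lia.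
rewrite E1; apply: leq_trans (@count_rows_mono _ _ _ _ _ r1 r2 r0 _); last by rewrite r12.
have {}E0 : count_rows e h (bead h r0) 0 xpredT r2 r0 = count_up e (maya h) (bead h r0) m := E0.
by rewrite E0; have := U m; have := count_up_addable_removable e (maya h) (bead h r0) m; lia.
Qed.

(** Vanishing of [eps] is the upper half of [balanced]; by [lowest_dn] and [up_dn_exclusive] the
    lower half means being the lowest such row of the class. *)
Lemma fstep_rowP r : fstep e (bead h r) (maya h) <->
  eps e (bead h r + 1)%R (row_letters h r) = 0 /\
  (forall r', r < r' -> congz e (bead h r') (bead h r) ->
     eps e (bead h r + 1)%R (row_letters h r') <> 0).
Proof.
have tr r' : congz e (bead h r') (bead h r) ->
    eps e (bead h r + 1)%R (row_letters h r') = eps e (bead h r' + 1)%R (row_letters h r').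
  by move=> c; apply: eps_congr; rewrite congzDr congz_sym.
split=> [[A [U D]]|[/eps_rows_up[A U] low]].
  split; first by apply/eps_rows_up.
  move=> r' lt c; rewrite tr // => /eps_rows_up[A' U'].
  have [j j0 jE] := congz_lt (ltnW e1) c (bead_lt hp lt); rewrite jE in A' U'.
  by apply: (up_dn_exclusive j0 A' (addable_removable A') U' D).
split=> //; split=> //; apply: lowest_dn => //; first exact: addable_removable.
move=> j j0 A' U'; have [r' rE] := addable_posP hp A'.
have c : congz e (bead h r') (bead h r) by rewrite -rE congz_shiftN.
apply: (low r') => //; first by rewrite -(bead_ltE _ _ hp) -rE; nia.
by rewrite tr //; apply/eps_rows_up; rewrite -rE.
Qed.

Lemma word_f_rows t n : match word_f e t (row_letters h n) with
  | Some w => exists2 r, [/\ r < n, congz e (bead h r + 1)%R t, eps e t (row_letters h r) = 0 &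
       forall r', r < r' < n -> congz e (bead h r' + 1)%R t -> eps e t (row_letters h r') <> 0] &
       w = row_letters (incr_nth h r) n
  | None => forall r, r < n -> congz e (bead h r + 1)%R t -> eps e t (row_letters h r) <> 0
  end.
Proof.
have sAE r : letter_add e t (row_letter h r) = congz e (bead h r + 1)%R t.
  by rewrite -(subrK 1%R t) letter_add_row congzDr.
elim: n => [//|n IHn]; rewrite rowsS /= sAE.
case: ifP => [/andP[c /eqP e0]|nc].
  exists n.
    by split=> // r' /andP[lt]; rewrite ltnS leqNgt lt.
  rewrite rowsS; congr cons.
    by rewrite /advance /row_letter /= part_incr eqxx; congr pair; lia.
  apply/eq_in_map => r; rewrite mem_rev mem_iota => lt.
  by rewrite /row_letter part_incr (_ : (r == n) = false) ?addn0 //; lia.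
case: (word_f e t (row_letters h n)) IHn => [w|] /= IHn.
  have [r [lt c e0 low] ->] := IHn; exists r.
    split=> //; first exact: ltnW.
    move=> r' /andP[lt']; rewrite ltnS leq_eqVlt => /orP[/eqP->|lt''] c'.
      by move: nc; rewrite c' /= => /eqP.
    by apply: low => //; rewrite lt'.
  rewrite rowsS /row_letter part_incr (_ : (n == r) = false) ?addn0 //; lia.
move=> r; rewrite ltnS leq_eqVlt => /orP[/eqP-> c|lt c]; last exact: IHn.
by move: nc; rewrite c /= => /eqP.
Qed.

Lemma word_f_init t a b : 0 < a -> part h a.-1 = 0 ->
  word_f e t (row_word a b h) = omap (cat [seq (false, (s%:Z - a%:Z)%R) | s <- rev (iota 0 b)])
     (word_f e t (row_letters h a)).
Proof.
move=> a0 h0; rewrite /row_word -[X in _ ++ X]/(row_letters h a).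
(* Strengthened for the induction: the next column to be prepended has as addable residue the
   removable residue of the current leftmost letter (at first an empty row), so [eps] is positive
   and [word_f] skips it. *)
suff [_ ->] : (congz e (b%:Z - a%:Z)%R t -> 0 < eps e t
    ([seq (false, (s%:Z - a%:Z)%R) | s <- rev (iota 0 b)] ++ row_letters h a)) /\
  word_f e t ([seq (false, (s%:Z - a%:Z)%R) | s <- rev (iota 0 b)] ++ row_letters h a) =
  omap (cat [seq (false, (s%:Z - a%:Z)%R) | s <- rev (iota 0 b)]) (word_f e t (row_letters h a)) by [].
elim: b => [|b [IH1 IH2]].
  split; last by case: (word_f _ _ _).
  move=> c /=; case: a a0 h0 c => // a _ h0 c.
  rewrite rowsS /eps /= /eps_step /letter_add /letter_rem /= h0.
  have c' : congz e (0%:Z - a%:Z - 1)%R t by rewrite (_ : (0 - a%:Z - 1 = 0 - a.+1%:Z)%R) //; lia.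
  by rewrite c' (_ : congz e (0%:Z - a%:Z)%R t = false) //; have := congz_excl e1 c'; rewrite subrK.
rewrite -[b.+1]addn1 iotaD rev_cat /= add0n; split.
  move=> c; rewrite /eps /= /eps_step /letter_add /letter_rem /=.
  have c' : congz e (b%:Z - a%:Z + 1)%R t by rewrite (_ : b%:Z - a%:Z + 1 = (b + 1)%:Z - a%:Z)%R //; lia.
  rewrite c' (_ : congz e (b%:Z - a%:Z)%R t = false) //.
  by apply/negP => c''; have := congz_excl e1 c''; rewrite c'.
rewrite IH2 /letter_add /=; case: ifP => [/andP[/IH1 lt /eqP e0]|_]; first by rewrite e0 in lt.
by case: (word_f _ _ _).
Qed.

Lemma fstep_word_f x a b : size h < a -> fstep e x (maya h) ->
  exists2 r, x = bead h r &
   word_f e (x + 1)%R (row_word a b h) = Some (row_word a b (incr_nth h r)).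
Proof.
move=> lt_a st; have [A _] := st; have [r xE] := addable_posP hp A; subst x.
exists r => //; rewrite word_f_init; [|by lia | by rewrite part_default; lia].
have [e0 low] := (fstep_rowP r).1 st; have := word_f_rows (bead h r + 1)%R a.
have lt_r : r < a by apply: leq_ltn_trans lt_a; apply: addable_row_le.
case: (word_f _ _ _) => [w [r' [lt' c' e0' low'] ->]|/(_ r lt_r)]; last first.
  by rewrite congz_refl => /(_ isT).
suff -> : r' = r by [].
case: (ltngtP r r') => // lt.
  by have := low r' lt; rewrite -(congzDr _ _ _ 1%R) c' e0' => /(_ isT).
by have := low' r; rewrite lt lt_r congz_refl e0 => /(_ isT isT).
Qed.

Lemma word_f_step t a b w : size h < a -> word_f e t (row_word a b h) = Some w ->
  exists2 r, fstep e (bead h r) (maya h) & congz e (bead h r + 1)%R t.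
Proof.
move=> lt_a; rewrite word_f_init; [|by lia | by rewrite part_default; lia].
have := word_f_rows t a; case: (word_f _ _ _) => [_ [r [lt_r c e0 low] _] _|//].
exists r => //; apply/fstep_rowP.
have tr w' : eps e (bead h r + 1)%R w' = eps e t w' by apply: eps_congr.
split; first by rewrite tr.
move=> r' lt c'; rewrite tr => e0'.
have c'' : congz e (bead h r' + 1)%R t by apply: congz_trans c; rewrite congzDr.
have [lt'|ge'] := ltnP r' a; first by apply: (low r'); rewrite ?lt.
have : eps e (bead h r' + 1)%R (row_letters h r') = 0 by rewrite (eps_congr _ c'').
by move/eps_rows_up => [/(addable_row_le hp)]; lia.
Qed.

End RowSignature.

(** * The signed automorphism *)

(* Two paths from the empty partition with opposite residues. Since [B] and [D] both live in the
   restricted crystal, [reach e (maya h) (maya k)] means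
   [mullineux e (conj h) = conj k]. *)
Inductive reach (e : nat) : (int -> bool) -> (int -> bool) -> Prop :=
| reach_vacuum : reach e vacuum vacuum
| reach_step B D x y : reach e B D -> fstep e x B -> fstep e y D ->
    congz e (x + y + 2)%R 0%R -> reach e (swap x B) (swap y D).

Lemma reach_sym e B D : reach e B D -> reach e D B.
Proof.
elim=> [|{}B {}D x y _ IH sx sy xy]; first exact: reach_vacuum.
by apply: reach_step => //; rewrite [(y + x)%R]addrC.
Qed.

Lemma size_sumn h : is_part h -> size h <= sumn h.
Proof.
case/andP=> _; elim: h => //= x h IHh /andP[x0 /IHh le]; lia.
Qed.

Lemma word_f_congr e i i' w : congz e i i' -> word_f e i w = word_f e i' w.
Proof.
move=> c; have E x : congz e x i = congz e x i'.
  by rewrite ![congz e x _]congz_sym; apply: congz_congr.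
by elim: w => [//|L w IHw] /=; rewrite IHw /letter_add E (eps_congr _ c).
Qed.

Lemma mirror_letterK : cancel mirror_letter mirror_letter.
Proof. by case=> b x; rewrite /mirror_letter /= negbK opprK. Qed.

Lemma congz_opp2 e x y : congz e (x + y + 2)%R 0%R = congz e (x + 1)%R (- (y + 1))%R.
Proof. by rewrite /congz; congr (_ %| _)%Z; lia. Qed.

Lemma word_f_final e t a b h : word_f e t (column_word a b h) = omap (map mirror_letter) (word_f e (- t)%R (row_word b a h)).
Proof. by rewrite -word_f_neg opprK. Qed.

Section Reach.
Variable e : nat.
Hypothesis e1 : 1 < e.

(** The invariant behind path independence: swaps commute with [word_f], so a list that is right for
    the empty partition remains right after each pair of steps. Large a and b keep the truncation of
    the words out of sight. *)
Lemma reach_words B D : reach e B D -> exists h k,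
  [/\ is_part h, is_part k, B = maya h, D = maya k & sumn h = sumn k] /\
  forall a b ns, sumn h < a -> sumn k < b ->
   odd_swaps e ns (row_word a b [::]) = column_word a b [::] -> odd_swaps e ns (row_word a b h) = column_word a b k.
Proof.
elim=> [|{}B {}D x y _ [h [k [[hp kp -> -> sm] bub]]] sx sy xy].
  by exists [::], [::]; rewrite maya_vacuum; split.
have [Ax _] := sx; have [Ay _] := sy.
have [r xE] := addable_posP hp Ax; have [s yE] := addable_posP kp Ay; subst x y.
exists (incr_nth h r), (incr_nth k s); rewrite !sumn_incr; split.
  by split; rewrite ?is_part_incr ?swap_add_node ?sm.
move=> a b ns lta ltb vacuumE.
have := @odd_swaps_f e (bead h r + 1)%R ns (row_word a b h) e1.
rewrite (bub a b ns) //; try by lia.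
have szh := size_sumn hp; have szk := size_sumn kp.
have [|r' /(bead_inj hp) <- ->] := @fstep_word_f e h e1 hp _ a b _ sx; first by lia.
have [|s' /(bead_inj kp) <- Fk] := @fstep_word_f e k e1 kp _ b a _ sy; first by lia.
rewrite word_f_final (@word_f_congr _ _ (bead k s + 1)%R) ?Fk /=; last first.
  by move: xy; rewrite congz_opp2 -congzN opprK.
by case.
Qed.

Lemma reach_parts B D : reach e B D -> exists h k,
  [/\ is_part h, is_part k, B = maya h, D = maya k & sumn h = sumn k].
Proof. by case/reach_words => h [k [H _]]; exists h, k. Qed.

Lemma column_word_inj a b h k : is_part h -> is_part k -> sumn h < b -> sumn k < b ->
  column_word a b h = column_word a b k -> h = k.
Proof.
move=> hp kp lth ltk /(inj_map (can_inj mirror_letterK)) /eqP.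
rewrite /row_word eqseq_cat ?size_map // => /andP[_ /eqP E].
have := size_sumn hp; have := size_sumn kp => szk szh.
apply: is_part_inj => // r; have [lt|ge] := ltnP r b; last by rewrite !part_default //; lia.
have /eq_in_map/(_ r) := E; rewrite mem_rev mem_iota lt => /(_ isT)[]; lia.
Qed.

(** The same swaps applied to the same row word give one column word, and this determines the
    partner. *)
Lemma reach_fun B D D' : reach e B D -> reach e B D' -> D = D'.
Proof.
move=> /reach_words[h [k [[hp kp -> -> sm] bub]]].
move=> /reach_words[h' [k' [[hp' kp' hE -> sm'] bub']]].
have hh := maya_inj hp hp' hE; subst h'.
have [ns nsE] := odd_swaps_vacuum e (sumn h).+1 (sumn h).+1.
congr maya; apply: (@column_word_inj (sumn h).+1 (sumn h).+1) => //; try by lia.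
by rewrite -(bub _ _ ns) -?(bub' _ _ ns) //; lia.
Qed.

(** If [word_f] is defined on the row word, it is defined on the swapped word, so the partner has a
    matching node. *)
Lemma reach_step_ex B D x : reach e B D -> fstep e x B ->
  exists2 y, fstep e y D & congz e (x + y + 2)%R 0%R.
Proof.
move=> /reach_words[h [k [[hp kp -> -> sm] bub]]] sx.
have [ns nsE] := odd_swaps_vacuum e (sumn h).+1 (sumn h).+1.
have szh := size_sumn hp; have szk := size_sumn kp.
have := @odd_swaps_f e (x + 1)%R ns (row_word (sumn h).+1 (sumn h).+1 h) e1.
rewrite (bub _ _ ns) //; try by lia.
have [|r _ ->] := @fstep_word_f e h e1 hp x (sumn h).+1 (sumn h).+1 _ sx; first by lia.
rewrite word_f_final; case E: (word_f _ _ _) => [w|//] _.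
have [|s ss c] := @word_f_step e k e1 kp _ _ _ _ _ E; first by lia.
by exists (bead k s) => //; rewrite congz_opp2 congz_sym -congzN opprK.
Qed.

Lemma reach_restr B D : reach e B D -> restrictedM e B.
Proof.
elim=> [|{}B {}D x y _ rB sx _ _]; last exact: restrictedM_step.
by move=> p; rewrite /vacuum => p0; exists 1; lia.
Qed.

End Reach.

(** * Good and cogood nodes in rows compared with steps on diagrams *)

Lemma modn_congz e N i : i < e -> (N %% e == i) = congz e N%:Z i%:Z.
Proof.
by move=> lt; rewrite /congz -eqz_mod_dvd !modz_nat (modn_small lt) eqz_nat.
Qed.

Lemma count_up_removable_mirror e B x m : count_up e (removable (mirror B)) (- 2 - x)%R m = count_dn e (removable B) x m.
Proof.
by apply: eq_count => j; rewrite -(removable_mirror B); congr removable; lia.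
Qed.

Lemma count_up_addable_mirror e B x m : count_up e (addable (mirror B)) (- 2 - x)%R m = count_dn e (addable B) x m.
Proof.
by apply: eq_count => j; rewrite -(addable_mirror B); congr addable; lia.
Qed.

Lemma count_dn_removable_mirror e B x m : count_dn e (removable (mirror B)) (- 2 - x)%R m = count_up e (removable B) x m.
Proof.
by apply: eq_count => j; rewrite -(removable_mirror B); congr removable; lia.
Qed.

Lemma count_dn_addable_mirror e B x m : count_dn e (addable (mirror B)) (- 2 - x)%R m = count_up e (addable B) x m.
Proof.
by apply: eq_count => j; rewrite -(addable_mirror B); congr addable; lia.
Qed.

Lemma filter_iota_head (P : pred nat) n r s : [seq x <- iota 0 n | P x] = r :: s ->
  [/\ r < n, P r & forall r', r' < r -> ~~ P r'].
Proof.
move=> E; have : r \in [seq x <- iota 0 n | P x] by rewrite E mem_head.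
rewrite mem_filter mem_iota => /andP[Pr lt]; split=> // r' lt'.
apply/negP => Pr'; have : r' \in r :: s by rewrite -E mem_filter Pr' mem_iota; lia.
have : sorted ltn (r :: s).
  by rewrite -E; apply: sorted_filter; [exact: ltn_trans | exact: iota_ltn_sorted].
move/(order_path_min ltn_trans)/allP => H; rewrite inE => /orP[|/H] /=; lia.
Qed.

Lemma filter_iota_last (P : pred nat) n r s : [seq x <- iota 0 n | P x] = rcons s r ->
  [/\ r < n, P r & forall r', r < r' < n -> ~~ P r'].
Proof.
move=> E; have : r \in [seq x <- iota 0 n | P x] by rewrite E mem_rcons mem_head.
rewrite mem_filter mem_iota => /andP[Pr lt]; split=> // r' lt'.
apply/negP => Pr'; have : r' \in rcons s r by rewrite -E mem_filter Pr' mem_iota; lia.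
have : sorted gtn (rev (rcons s r)).
  rewrite -E rev_sorted; apply: sorted_filter; [exact: ltn_trans | exact: iota_ltn_sorted].
rewrite rev_rcons /= => /(order_path_min (fun _ _ _ a b => ltn_trans b a))/allP H.
rewrite mem_rcons inE -mem_rev => /orP[|/H] /=; lia.
Qed.

Section Rows.
Variables (e : nat) (l : seq nat).
Hypotheses (e1 : 1 < e) (lp : is_part l).
Let C := maya l.

Lemma addIE i r : i < e -> addI e i l r = addable C (bead l r) && congz e (bead l r + 1)%R i%:Z.
Proof.
move=> lt; rewrite /addI addable_bead // /res modn_congz //.
rewrite (@congz_congr e _ (bead l r + 1)%R); last first.
  by apply/congzP; exists (r%:Z)%R; rewrite /bead; nia.
apply/and3P/andP => [[]//|[A c]]; split=> //.
by apply: addable_row_le; rewrite ?addable_bead.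
Qed.

Lemma remIE i r : i < e -> remI e i l r = removable C (bead l r - 1)%R && congz e (bead l r) i%:Z.
Proof.
move=> lt; rewrite /remI removable_bead // /res modn_congz //.
case: (ltnP (part l r.+1) (part l r)) => lt'; last by rewrite andbF.
have := is_part_gt0 r lp; rewrite (leq_ltn_trans _ lt') // => <- /=.
by apply: congz_congr; apply/congzP; exists (r%:Z)%R; rewrite /bead; nia.
Qed.

Lemma count_addI i x ra rb : i < e -> congz e (x + 1)%R i%:Z ->
  count (addI e i l) (index_iota ra rb) = count_rows e l x 0 (fun y => ~~ C (y + 1)%R) ra rb.
Proof.
move=> lt c; apply: eq_count => r; rewrite addIE // /addable /C maya_bead /= subr0 andbC.
congr andb; rewrite -(congzDr _ _ x 1%R) [LHS]congz_sym [RHS]congz_sym; apply: congz_congr.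
by rewrite congz_sym.
Qed.

Lemma count_remI i x ra rb : i < e -> congz e (x + 1)%R i%:Z ->
  count (remI e i l) (index_iota ra rb) = count_rows e l x 1 (fun y => ~~ C y) ra rb.
Proof.
move=> lt c; apply: eq_count => r; rewrite remIE // /removable subrK /C maya_bead andbT andbC.
congr andb; rewrite -(congzDr _ _ x 1%R) subrK [LHS]congz_sym [RHS]congz_sym; apply: congz_congr.
by rewrite congz_sym.
Qed.

Lemma count_iotaSr (P : pred nat) a b : a <= b ->
  count P (index_iota a b.+1) = count P (index_iota a b) + P b.
Proof.
by move=> le; rewrite /index_iota subSn // -[(b - a).+1]addn1 iotaD count_cat /= subnKC // addn0.
Qed.

Lemma count_iotaSl (P : pred nat) a b : a < b ->
  count P (index_iota a b) = P a + count P (index_iota a.+1 b).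
Proof. by move=> lt; rewrite /index_iota -(subnSK lt). Qed.

Lemma addI_remI i r : i < e -> addI e i l r -> remI e i l r = false.
Proof.
move=> lt; rewrite addIE // remIE // => /andP[_ c]; apply/negP => /andP[_ c'].
by rewrite (congz_excl e1 c') in c.
Qed.

(** The test on rows includes the last row b on one side only. This agrees with comparing full
    intervals, as no row is both addable and removable for the same residue. *)
Lemma dn_below i r x : i < e -> congz e (x + 1)%R i%:Z ->
  (forall r', (r < r') = (bead l r' < x)%R) ->
  all (fun b => count (remI e i l) (index_iota r.+1 b.+1) <=
                count (addI e i l) (index_iota r.+1 b)) (index_iota r.+1 (size l).+1)
  <-> dn_le e (removable C) (addable C) x.
Proof.
move=> lt c H0; split=> [/allP H m|D].
  have [r1 lt_r [E0 E1]] := dn_rows e1 lp H0 m (fun y => ~~ C (y + 1)%R) (fun y => ~~ C y).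
  have -> : count_dn e (addable C) x m = count_dn e (fun y => ~~ C (y + 1)%R && C y) x m.
    by apply: eq_count_dn => j _; rewrite /addable andbC.
  rewrite -E0 -E1 -(count_addI _ _ lt c) -(count_remI _ _ lt c).
  elim: r1 lt_r {E0 E1} => // b IHb; rewrite ltnS leq_eqVlt => /orP[/eqP->|lt_b].
    by rewrite /index_iota subnn.
  have [le_b|gt_b] := leqP b (size l).
    apply: leq_trans (H b _) _; first by rewrite mem_index_iota; lia.
    by rewrite count_iotaSr ?leq_addr.
  rewrite !count_iotaSr //; have := IHb lt_b.
  by rewrite [remI e i l b](_ : _ = false); [lia | rewrite /remI; case: ltnP => //; lia].
have D' r1 : r < r1 -> count (remI e i l) (index_iota r.+1 r1)
    <= count (addI e i l) (index_iota r.+1 r1).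
  move=> /(dn_rows_signs e1 lp H0)[m [E0 E1]].
  by rewrite (count_addI _ _ lt c) (count_remI _ _ lt c) E0 E1; apply: D.
apply/allP => b; rewrite mem_index_iota => /andP[lt_b _].
have := D' b.+1 (ltnW lt_b); have := D' b lt_b; rewrite !count_iotaSr //.
by case E: (addI e i l b); rewrite ?(addI_remI lt E); lia.
Qed.

Lemma up_above i r x : i < e -> congz e (x + 1)%R i%:Z ->
  (forall r', (r' < r) = (x + 1 < bead l r')%R) ->
  all (fun b => count (addI e i l) (index_iota b r) <=
                count (remI e i l) (index_iota b.+1 r)) (iota 0 r)
  <-> up_le e (addable C) (removable C) x.
Proof.
move=> lt c H0; split=> [/allP H m|U].
  have [r1 le_r [E0 E1 _]] := up_rows e1 lp H0 m (fun y => ~~ C (y + 1)%R) (fun y => ~~ C y).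
  have -> : count_up e (addable C) x m = count_up e (fun y => ~~ C (y + 1)%R && C y) x m.
    by apply: eq_count_up => j _; rewrite /addable andbC.
  rewrite -E0 -E1 -(count_addI _ _ lt c) -(count_remI _ _ lt c).
  move: le_r; rewrite leq_eqVlt => /orP[/eqP->|lt_r]; first by rewrite /index_iota subnn.
  apply: leq_trans (H r1 _) _; first by rewrite mem_iota.
  by rewrite [leqRHS]count_iotaSl // leq_addl.
have U' r1 : r1 <= r -> count (addI e i l) (index_iota r1 r)
    <= count (remI e i l) (index_iota r1 r).
  move=> /(up_rows_signs e1 lp H0)[m [E0 E1]].
  by rewrite (count_addI _ _ lt c) (count_remI _ _ lt c) E0 E1; apply: U.
apply/allP => b; rewrite mem_iota add0n => /andP[_ lt_b].
have := U' b (ltnW lt_b); have := U' b.+1 lt_b; rewrite !(count_iotaSl _ lt_b).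
by case E: (addI e i l b); rewrite ?(addI_remI lt E); lia.
Qed.

Lemma conormalP i r : i < e -> reflect
  [/\ addable C (bead l r), congz e (bead l r + 1)%R i%:Z & dn_le e (removable C) (addable C) (bead l r)]
  (conormal e i l r).
Proof.
move=> lt; rewrite /conormal addIE //.
have H0 r' : (r < r') = (bead l r' < bead l r)%R by rewrite bead_ltE.
apply: (iffP andP) => [[/andP[A c] /(dn_below lt c H0)] //|[A c /(dn_below lt c H0) D]].
by rewrite A c.
Qed.

Lemma normalP i r : i < e -> reflect
  [/\ removable C (bead l r - 1)%R, congz e (bead l r) i%:Z & up_le e (addable C) (removable C) (bead l r - 1)%R]
  (normal e i l r).
Proof.
move=> lt; rewrite /normal remIE //.
have H0 r' : (r' < r) = (bead l r - 1 + 1 < bead l r')%R by rewrite subrK bead_ltE.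
have cE : congz e (bead l r - 1 + 1)%R i%:Z = congz e (bead l r) i%:Z by rewrite subrK.
apply: (iffP andP) => [[/andP[A c]]|[A c U]].
  by rewrite -cE in c; move/(up_above lt c H0); rewrite cE in c.
by rewrite A c; split=> //; apply/(up_above lt _ H0); rewrite ?cE.
Qed.

(** [mirror] reverses positions, so the topmost conormal row becomes the lowest candidate, and
    [lowest_dn] supplies the missing half of [balanced]. *)
Lemma cogood_step i r : i < e -> cogood_row e i l = Some r ->
  [/\ addable C (bead l r), congz e (bead l r + 1)%R i%:Z & fstep e (- 2 - bead l r)%R (mirror C)].
Proof.
move=> lt; rewrite /cogood_row; case E: [seq _ <- _ | _] => [//|r1 s] [<-].
have [_ /(conormalP _ lt)[A c D] low] := filter_iota_head E; split=> //.
have U : up_le e (removable (mirror C)) (addable (mirror C)) (- 2 - bead l r1)%R.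
  by move=> m; rewrite count_up_removable_mirror count_up_addable_mirror.
split; first by rewrite addable_mirror.
split=> //; apply: lowest_dn => //; rewrite ?addable_mirror //.
  by rewrite removable_mirror addable_removable.
move=> j j0; rewrite (_ : - 2 - bead l r1 - (e * j)%:Z = - 2 - (bead l r1 + (e * j)%:Z))%R; last by lia.
rewrite addable_mirror => A' U'; have [r' rE] := addable_posP lp A'.
have ltr : r' < r1 by rewrite -(bead_ltE _ _ lp) -rE; nia.
have /negP := low r' ltr; apply; apply/conormalP => //; rewrite -rE; split=> //.
  by apply: congz_trans c; rewrite congzDr congz_shift.
by move=> m; have := U' m; rewrite count_up_removable_mirror count_up_addable_mirror.
Qed.

Lemma fstep_cogood i x : i < e -> fstep e (- 2 - x)%R (mirror C) -> congz e (x + 1)%R i%:Z ->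
  exists r, cogood_row e i l = Some r.
Proof.
move=> lt [A [U _]] c; rewrite addable_mirror in A; have [r xE] := addable_posP lp A; subst x.
have : conormal e i l r.
  apply/conormalP => //; split=> // m.
  by have := U m; rewrite count_up_removable_mirror count_up_addable_mirror.
rewrite /cogood_row; case E: [seq _ <- _ | _] => [|r1 s] cn; last by exists r1.
have : r \in [seq r <- iota 0 (size l).+1 | conormal e i l r].
  by rewrite mem_filter cn mem_iota ltnS /= addable_row_le.
by rewrite E.
Qed.

Lemma good_step i r : i < e -> good_row e i l = Some r ->
  [/\ removable C (bead l r - 1)%R, congz e (bead l r) i%:Z &
      estep e (- 2 - (bead l r - 1))%R (mirror C)].
Proof.
move=> lt; rewrite /good_row; case/lastP E: [seq _ <- _ | _] => [//|s r1].
case E': (rcons s r1) => [|a t]; first by case: (s) E'.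
rewrite -E' last_rcons => -[<-] {E' a t}.
have [ltr /(normalP _ lt)[R c U] high] := filter_iota_last E; split=> //.
have D : dn_le e (addable (mirror C)) (removable (mirror C)) (- 2 - (bead l r1 - 1))%R.
  by move=> m; rewrite count_dn_removable_mirror count_dn_addable_mirror.
split; first by rewrite removable_mirror.
split=> //; apply: highest_up => //; rewrite ?removable_mirror //.
  by rewrite addable_mirror removable_addable.
move=> j j0; rewrite (_ : - 2 - (bead l r1 - 1) + (e * j)%:Z = - 2 - (bead l r1 - 1 - (e * j)%:Z))%R; last by lia.
rewrite removable_mirror => R' D'; have [r' rE] := removable_posP lp R'.
have rE' : (bead l r' = bead l r1 - (e * j)%:Z)%R by lia.
have ltr' : r1 < r' by rewrite -(bead_ltE _ _ lp); nia.
have lts : r' < size l.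
  by rewrite -is_part_gt0 //; move: R'; rewrite rE removable_bead //; lia.
have /negP : ~~ normal e i l r' by apply: high; rewrite ltr' lts.
apply.
apply/normalP => //; rewrite -rE; split=> //.
  by apply: congz_trans c; rewrite rE' congz_shiftN.
by move=> m; have := D' m; rewrite count_dn_removable_mirror count_dn_addable_mirror.
Qed.

(** Take the last row r of the top block of equal rows. The only addable row above it is row 0, and
    since the block has r + 1 < e rows by regularity, that node has another residue; so the node of
    row r is normal. *)
Lemma exists_good : l != [::] -> restrictedM e (mirror C) ->
  exists2 i, i < e & good_row e i l != None.
Proof.
move=> l0 rC.
have ex : exists r, part l r.+1 < part l 0.
  exists (size l); rewrite part_default // is_part_gt0 //; by case: (l) l0.
case: (ex_minnP ex) => r ltr min_r.
have eqr r' : r' <= r -> part l r' = part l 0.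
  case: r' => // r' lt'; apply/eqP; rewrite eqn_leq is_part_mono //= leqNgt.
  by apply/negP => /min_r; lia.
pose i := res e r (part l r).-1.
have lt : i < e by rewrite /i /res ltn_pmod //; lia.
have rm : remI e i l r.
  by rewrite /remI eqxx andbT -is_part_gt0 // (eqr r) // ltr; lia.
have /andP[R c] : removable C (bead l r - 1)%R && congz e (bead l r) i%:Z by rewrite -remIE.
have lt_e : r.+1 < e.
  have nC : mirror C (- bead l r)%R.
    by rewrite /mirror opprK addrC; case/andP: R.
  have [j /andP[j0 je]] := rC _ nC; rewrite /mirror => nb.
  rewrite ltnNge; apply: contra nb => le; apply/mayaP; exists (r.+1 - j).
  by rewrite /bead !eqr //; lia.
have N : normal e i l r.
  apply/normalP => //; split=> // m.
  rewrite [X in X <= _](_ : _ = 0) //; apply/eqP; rewrite /count_up -leqn0 leqNgt -has_count.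
  apply/hasPn => j; rewrite mem_iota => /andP[j0 _]; apply/negP => A.
  have [r' rE] := addable_posP lp A.
  have lt' : r' < r by rewrite -(bead_ltE _ _ lp) -rE; nia.
  rewrite rE addable_bead // in A; case: r' rE lt' A => [|r'] rE lt' /=.
    by move=> _; move: rE; rewrite /bead (eqr r) //; nia.
  by rewrite !eqr; lia.
exists i => //; rewrite /good_row.
have : r \in [seq r <- iota 0 (size l) | normal e i l r].
  by rewrite mem_filter N mem_iota /=; case/and3P: rm.
by case: [seq _ <- _ | _].
Qed.

End Rows.

Section Mullineux.
Variable e : nat.
Hypothesis e1 : 1 < e.

(** The recursion removes the good node of the first possible residue. [reach_step_ex] shows that
    the image of the smaller partition has a matching node, and [fstep_uniq] identifies it with the
    cogood row chosen by [ftilde]. *)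
Lemma mull_aux_reach n l : is_part l -> sumn l = n -> restrictedM e (maya (conj l)) ->
  is_part (mull_aux e n l) /\ reach e (maya (conj l)) (maya (conj (mull_aux e n l))).
Proof.
elim: n l => [|n IHn] l lp ln rl.
  have -> : l = [::] by apply/nilP; have := size_sumn lp; rewrite ln leqn0.
  by split=> //=; rewrite maya_vacuum; apply: reach_vacuum.
rewrite /=; rewrite maya_conj // in rl *.
case E: [seq i <- iota 0 e | good_row e i l != None] => [|i s].
  have l0 : l != [::] by apply/eqP => l0; rewrite l0 in ln.
  have [i lt gi] := exists_good e1 lp l0 rl.
  have : i \in [seq i <- iota 0 e | good_row e i l != None].
    by rewrite mem_filter gi mem_iota.
  by rewrite E.
have [lt gi _] := filter_iota_head E.
case G: (good_row e i l) gi => [r|//] _.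
have [R c st] := good_step e1 lp lt G.
have -> : etilde e i l = remove_node l r by rewrite /etilde G.
have dp := is_part_remove_node lp R.
have mE : maya (conj (remove_node l r)) = swap (- 2 - (bead l r - 1))%R (mirror (maya l)).
  by rewrite swap_mirror swap_remove_node // maya_conj.
have sm : sumn (remove_node l r) = n by have := sumn_remove_node lp R; lia.
have [|mp re] := IHn _ dp sm; first by rewrite mE; apply: restrictedM_estep.
move: (mull_aux _ _ _) mp re => m mp re; rewrite mE in re.
have st' := estep_swap e1 st; have [y sy cy] := reach_step_ex e1 re st'.
pose i' := (e - i) %% e; have lt' : i' < e by rewrite ltn_pmod; lia.
have cyi : congz e (- 2 - y + 1)%R i'%:Z.
  have c1 : congz e (e - i)%:Z i'%:Z by rewrite -modn_congz.
  apply: congz_trans c1; apply: (@congz_trans _ (- i%:Z)); last first.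
    by apply/congzP; exists (-1)%R; lia.
  apply: (@congz_trans _ (- bead l r)); last by rewrite congzN.
  move: cy; rewrite /congz => cy; rewrite -rpredN; move: cy; congr (_ %| _)%Z; lia.
rewrite maya_conj // in sy re.
have [|r' G'] := @fstep_cogood e m e1 mp i' (- 2 - y)%R lt' _ cyi.
  by rewrite (_ : - 2 - (- 2 - y) = y)%R //; lia.
rewrite -/i' /ftilde G'; have [A c' st2] := cogood_step e1 mp lt' G'.
have yE : (- 2 - bead m r' = y)%R.
  apply: (fstep_uniq (ltnW e1) st2 sy).
  have : congz e (bead m r' + 1)%R (- 2 - y + 1)%R by apply: congz_trans c' _; rewrite congz_sym.
  by rewrite congzDr -congzN -(congzDr _ _ _ (-2)%R); congr congz; lia.
have ip := is_part_incr mp A; split=> //.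
rewrite maya_conj // -swap_add_node // -swap_mirror yE.
by have := reach_step re st' sy cy; rewrite swapK.
Qed.

Lemma mullineux_reach l : is_part l -> restrictedM e (maya (conj l)) ->
  is_part (mullineux e l) /\ reach e (maya (conj l)) (maya (conj (mullineux e l))).
Proof. by move=> lp; apply: mull_aux_reach. Qed.

End Mullineux.

(** * Reflections *)

Inductive chain (e : nat) (x : int) : (int -> bool) -> (int -> bool) -> Prop :=
| chain_nil B : chain e x B B
| chain_cons B z B1 : congz e z x -> fstep e z B -> chain e x (swap z B) B1 -> chain e x B B1.

(** The same strings as [chain], unrolled at their upper end, which is what descending along two
    strings in parallel requires. *)
Inductive rchain (e : nat) (x : int) : (int -> bool) -> (int -> bool) -> Prop :=
| rchain_nil B : rchain e x B B
| rchain_rcons B B1 z : congz e z x -> fstep e z B1 -> rchain e x B B1 ->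
    rchain e x B (swap z B1).

Lemma rchain_cons e x B z B1 : congz e z x -> fstep e z B -> rchain e x (swap z B) B1 ->
  rchain e x B B1.
Proof.
move=> c s; move E: (swap z B) => B' ch; elim: ch E => [{}B' <-|{}B' {}B1 w cw stw _ IH E].
  by apply: rchain_rcons => //; apply: rchain_nil.
by apply: rchain_rcons => //; apply: IH.
Qed.

Lemma chain_rchain e x B B1 : chain e x B B1 -> rchain e x B B1.
Proof.
elim=> [*|{}B z {}B1 c s _ IH]; first exact: rchain_nil.
exact: rchain_cons IH.
Qed.

Lemma chain_inv e x B B1 : chain e x B B1 -> B = B1 \/
  exists z, [/\ congz e z x, fstep e z B & chain e x (swap z B) B1].
Proof. by case=> [|{}B z {}B1 c s ch]; [left | right; exists z]. Qed.

Lemma rchain_inv e x B B1 : rchain e x B B1 -> B = B1 \/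
  exists B' z, [/\ congz e z x, fstep e z B', rchain e x B B' & B1 = swap z B'].
Proof. by case=> [|{}B B' z c s ch]; [left | right; exists B', z]. Qed.

(* Exchange of the adjacent runners x and x + 1. *)
Definition class_swap (e : nat) (x y : int) : int :=
  (if congz e y x then y + 1 else if congz e (y - 1) x then y - 1 else y)%R.

(** The top of the string through [B] for the class of x, provided no removable node of the class
    lies above an addable one: in each pair y, y + 1 a single bead ends up on the right. *)
Definition flip_addable (e : nat) (x : int) (B : int -> bool) (y : int) : bool :=
  if congz e y x then B y && B (y + 1)%R
  else if congz e (y - 1)%R x then B (y - 1)%R || B y else B y.

Definition bounded (B : int -> bool) : Prop :=
  exists N : nat, forall z : int, ((z < - N%:Z)%R -> B z) /\ ((N%:Z <= z)%R -> ~~ B z).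

Lemma ismaya_bounded B : ismaya B -> bounded B.
Proof.
case=> h hp ->; exists (size h + part h 0) => z; split=> zN.
  by rewrite /maya; apply/orP; left; lia.
apply/mayaP => -[r rE]; have := is_part_mono hp (leq0n r).
by move: zN; rewrite rE /bead; lia.
Qed.

Section Chains.
Variable e : nat.
Hypothesis e1 : 1 < e.

Lemma reach_ex B : ismaya B -> restrictedM e B -> exists D, reach e B D.
Proof.
case=> h hp -> rB; have [||_] := @mullineux_reach e e1 (conj h); rewrite ?is_part_conj ?conjK //.
by move=> re; exists (maya (conj (mullineux e (conj h)))).
Qed.

Lemma reach_ismaya B D : reach e B D -> ismaya B.
Proof. by move/(reach_parts e1) => [h [k [hp _ BE _ _]]]; exists h. Qed.

(** [reach] only grows diagrams. The smaller diagram is restricted and so has some partner; adding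
    the node back on both sides gives a partner of [B], which is [D] by uniqueness. *)
Lemma reach_estep B D x : reach e B D -> estep e x B ->
  exists y, [/\ congz e (x + y + 2)%R 0%R, estep e y D & reach e (swap x B) (swap y D)].
Proof.
move=> re ex; have [R _] := ex.
have rB := restrictedM_estep e1 (reach_restr e1 re) ex.
have [D0 re0] := reach_ex (ismaya_swapR (reach_ismaya re) R) rB.
have sx := estep_swap e1 ex; have [y sy c] := reach_step_ex e1 re0 sx.
have := reach_step re0 sx sy c; rewrite swapK => /(reach_fun e1 re) DE.
by exists y; rewrite DE swapK; split=> //; apply: fstep_swap.
Qed.

(** Steps of partners correspond one to one, so neither string can stop before the other, and the
    tops are partners. *)
Lemma reach_chain x y B D B1 D1 : reach e B D -> chain e x B B1 -> chain e y D D1 ->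
  congz e (x + y + 2)%R 0%R -> (forall z, congz e z x -> ~ fstep e z B1) ->
  (forall z, congz e z y -> ~ fstep e z D1) -> reach e B1 D1.
Proof.
move=> re chB chD xy nB nD.
have tr z w : congz e z x -> congz e (z + w + 2)%R 0%R -> congz e w y.
  move=> /congzP[k ->] /congzP[k' E]; case/congzP: xy => k'' E'.
  by apply/congzP; exists (k' - k - k'')%R; lia.
elim: chB D re chD nB => {B B1} [B|B z B1 cz sz _ IH] D re chD nB.
  have [<- //|[w [cw stw _]]] := chain_inv chD.
  have [v sv c] := reach_step_ex e1 (reach_sym re) stw.
  exfalso; apply: (nB v) => //; case/congzP: c => k E; case/congzP: cw => k' E'; case/congzP: xy => k'' E''.
  by apply/congzP; exists (k - k' - k'')%R; lia.
have [w stw c] := reach_step_ex e1 re sz; have cw := tr _ _ cz c.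
have [DE|[w' [cw' stw' ch]]] := chain_inv chD; first by case: (nD w); rewrite -?DE.
have ww : w' = w by apply: (fstep_uniq (ltnW e1) stw' stw); apply: congz_trans cw' _; rewrite congz_sym.
subst w'; apply: (IH _ _ ch nB).
exact: reach_step.
Qed.

Lemma reach_rchain x y B D B1 D1 : reach e B1 D1 -> rchain e x B B1 -> rchain e y D D1 ->
  congz e (x + y + 2)%R 0%R -> (forall z, congz e z x -> ~ estep e z B) ->
  (forall z, congz e z y -> ~ estep e z D) -> reach e B D.
Proof.
move=> re chB chD xy nB nD.
have tr z w : congz e z x -> congz e (z + w + 2)%R 0%R -> congz e w y.
  move=> /congzP[k ->] /congzP[k' E]; case/congzP: xy => k'' E'.
  by apply/congzP; exists (k' - k - k'')%R; lia.
elim: chB D1 re chD nB => {B B1} [B|B B1 z cz sz _ IH] D1 re chD nB.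
  have [->//|[D' [w [cw stw _ DE]]]] := rchain_inv chD; subst D1.
  have [v [c ev _]] := reach_estep (reach_sym re) (fstep_swap e1 stw).
  exfalso; apply: (nB v) => //; case/congzP: c => k E; case/congzP: cw => k' E'; case/congzP: xy => k'' E''.
  by apply/congzP; exists (k - k' - k'')%R; lia.
have [w [c ew re']] := reach_estep re (fstep_swap e1 sz); have cw := tr _ _ cz c.
have [DE|[D' [w' [cw' stw' ch DE]]]] := rchain_inv chD; first by case: (nD w); rewrite ?DE.
subst D1.
have ww : w' = w.
  by apply: (estep_uniq (ltnW e1) (fstep_swap e1 stw') ew); apply: congz_trans cw' _; rewrite congz_sym.
subst w'; rewrite !swapK in re'; exact: IH re' ch nB.
Qed.

Lemma chain_ismaya x B B1 : chain e x B B1 -> ismaya B -> ismaya B1.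
Proof. by elim=> // {}B z {}B1 _ [A _] _ IH mB; apply: IH; apply: ismaya_swapA. Qed.

Lemma chain_sumn x B B1 h1 : chain e x B B1 -> is_part h1 -> B1 = maya h1 ->
  B = B1 \/ exists h, [/\ is_part h, B = maya h & sumn h < sumn h1].
Proof.
elim=> [*|{}B z {}B1 _ [A _] _ IH hp BE]; first by left.
have {IH} : exists h, [/\ is_part h, swap z B = maya h & sumn h <= sumn h1].
  have [->|[h [hp' -> lt]]] := IH hp BE; [exists h1|exists h]; split=> //; exact: ltnW.
case=> h [hp' hE le]; right.
have R : removable (maya h) z by rewrite -hE removable_swap.
have [r zE] := removable_posP hp' R; subst z.
exists (remove_node h r); split; first exact: is_part_remove_node.
  by rewrite -(swap_remove_node hp' R) -hE swapK.
by rewrite -(sumn_remove_node hp' R).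
Qed.

Lemma class_ne x z w : congz e z x -> congz e w x -> w != z ->
  [/\ w != (z + 1)%R, (w + 1)%R != z & (w + 1)%R != (z + 1)%R].
Proof.
move=> cz cw ne; split.
- by apply/eqP => E; have := congz_excl e1 cz; rewrite -E cw.
- by apply/eqP => E; have := congz_excl e1 cw; rewrite E cz.
- by apply: contraNneq ne => /addIr->.
Qed.

Lemma addable_swap_ne x z w B : congz e z x -> congz e w x -> w != z -> addable (swap z B) w = addable B w.
Proof. by move=> cz cw ne; have [? ? ?] := class_ne cz cw ne; rewrite /addable !swap_ne. Qed.

Lemma removable_swap_ne x z w B : congz e z x -> congz e w x -> w != z -> removable (swap z B) w = removable B w.
Proof. by move=> cz cw ne; have [? ? ?] := class_ne cz cw ne; rewrite /removable !swap_ne. Qed.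

Lemma seq_min (s : seq int) : s != [::] ->
  exists2 z, z \in s & forall w, w \in s -> (z <= w)%R.
Proof.
elim: s => // y [|y' s] IHs _.
  by exists y; rewrite ?mem_head // => w; rewrite inE => /eqP->.
have [//|z zs zmin] := IHs; have [le|lt] := lerP z y.
  exists z; first by rewrite inE zs orbT.
  by move=> w; rewrite inE => /orP[/eqP->//|/zmin].
exists y; first by rewrite mem_head.
move=> w; rewrite inE => /orP[/eqP->//|/zmin]; exact: le_trans (ltW lt).
Qed.

(** The lowest addable node of the class is added first: there is nothing removable above it by
    assumption and nothing addable below it, so both inequalities of [balanced] have left side
    zero. *)
Lemma chain_flip_addable x (L : seq int) B :
  (forall z w, congz e z x -> congz e w x -> addable B z -> (z < w)%R -> ~~ removable B w) ->
  (forall z, congz e z x -> addable B z -> z \in L) ->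
  chain e x B (flip_addable e x B).
Proof.
move En: (size [seq z <- L | congz e z x && addable B z]) => n.
elim/ltn_ind: n B En => n IHn B En pat fin.
have [E|ne] := eqVneq [seq z <- L | congz e z x && addable B z] [::].
  have nA z : congz e z x -> addable B z = false.
    move=> c; apply/negP => A.
    have : z \in [seq z <- L | congz e z x && addable B z] by rewrite mem_filter c A fin.
    by rewrite E.
  suff -> : flip_addable e x B = B by apply: chain_nil.
  apply: functional_extensionality => y; rewrite /flip_addable.
  case: ifP => cy; first by move: (nA y cy); rewrite /addable; do 2 case: (B _).
  case: ifP => cy'; last by [].
  by move: (nA _ cy'); rewrite /addable subrK; do 2 case: (B _).
have [z] := seq_min ne; rewrite mem_filter => /andP[/andP[cz Az] zL] zmin.
have low w : congz e w x -> addable B w -> (z <= w)%R.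
  by move=> cw Aw; apply: zmin; rewrite mem_filter cw Aw fin.
have st : fstep e z B.
  split=> //; split=> m.
    rewrite [X in X <= _](_ : _ = 0) //; apply/eqP; rewrite /count_up -leqn0 leqNgt -has_count.
    apply/hasPn => j; rewrite mem_iota => /andP[j0 _]; apply: (pat z) => //; last by nia.
    by apply: congz_trans cz; rewrite congz_shift.
  rewrite [X in X <= _](_ : _ = 0) //; apply/eqP; rewrite /count_dn -leqn0 leqNgt -has_count.
  apply/hasPn => j; rewrite mem_iota => /andP[j0 _]; apply/negP => A.
  have := low _ _ A; rewrite (congz_trans (congz_shiftN _ _ _) cz) => /(_ isT); nia.
have flE : flip_addable e x (swap z B) = flip_addable e x B.
  apply: functional_extensionality => y; rewrite /flip_addable.
  case: ifP => cy.
    have [->|ney] := eqVneq y z; first by rewrite swap_l swap_r andbC.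
    by have [? ? ?] := class_ne cz cy ney; rewrite !swap_ne.
  case: ifP => cy'.
    have [E|ney] := eqVneq (y - 1)%R z.
      have -> : y = (z + 1)%R by lia.
      by rewrite addrK swap_l swap_r orbC.
    by have [? ? ?] := class_ne cz cy' ney; rewrite !swap_ne // -[y](subrK 1%R).
  rewrite swap_ne //; first by apply: contraFneq cy => ->.
  by apply: contraFneq cy' => ->; rewrite addrK.
apply: (chain_cons cz st); rewrite -flE; apply: (IHn _ _ _ erefl).
- rewrite -En !size_filter -(addn0 (count _ _)) -[X in _ < X](addn0).
  have sub w : congz e w x && addable (swap z B) w -> congz e w x && addable B w && (w != z).
    move=> /andP[cw Aw]; have wz : w != z.
      by apply: contraTneq Aw => ->; rewrite addable_swap (negbTE (addable_removable Az)).
    by move: Aw; rewrite (addable_swap_ne _ cz cw) // cw wz => ->.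
  elim: (L) zL => // w s IHs; rewrite inE /= => /orP[/eqP <-|zs].
    rewrite cz Az addable_swap (negbTE (addable_removable Az)) /= !addn0 add0n add1n ltnS.
    by apply: sub_count => v /sub/andP[].
  have := IHs zs; have := @sub w; case: (congz e w x && addable (swap z B) w) => [/(_ isT)/andP[-> _]|_]; lia.
- move=> w v cw cv Aw lt.
  have wz : w != z by apply: contraTneq Aw => ->; rewrite addable_swap (negbTE (addable_removable Az)).
  rewrite (addable_swap_ne _ cz cw) // in Aw.
  have vz : v != z by have := low w cw Aw; lia.
  by rewrite (removable_swap_ne _ cz cv) //; apply: (pat w).
- move=> w cw; have [->|wz] := eqVneq w z; first by rewrite addable_swap (negbTE (addable_removable Az)).
  by rewrite (addable_swap_ne _ cz) //; apply: fin.
Qed.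
End Chains.

Definition reflect_at e x (B : int -> bool) : int -> bool := fun y => B (class_swap e x y).

Section Reflect.
Variable e : nat.
Hypothesis e1 : 1 < e.

Lemma class_swapK x : involutive (class_swap e x).
Proof.
move=> y; rewrite /class_swap; case: (boolP (congz e y x)) => c.
  by rewrite (congz_excl e1 c) !addrK c.
case: (boolP (congz e (y - 1)%R x)) => c'; first by rewrite c' subrK.
by rewrite (negbTE c) (negbTE c').
Qed.

Lemma reflect_atK x B : reflect_at e x (reflect_at e x B) = B.
Proof. by apply: functional_extensionality => y; rewrite /reflect_at class_swapK. Qed.

Lemma class_swap_opp x y : class_swap e (- 2 - x)%R (- 1 - y)%R = (- 1 - class_swap e x y)%R.
Proof.
rewrite /class_swap.
have -> : congz e (- 1 - y)%R (- 2 - x)%R = congz e (y - 1)%R x.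
  by rewrite -congzN -(congzDr _ _ _ (-2)%R); congr congz; lia.
have -> : congz e (- 1 - y - 1)%R (- 2 - x)%R = congz e y x.
  by rewrite -congzN -(congzDr _ _ _ (-2)%R); congr congz; lia.
case: (boolP (congz e y x)) => c; last by case: ifP => _; lia.
have -> : congz e (y - 1)%R x = false.
  by apply/negP => c'; have := congz_excl e1 c'; rewrite subrK c.
by lia.
Qed.

Lemma reflect_mirror x B :
  reflect_at e (- 2 - x)%R (mirror B) = mirror (reflect_at e x B).
Proof.
apply: functional_extensionality => y; rewrite /reflect_at /mirror.
have {1}-> : y = (- 1 - (- 1 - y))%R by lia.
rewrite class_swap_opp; congr (~~ B _); lia.
Qed.

Definition no_removable x B := forall z, congz e z x -> ~~ removable B z.

Lemma flip_addable_reflect x B : no_removable x B -> flip_addable e x B = reflect_at e x B.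
Proof.
move=> nR; apply: functional_extensionality => y; rewrite /flip_addable /reflect_at /class_swap.
case: ifP => [c|_]; first by move: (nR y c); rewrite /removable; do 2 case: (B _).
case: ifP => [c|_] //; move: (nR _ c); rewrite /removable subrK; do 2 case: (B _) => //.
Qed.

Lemma addable_flip x B z : congz e z x -> addable (flip_addable e x B) z = false.
Proof.
move=> c; rewrite /addable /flip_addable c (congz_excl e1 c) addrK c.
by case: (B z); case: (B (z + 1)%R).
Qed.

Lemma bounded_reflect x B : bounded B -> bounded (reflect_at e x B).
Proof.
case=> N NP; exists N.+1 => z; rewrite /reflect_at /class_swap; split=> zN.
  by case: ifP => _; [|case: ifP => _]; apply: (NP _).1; lia.
by case: ifP => _; [|case: ifP => _]; apply: (NP _).2; lia.
Qed.

Lemma chain_reflect x B : bounded B -> no_removable x B -> chain e x B (reflect_at e x B).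
Proof.
move=> [N NP] nR; rewrite -flip_addable_reflect //.
apply: (@chain_flip_addable e e1 x [seq (j%:Z - N.+1%:Z)%R | j <- iota 0 (N + N.+1)]).
  by move=> z w _ cw _ _; apply: nR.
move=> z _ /andP[Bz Bz1].
have lt1 : (z < N%:Z)%R by rewrite ltNge; apply/negP => /(NP z).2; rewrite Bz.
have lt2 : (- N%:Z <= z + 1)%R by rewrite leNgt; apply/negP => /(NP _).1; apply/negP.
by apply/mapP; exists `|(z + N.+1%:Z)%R|%N; rewrite ?mem_iota; lia.
Qed.

Lemma reach_reflect x y B D : bounded B -> bounded D -> no_removable x B -> no_removable y D ->
  congz e (x + y + 2)%R 0%R ->
  reach e B D <-> reach e (reflect_at e x B) (reflect_at e y D).
Proof.
move=> bB bD nB nD xy.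
have chB := chain_reflect bB nB; have chD := chain_reflect bD nD; split=> re.
  apply: (reach_chain e1 re chB chD xy) => z c [A _]; move: A.
    by rewrite -flip_addable_reflect // addable_flip.
  by rewrite -flip_addable_reflect // addable_flip.
apply: (reach_rchain e1 re (chain_rchain chB) (chain_rchain chD) xy) => z c [R _].
  by have := nB z c; rewrite R.
by have := nD z c; rewrite R.
Qed.

Lemma core_iter (B : int -> bool) : (forall y, B (y + e%:Z)%R -> B y) ->
  forall y (j : nat), B (y + (e * j)%:Z)%R -> B y.
Proof.
move=> core y; elim=> [|j IHj]; first by rewrite muln0 addr0.
by move=> H; apply/IHj/core; move: H; congr B; lia.
Qed.

(** Every runner of a core is filled up to its last bead, so a class with a removable node has no
    addable one. The core is therefore the reflection of a strictly smaller core. *)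
Lemma reach_core B : ismaya B -> (forall y, B (y + e%:Z)%R -> B y) ->
  reach e B (mirror B).
Proof.
case=> h; have [n] := ubnP (sumn h); elim: n h B => // n IHn h B le hp BE core.
have [h0|h0] := eqVneq h [::].
  by rewrite BE h0 maya_vacuum mirror_vacuum; apply: reach_vacuum.
pose x := (bead h (size h).-1 - 1)%R.
have Rx : removable B x.
  rewrite BE removable_bead // prednK ?lt0n ?size_eq0 // part_default //.
  by rewrite is_part_gt0 // prednK // lt0n size_eq0.
have ci := core_iter core.
have nA z : congz e z x -> ~~ addable B z.
  move=> c; apply/negP => A; case/andP: Rx => nx x1; case/andP: A => zB nz1.
  have := nx; have := nz1; case: (ltgtP z x) => [lt|lt|zx]; last by rewrite zx x1.
    have [|j j0 zE] := @congz_lt e x z _ c lt; first lia.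
    by move=> /negP[]; apply: (ci _ j); rewrite zE; move: x1; congr B; lia.
  have [|j j0 zE] := @congz_gt e x z _ c lt; first lia.
  by move=> _ /negP[]; apply: (ci _ j); rewrite -zE.
pose B1 := reflect_at e x B.
have nR1 : no_removable x B1.
  move=> z c; have := nA z c; rewrite /removable /addable /B1 /reflect_at /class_swap c (congz_excl e1 c).
  by rewrite addrK c andbC.
have B1K : reflect_at e x B1 = B by apply: reflect_atK.
have mB : ismaya B by exists h.
have bB1 : bounded B1 by apply/bounded_reflect/ismaya_bounded.
have ch := chain_reflect bB1 nR1; rewrite B1K in ch.
have [E|[h1 [hp1 B1E lt]]] := chain_sumn ch hp BE.
  have := congr1 (fun f => f x) E; rewrite /B1 /reflect_at /class_swap congz_refl.
  by case/andP: Rx => /negbTE-> ->.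
have core1 y : B1 (y + e%:Z)%R -> B1 y.
  rewrite /B1 /reflect_at /class_swap.
  have E w : congz e (w + e%:Z)%R x = congz e w x.
    by apply: congz_congr; apply/congzP; exists 1%R; lia.
  rewrite E (_ : y + e%:Z - 1 = y - 1 + e%:Z)%R ?E; last by lia.
  case: ifP => _; last case: ifP => _; move=> H; apply: core; move: H; congr B; lia.
have re1 : reach e B1 (mirror B1) by apply: (IHn h1) => //; lia.
have := re1; rewrite (@reach_reflect x (- 2 - x)%R) //.
- by rewrite reflect_mirror B1K.
- by rewrite B1E -maya_conj //; apply: ismaya_bounded; exists (conj h1); rewrite ?is_part_conj.
- move=> z c; rewrite (_ : z = - 2 - (- 2 - z))%R ?removable_mirror; last by lia.
  by apply: nR1; rewrite -congzN -(congzDr _ _ _ (-2)%R); move: c; congr congz; lia.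
- by rewrite (_ : x + (- 2 - x) + 2 = 0)%R ?congz_refl //; lia.
Qed.

End Reflect.

(** * Separated Maya diagrams *)

Lemma incr_lt (a : int -> int) : (forall k, (a k < a (k + 1))%R) ->
  forall k l, (k < l)%R -> (a k < a l)%R.
Proof.
move=> inc k l lt.
have key (n : nat) : (a k < a (k + n.+1%:Z))%R.
  elim: n => [|n IHn]; first exact: inc.
  apply: lt_trans IHn _; rewrite (_ : k + n.+2%:Z = k + n.+1%:Z + 1)%R; last by lia.
  exact: inc.
have := key `|(l - k - 1)%R|%N.
by rewrite (_ : (k + `|(l - k - 1)%R|%N.+1%:Z = l)%R) //; lia.
Qed.

(* [a] and [b] enumerate, increasingly, a union I of c residue classes and its complement. *)
Record enum_pair (e c cb : nat) (a b : int -> int) : Prop := Enum {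
  enum_inc1 : forall k, (a k < a (k + 1))%R;
  enum_inc2 : forall l, (b l < b (l + 1))%R;
  enum_per1 : forall k, a (k + c%:Z)%R = (a k + e%:Z)%R;
  enum_per2 : forall l, b (l + cb%:Z)%R = (b l + e%:Z)%R;
  enum_cover : forall x, (exists k, x = a k) \/ (exists l, x = b l);
  enum_disj : forall k l, a k <> b l }.

(* Chosen so that [mirror B \o mirror_enum a = mirror (B \o a)]. *)
Definition mirror_enum (a : int -> int) (k : int) : int := (- 1 - a (- 1 - k))%R.

Definition separated (a b : int -> int) (B : int -> bool) : Prop :=
  forall k l, B (b l) -> ~~ B (a k) -> (b l < a k)%R.

Lemma mirror_enumK a : mirror_enum (mirror_enum a) = a.
Proof.
apply: functional_extensionality => k; rewrite /mirror_enum.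
by rewrite (_ : - 1 - (- 1 - k) = k)%R; lia.
Qed.

Lemma enum_swap e c cb a b : enum_pair e c cb a b -> enum_pair e cb c b a.
Proof.
case=> i1 i2 p1 p2 cv d; split=> //.
  by move=> x; case: (cv x); [right | left].
by move=> k l /esym; apply: d.
Qed.

Lemma enum_mirror_enum e c cb a b : enum_pair e c cb a b -> enum_pair e cb c (mirror_enum b) (mirror_enum a).
Proof.
case=> i1 i2 p1 p2 cv d; split; rewrite /mirror_enum.
- move=> k; have := i2 (- 1 - (k + 1))%R.
  by rewrite (_ : - 1 - (k + 1) + 1 = - 1 - k)%R; lia.
- move=> k; have := i1 (- 1 - (k + 1))%R.
  by rewrite (_ : - 1 - (k + 1) + 1 = - 1 - k)%R; lia.
- move=> k; have := p2 (- 1 - (k + cb%:Z))%R.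
  by rewrite (_ : - 1 - (k + cb%:Z) + cb%:Z = - 1 - k)%R; lia.
- move=> k; have := p1 (- 1 - (k + c%:Z))%R.
  by rewrite (_ : - 1 - (k + c%:Z) + c%:Z = - 1 - k)%R; lia.
- move=> x; case: (cv (- 1 - x)%R) => -[k kE]; [right|left]; exists (- 1 - k)%R;
  by rewrite (_ : - 1 - (- 1 - k) = k)%R; lia.
- by move=> k l E; apply: (d (- 1 - l)%R (- 1 - k)%R); lia.
Qed.

Section Enum.
Variables (e c cb : nat) (a b : int -> int).
Hypothesis E : enum_pair e c cb a b.

Lemma enum_lt k l : (k < l)%R -> (a k < a l)%R.
Proof. exact: incr_lt (enum_inc1 E) k l. Qed.

Lemma enum_le k l : (k <= l)%R -> (a k <= a l)%R.
Proof. by rewrite le_eqVlt => /orP[/eqP->//|/enum_lt/ltW]. Qed.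

Lemma enum_ltE k l : (a k < a l)%R = (k < l)%R.
Proof.
apply/idP/idP; last exact: enum_lt.
by apply: contraTT; rewrite -!leNgt; apply: enum_le.
Qed.

Lemma enum_inj k l : a k = a l -> k = l.
Proof. by move=> Ek; have := enum_ltE k l; have := enum_ltE l k; rewrite Ek; lia. Qed.

Lemma enum_perN k (j : nat) : a (k + (c * j)%:Z)%R = (a k + (e * j)%:Z)%R.
Proof.
elim: j => [|j IHj]; first by rewrite !muln0 !addr0.
rewrite (_ : k + (c * j.+1)%:Z = k + (c * j)%:Z + c%:Z)%R; last by lia.
by rewrite (enum_per1 E) IHj; lia.
Qed.

Lemma enum_perN' k (j : nat) : a (k - (c * j)%:Z)%R = (a k - (e * j)%:Z)%R.
Proof. by have := enum_perN (k - (c * j)%:Z)%R j; rewrite subrK; lia. Qed.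

Lemma enum_perZ k (j : int) : a (k + j * c%:Z)%R = (a k + j * e%:Z)%R.
Proof.
case: j => j.
  by rewrite (_ : k + j%:Z * c%:Z = k + (c * j)%:Z)%R ?enum_perN; lia.
rewrite NegzE (_ : k + - j.+1%:Z * c%:Z = k - (c * j.+1)%:Z)%R ?enum_perN'; lia.
Qed.

Lemma enum_congz k k' : congz c k k' -> congz e (a k) (a k').
Proof. by case/congzP=> j ->; rewrite enum_perZ; apply/congzP; exists j. Qed.

Lemma enum_congzE x k : congz e x (a k) -> exists2 k', x = a k' & congz c k' k.
Proof.
case/congzP=> j ->; exists (k + j * c%:Z)%R; first by rewrite enum_perZ.
by apply/congzP; exists j.
Qed.

(** By periodicity the class of [a k] modulo e consists of the [a (k + c j)], each followed by
    [a (k + c j + 1)]. So both signatures are the same sequence. *)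
Lemma fstep_enum B k : (a (k + 1) = a k + 1)%R ->
  fstep c k (fun k => B (a k)) -> fstep e (a k) B.
Proof.
move=> adj [A [U D]].
have up1 j : (a k + (e * j)%:Z + 1 = a (k + (c * j)%:Z + 1))%R.
  by rewrite (_ : k + (c * j)%:Z + 1 = k + 1 + (c * j)%:Z)%R ?enum_perN; lia.
have dn1 j : (a k - (e * j)%:Z + 1 = a (k - (c * j)%:Z + 1))%R.
  by rewrite (_ : k - (c * j)%:Z + 1 = k + 1 - (c * j)%:Z)%R ?enum_perN'; lia.
split; first by move: A; rewrite /addable adj.
split=> m.
  have := U m; rewrite /count_up; congr (_ <= _); apply: eq_count => j; rewrite /removable /addable;
  by rewrite up1 -enum_perN.
have := D m; rewrite /count_dn; congr (_ <= _); apply: eq_count => j; rewrite /removable /addable;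
by rewrite dn1 -enum_perN'.
Qed.

Lemma swap_enum1 B k : (a (k + 1) = a k + 1)%R ->
  (fun k' => swap (a k) B (a k')) = swap k (fun k' => B (a k')).
Proof.
move=> adj; apply: functional_extensionality => k'; rewrite /swap -adj.
have [->|ne] := eqVneq k' k; first by rewrite eqxx.
rewrite ifF; last by apply/negbTE; apply: contra_neq ne => /enum_inj.
have [->|ne1] := eqVneq k' (k + 1)%R; first by rewrite eqxx.
by rewrite ifF //; apply/negbTE; apply: contra_neq ne1 => /enum_inj.
Qed.

Lemma swap_enum2 B k l : (a (k + 1) = a k + 1)%R -> swap (a k) B (b l) = B (b l).
Proof.
move=> adj; apply: swap_ne; rewrite -?adj; apply/eqP => H.
  exact: (enum_disj E (esym H)).
exact: (enum_disj E (esym H)).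
Qed.

End Enum.

(** * Adding a multiple of a partition to the rows *)

Lemma part_join c a b r : part (join_bar c a b) r = c * part a r + part b r.
Proof.
rewrite /part /join_bar; have [lt|ge] := ltnP r (maxn (size a) (size b)).
  by rewrite nth_mkseq.
by rewrite nth_default ?size_mkseq // -!/(part _ _) !part_default ?muln0 //; lia.
Qed.

Lemma is_part_join c a b : 0 < c -> is_part a -> is_part b -> is_part (join_bar c a b).
Proof.
move=> c0 ap bp; apply: is_partP => r; rewrite ?size_mkseq !part_join.
  by apply: leq_add; [rewrite leq_pmul2l // |]; apply: is_part_le.
by rewrite addn_gt0 muln_gt0 c0 !is_part_gt0 //; lia.
Qed.

(** The node stays in its row r, but the bead of this row has moved by c times [part al r], so k' is
    in general another position of the same class. The row letters have congruent contents, hence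
    the same [eps]. *)
Lemma fstep_join c al h k : 1 < c -> is_part al -> is_part h ->
  fstep c k (maya h) ->
  exists k', [/\ congz c k' k, fstep c k' (maya (join_bar c al h)) &
    forall h', is_part h' -> swap k (maya h) = maya h' ->
      swap k' (maya (join_bar c al h)) = maya (join_bar c al h')].
Proof.
move=> c1 alp hp st; have [A _] := st; have [r kE] := addable_posP hp A; subst k.
have c0 := ltnW c1; have jp := is_part_join c0 alp hp.
have posc s : congz c (bead (join_bar c al h) s) (bead h s).
  by apply/congzP; exists (part al s)%:Z%R; rewrite /bead part_join; lia.
have epsE t n : eps c t (row_letters (join_bar c al h) n) = eps c t (row_letters h n).
  rewrite /eps; elim: n => // n IHn; rewrite !rowsS /= IHn.
  have c2 : congz c (bead (join_bar c al h) n - 1)%R (bead h n - 1)%R by rewrite congzDr.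
  by rewrite /eps_step -(subrK 1%R t) !letter_add_row !letter_rem_row (congz_congr _ (posc n)) (congz_congr _ c2).
have [e0 low] := (fstep_rowP c1 hp r).1 st.
have st' : fstep c (bead (join_bar c al h) r) (maya (join_bar c al h)).
  apply/fstep_rowP => //.
  have tr w : eps c (bead (join_bar c al h) r + 1)%R w = eps c (bead h r + 1)%R w.
    by apply: eps_congr; rewrite congzDr.
  rewrite tr epsE; split=> // s lt cs; rewrite tr epsE; apply: low => //.
  apply: congz_trans (posc r); apply: congz_trans cs; rewrite congz_sym; exact: posc.
exists (bead (join_bar c al h) r); split=> // h' hp' E; have [A' _] := st'.
rewrite (swap_add_node jp A'); congr maya.
have <- : incr_nth h r = h'.
  by apply: maya_inj => //; [exact: is_part_incr | rewrite -swap_add_node].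
apply: is_part_inj => [||s]; first exact: is_part_incr.
  by apply: is_part_join => //; apply: is_part_incr.
by rewrite part_incr !part_join part_incr addnA.
Qed.

(* B is the diagram of lambda and D that of the conjugate of mu. Conjugation reverses the order
   of positions and exchanges beads and gaps, so in D the complement of I plays the role of I. *)
Record config (a b : int -> int) (B D X Y X' Y' : int -> bool) : Prop := Config {
  config_mB : ismaya B; config_mD : ismaya D;
  config_sB : separated a b B; config_sD : separated (mirror_enum b) (mirror_enum a) D;
  config_X : (fun k => B (a k)) = X; config_Y : (fun l => B (b l)) = Y;
  config_X' : (fun k => D (mirror_enum a k)) = X'; config_Y' : (fun l => D (mirror_enum b l)) = Y' }.

Lemma config_mirror_enum a b B D X Y X' Y' :
  config a b B D X Y X' Y' -> config (mirror_enum b) (mirror_enum a) D B Y' X' Y X.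
Proof. by case=> *; split; rewrite ?mirror_enumK. Qed.

Lemma subm1K (j : int) : (- 1 - (- 1 - j))%R = j.
Proof. by lia. Qed.

Section Refl.
Variables (e c cb : nat) (a b : int -> int) (k l : int).
Hypotheses (e1 : 1 < e) (E : enum_pair e c cb a b) (adj : (b l = a k + 1)%R).
Let x := a k.
Let s := class_swap e x.

Lemma class_swap_a k' : s (a k') = (a k' + (congz e (a k') x)%:Z)%R.
Proof.
rewrite /s /class_swap; case: ifP => c1 //; case: ifP => c2; last by lia.
exfalso; have : congz e (a k') (b l).
  by rewrite adj -(congzDr _ _ _ (-1)%R) addrK.
by case/(enum_congzE (enum_swap E)) => l' El _; apply: (enum_disj E El).
Qed.

Lemma class_swap_b l' : s (b l') = (b l' - (congz e (b l' - 1) x)%:Z)%R.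
Proof.
rewrite /s /class_swap; case: ifP => c1; last by case: ifP => c2 //; lia.
exfalso; case/(enum_congzE E): c1 => k' Ek _; exact: (enum_disj E (esym Ek)).
Qed.

Lemma class_swap_per y : s (y + e%:Z)%R = (s y + e%:Z)%R.
Proof.
have H w : congz e (w + e%:Z)%R x = congz e w x.
  by apply: congz_congr; apply/congzP; exists 1%R; lia.
rewrite /s /class_swap H (_ : y + e%:Z - 1 = y - 1 + e%:Z)%R ?H; last by lia.
by case: ifP => _; [|case: ifP => _]; lia.
Qed.

Lemma class_swap_ltE k' l' : (b l' < a k')%R -> (s (b l') < s (a k'))%R.
Proof. by rewrite class_swap_a class_swap_b; case: congz; case: congz; lia. Qed.

(** The order survives because a moving element of I has its right neighbour outside I, so the next
    element of I is at least two away; likewise for the complement. *)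
Lemma enum_refl : enum_pair e c cb (fun k => s (a k)) (fun l => s (b l)).
Proof.
split.
- move=> k'; rewrite !class_swap_a; have := enum_inc1 E k'; case: (boolP (congz e (a k') x)) => c1; last first.
    by case: congz; lia.
  have : congz e (a k' + 1)%R (b l) by rewrite adj congzDr.
  case/(enum_congzE (enum_swap E)) => l' El _; have := enum_disj E (k := (k' + 1)%R) (l := l').
  by case: congz; lia.
- move=> l'; rewrite !class_swap_b; have := enum_inc2 E l'.
  case: (boolP (congz e (b (l' + 1) - 1) x)) => c1; last by case: congz; lia.
  case/(enum_congzE E): c1 => k' Ek _; have := enum_disj E (k := k') (l := l').
  by case: congz; lia.
- by move=> k'; rewrite (enum_per1 E) class_swap_per.
- by move=> k'; rewrite (enum_per2 E) class_swap_per.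
- move=> y; case: (enum_cover E (s y)) => -[z zE]; [left|right]; exists z;
  by rewrite -zE /s class_swapK.
- move=> k' l' /(congr1 s); rewrite /s !class_swapK //; exact: (enum_disj E).
Qed.

Lemma separated_no_removable B : separated a b B -> no_removable e x B.
Proof.
move=> sB z cz; apply/negP => /andP[nz z1].
have [k' zE _] := enum_congzE E cz.
have : congz e (z + 1)%R (b l) by rewrite adj congzDr.
case/(enum_congzE (enum_swap E)) => l' El _.
by have := sB k' l'; rewrite -zE -El => /(_ z1 nz); lia.
Qed.

Lemma separated_refl B : separated a b B ->
  separated (fun k => s (a k)) (fun l => s (b l)) (reflect_at e x B).
Proof.
move=> sB k' l'; rewrite /reflect_at -/s /s !class_swapK // => Bl Bk.
exact/class_swap_ltE/sB.
Qed.

End Refl.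

Lemma reflect_comp e x B (f : int -> int) : 1 < e ->
  (fun k => reflect_at e x B (class_swap e x (f k))) = (fun k => B (f k)).
Proof. by move=> e1; apply: functional_extensionality => k; rewrite /reflect_at class_swapK. Qed.

Lemma mirror_enum_class_swap e x a : 1 < e ->
  mirror_enum (fun k => class_swap e x (a k)) = (fun k => class_swap e (- 2 - x)%R (mirror_enum a k)).
Proof. by move=> e1; apply: functional_extensionality => k; rewrite /mirror_enum class_swap_opp. Qed.

Section ReflPair.
Variables (e c cb : nat) (a b : int -> int) (k l : int).
Hypotheses (e1 : 1 < e) (E : enum_pair e c cb a b).

Let adj_mirror_enum : (b l = a k + 1)%R -> (mirror_enum a (- 1 - k) = mirror_enum b (- 1 - l) + 1)%R.
Proof. by rewrite /mirror_enum !subm1K; lia. Qed.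

Let mirror_enum_x : (b l = a k + 1)%R -> (mirror_enum b (- 1 - l) = - 2 - a k)%R.
Proof. by rewrite /mirror_enum !subm1K; lia. Qed.

Lemma config_reflect B D X Y X' Y' : (b l = a k + 1)%R -> config a b B D X Y X' Y' ->
  let s := class_swap e (a k) in
  exists B' D', config (fun k => s (a k)) (fun l => s (b l)) B' D' X Y X' Y' /\
    (reach e B D <-> reach e B' D').
Proof.
move=> adj [mB mD sB sD <- <- <- <-] s.
have EO := enum_mirror_enum E; have adj' := adj_mirror_enum adj; have ox := mirror_enum_x adj.
have nB := separated_no_removable e1 E adj sB; have nD := separated_no_removable e1 EO adj' sD.
exists (reflect_at e (a k) B), (reflect_at e (- 2 - a k)%R D); split.
  split.
  - exact: chain_ismaya (chain_reflect e1 (ismaya_bounded mB) nB) mB.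
  - rewrite -ox; exact: chain_ismaya (chain_reflect e1 (ismaya_bounded mD) nD) mD.
  - exact: (separated_refl e1 E adj sB).
  - rewrite !mirror_enum_class_swap // -ox; exact: (separated_refl e1 EO adj' sD).
  - exact: reflect_comp.
  - exact: reflect_comp.
  - rewrite mirror_enum_class_swap //; exact: reflect_comp.
  - rewrite mirror_enum_class_swap //; exact: reflect_comp.
apply: reach_reflect => //; try exact: ismaya_bounded.
  by rewrite -ox.
by rewrite (_ : a k + (- 2 - a k) + 2 = 0)%R ?congz_refl //; lia.
Qed.

(** In this direction the exchange moves I down past its complement and may destroy separation, so
    separation of the result is assumed. It is the new pair that has no removable nodes in the
    class. *)
Lemma config_unreflect B D X Y X' Y' : (a k = b l + 1)%R -> config a b B D X Y X' Y' ->
  let s := class_swap e (b l) in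
  separated (fun k => s (a k)) (fun l => s (b l)) (reflect_at e (b l) B) ->
  separated (mirror_enum (fun l => s (b l))) (mirror_enum (fun k => s (a k))) (reflect_at e (- 2 - b l)%R D) ->
  exists B' D', config (fun k => s (a k)) (fun l => s (b l)) B' D' X Y X' Y' /\
    (reach e B' D' -> reach e B D).
Proof.
move=> adj [mB mD sB sD <- <- <- <-] s sB' sD'.
have E' := enum_refl e1 (enum_swap E) adj; rewrite -/s in E'.
have sx : (s (b l) = b l + 1)%R by rewrite /s /class_swap congz_refl.
have sx1 : s (a k) = b l by rewrite adj -sx /s class_swapK.
have EO := enum_mirror_enum (enum_swap E').
have adj1 : (s (b l) = s (a k) + 1)%R by rewrite sx sx1.
have nB := separated_no_removable e1 (enum_swap E') adj1 sB'; rewrite sx1 in nB.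
have adj2 : (mirror_enum (fun k => s (a k)) (- 1 - k) = mirror_enum (fun l => s (b l)) (- 1 - l) + 1)%R.
  by rewrite /mirror_enum !subm1K; lia.
have ox : (mirror_enum (fun l => s (b l)) (- 1 - l) = - 2 - b l)%R.
  by rewrite /mirror_enum !subm1K; lia.
have nD := separated_no_removable e1 EO adj2 sD'; rewrite ox in nD.
have bB : bounded (reflect_at e (b l) B) by apply/bounded_reflect/ismaya_bounded.
have bD : bounded (reflect_at e (- 2 - b l)%R D) by apply/bounded_reflect/ismaya_bounded.
have maya_back x G : bounded (reflect_at e x G) -> no_removable e x (reflect_at e x G) -> ismaya G ->
    ismaya (reflect_at e x G).
  move=> bG nG [h hp GE]; have := chain_reflect e1 bG nG; rewrite reflect_atK // => ch.
  by case: (chain_sumn ch hp GE) => [->|[h' [hp' ->]]]; [exists h | exists h'].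
exists (reflect_at e (b l) B), (reflect_at e (- 2 - b l)%R D); split.
  split=> //; try exact: maya_back.
  - exact: reflect_comp.
  - exact: reflect_comp.
  - rewrite mirror_enum_class_swap //; exact: reflect_comp.
  - rewrite mirror_enum_class_swap //; exact: reflect_comp.
rewrite (reach_reflect e1 bB bD nB nD) ?reflect_atK //.
by rewrite (_ : b l + (- 2 - b l) + 2 = 0)%R ?congz_refl //; lia.
Qed.

End ReflPair.

Lemma enum_adj e c cb a b k k' : enum_pair e c cb a b -> congz c k' k ->
  (a (k + 1) = a k + 1)%R -> (a (k' + 1) = a k' + 1)%R.
Proof.
move=> E /congzP[j ->] adj; rewrite (enum_perZ E).
rewrite (_ : k + j * c%:Z + 1 = k + 1 + j * c%:Z)%R; last by lia.
by rewrite (enum_perZ E) adj; lia.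
Qed.

Lemma separated_swap1 e c cb a b B k : enum_pair e c cb a b -> (a (k + 1) = a k + 1)%R ->
  removable B (a k) -> separated a b B -> separated a b (swap (a k) B).
Proof.
move=> E adj /andP[nk k1] sB k' l'; rewrite (swap_enum2 E) // => Bl.
rewrite -[swap _ _ _]/((fun k' => swap (a k) B (a k')) k') (swap_enum1 E) // /swap.
case: eqP => [_|_]; first by rewrite adj k1.
case: eqP => [->|_] Bk; last exact: sB.
have := sB k l' Bl nk; have := enum_inc1 E k; lia.
Qed.

Lemma separated_swap2 e c cb a b B l : enum_pair e c cb a b -> (b (l + 1) = b l + 1)%R ->
  removable B (b l) -> separated a b B -> separated a b (swap (b l) B).
Proof.
move=> E adj /andP[nl l1] sB k' l'; rewrite (swap_enum2 (enum_swap E)) //.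
rewrite -[swap _ _ (b l')]/((fun l' => swap (b l) B (b l')) l') (swap_enum1 (enum_swap E)) // /swap.
case: eqP => [-> _|_] Bk.
  by have := sB k' (l + 1)%R; rewrite adj l1 => /(_ isT Bk); lia.
by move: Bk; case: eqP => [_|_]; [rewrite (negbTE nl) | exact: sB].
Qed.

(* A crystal operator of the c-runner abacus is one of the e-runner abacus as soon as the two
   positions involved are adjacent, which is achieved by reflections. *)
Section AddNode.
Variables (e c cb : nat) (al h0 h0' h1 h1' : seq nat) (k k' : int) (Y Y' : int -> bool).
Hypotheses (e1 : 1 < e) (c1 : 1 < c).
Hypotheses (alp : is_part al) (hp0' : is_part h0') (hp1' : is_part h1').
Hypotheses (st : fstep c k (maya h0)) (st' : fstep c k' (maya h0')).
Hypothesis kk : congz c (k + k' + 2)%R 0%R.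
Hypotheses (E1 : swap k (maya h0) = maya h1) (E1' : swap k' (maya h0') = maya h1').
Hypothesis IH : forall a b B D, enum_pair e c cb a b ->
  config a b B D (maya h0) Y (maya (join_bar c al h0')) Y' -> reach e B D.

Lemma reach_add_node a b B D : enum_pair e c cb a b ->
  config a b B D (maya h1) Y (maya (join_bar c al h1')) Y' -> reach e B D.
Proof.
have [g] := ubnP `|(a (k + 1) - a k - 1)%R|%N.
elim: g a b B D => // g IHg a b B D le E C.
have inc := enum_inc1 E k.
have [adj|nadj] := eqVneq (a (k + 1)%R) (a k + 1)%R; last first.
  have [l adjl] : exists l, (b l = a k + 1)%R.
    case: (enum_cover E (a k + 1)%R) => -[z zE]; last by exists z.
    have lt1 : (k < z)%R by rewrite -(enum_ltE E) -zE; lia.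
    have lt2 : (z < k + 1)%R by rewrite -(enum_ltE E) -zE; lia.
    by lia.
  have [B1 [D1 [C1 re]]] := config_reflect e1 E adjl C.
  apply/re; apply: IHg C1; last exact: (enum_refl e1 E adjl).
  (* The reflection raises [a k] by one and fixes [a (k + 1)], because c > 1; so the distance to be
     closed shrinks. *)
  rewrite !(class_swap_a e1 E adjl) congz_refl.
  suff -> : congz e (a (k + 1)%R) (a k) = false by lia.
  apply/negP => /(enum_congzE E)[k2 /(enum_inj E) <-].
  by rewrite (congz_excl c1 (congz_refl c k)).
have [k1' [ck st1 jE]] := fstep_join c1 alp hp0' st'.
have {}jE := jE _ hp1' E1'.
(* Under the reversal by [mirror_enum], the pair k1', k1' + 1 corresponds to -2 - k1', -1 - k1' in
   [a]. Being congruent to k modulo c, it is adjacent as well. *)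
have ckk : congz c (- 2 - k1')%R k.
  apply: (@congz_trans _ (- 2 - k')%R); first by rewrite -congzN -(congzDr _ _ _ (-2)%R); move: ck; congr congz; lia.
  by rewrite -(congzDr _ _ _ (k' + 2)%R) congz_sym; move: kk; congr congz; lia.
have adj1 := enum_adj E ckk adj.
have adj' : (mirror_enum a (k1' + 1) = mirror_enum a k1' + 1)%R.
  rewrite /mirror_enum (_ : - 1 - (k1' + 1) = - 2 - k1')%R; last by lia.
  by move: adj1; rewrite (_ : - 2 - k1' + 1 = - 1 - k1')%R; lia.
have EO := enum_mirror_enum E; have EO' := enum_swap EO.
case: C => mB mD sB sD XE YE XE' YE'.
have RB : removable B (a k).
  have := removable_swap (maya h0) k; rewrite E1 -XE; case: st => -> _.
  by rewrite /removable -adj.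
have RD : removable D (mirror_enum a k1').
  have := removable_swap (maya (join_bar c al h0')) k1'; rewrite jE -XE'; case: st1 => -> _.
  by rewrite /removable -adj'.
have XE0 : (fun j => swap (a k) B (a j)) = maya h0 by rewrite (swap_enum1 E) // XE -E1 swapK.
have XE0' : (fun j => swap (mirror_enum a k1') D (mirror_enum a j)) = maya (join_bar c al h0').
  by rewrite (swap_enum1 EO') // XE' -jE swapK.
have re : reach e (swap (a k) B) (swap (mirror_enum a k1') D).
  apply: (IH E); split => //.
  - exact: ismaya_swapR.
  - exact: ismaya_swapR.
  - exact: (separated_swap1 E).
  - exact: (separated_swap2 EO).
  - by apply: functional_extensionality => l; rewrite (swap_enum2 E) // -YE.
  - by apply: functional_extensionality => l; rewrite (swap_enum2 EO') // -YE'.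
have sB0 : fstep e (a k) (swap (a k) B) by apply: (fstep_enum E) => //; rewrite XE0.
have sD0 : fstep e (mirror_enum a k1') (swap (mirror_enum a k1') D) by apply: (fstep_enum EO') => //; rewrite XE0'.
have := reach_step re sB0 sD0; rewrite !swapK; apply.
rewrite (_ : a k + mirror_enum a k1' + 2 = a k - a (- 2 - k1'))%R; last first.
  rewrite /mirror_enum (_ : - 1 - k1' = - 2 - k1' + 1)%R ?adj1; lia.
by rewrite -(congzDr _ _ _ (a (- 2 - k1'))%R) subrK add0r congz_sym; apply: (enum_congz E).
Qed.

End AddNode.

(** * The case of empty beta and gamma *)

Lemma is_part_nil : is_part [::].
Proof. by []. Qed.

Lemma part_behead h r : part (behead h) r = part h r.+1.
Proof. by rewrite /part nth_behead. Qed.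

Lemma is_part_behead h : is_part h -> is_part (behead h).
Proof.
move=> hp; apply: is_partP => r; rewrite !part_behead; first exact: is_part_le.
by rewrite size_behead is_part_gt0 //; lia.
Qed.

Lemma maya_behead h l : is_part h ->
  maya (behead h) l = maya h (l - 1)%R && (l - 1 != bead h 0)%R.
Proof.
move=> hp; have posE r : bead (behead h) r = (bead h r.+1 + 1)%R.
  by rewrite /bead part_behead; lia.
apply/mayaP/andP => [[r ->]|[/mayaP[r rE] ne]].
  rewrite posE addrK maya_bead; split=> //; apply/eqP => /(bead_inj hp); lia.
case: r rE => [|r] rE; first by rewrite rE eqxx in ne.
by exists r; rewrite posE -rE subrK.
Qed.

Lemma behead_join c al : 0 < c -> is_part al ->
  behead (join_bar c al [::]) = join_bar c (behead al) [::].
Proof.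
move=> c0 ap; apply: is_part_inj => [||r].
- exact/is_part_behead/is_part_join.
- by apply: is_part_join => //; apply: is_part_behead.
- by rewrite part_behead !part_join part_behead !(part_default (h := [::])).
Qed.

(** When a bead crosses from the complement into I, one charge rises and the other drops by one; the
    new indexing makes both pulled-back diagrams charge zero again. *)
Lemma enum_shift e c cb a b : enum_pair e c cb a b ->
  enum_pair e c cb (fun k => a (k + 1)%R) (fun l => b (l - 1)%R).
Proof.
case=> i1 i2 p1 p2 cv d; split.
- by move=> k; apply: i1.
- by move=> l; have := i2 (l - 1)%R; rewrite subrK addrK.
- by move=> k; rewrite -p1; congr a; lia.
- by move=> k; rewrite -p2; congr b; lia.
- move=> x; case: (cv x) => -[z ->]; [left|right].
    by exists (z - 1)%R; rewrite subrK.
  by exists (z + 1)%R; rewrite addrK.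
- by move=> k l; apply: d.
Qed.

Section Base.
Variables (e c cb : nat) (al : seq nat).
Hypotheses (e1 : 1 < e) (c0 : 0 < c) (cb0 : 0 < cb) (alp : is_part al).
Let h := join_bar cb al [::].
Let hp : is_part h := is_part_join cb0 alp is_part_nil.

Let pos0 : bead h 0 = ((cb * part al 0)%:Z - 1)%R.
Proof. by rewrite /bead /h part_join (part_default (h := [::])) //; lia. Qed.

Let b_top a b : enum_pair e c cb a b -> b (bead h 0) = (b (- 1) + (e * part al 0)%:Z)%R.
Proof.
move=> E; rewrite -(enum_perN (enum_swap E)) pos0; congr b; lia.
Qed.

Lemma separated_base a b B : enum_pair e c cb a b ->
  (fun k => B (a k)) = vacuum -> (fun l => B (b l)) = maya h ->
  (b (- 1) + (e * part al 0)%:Z < a 0)%R -> separated a b B.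
Proof.
move=> E XE YE lt k l.
have -> : B (b l) = maya h l by rewrite -YE.
have -> : B (a k) = vacuum k by rewrite -XE.
move=> /mayaP[r ->]; rewrite /vacuum -leNgt => k0.
apply: le_lt_trans (lt_le_trans lt (enum_le E k0)).
by rewrite -(b_top E); apply: (enum_le (enum_swap E)); rewrite bead_leE.
Qed.

(* If the last bead of the complement of I is immediately followed by the first gap of I, moving
   it across is a crystal operator, and it deletes the first row of [al]. *)
Lemma base_step a b B (P := b (bead h 0)) : enum_pair e c cb a b -> al != [::] ->
  (fun k => B (a k)) = vacuum -> (fun l => B (b l)) = maya h -> a 0%R = (P + 1)%R ->
  [/\ fstep e P B, (fun k => swap P B (a (k + 1)%R)) = vacuum,
      (fun l => swap P B (b (l - 1)%R)) = maya (join_bar cb (behead al) [::]) &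
      separated (fun k => a (k + 1)%R) (fun l => b (l - 1)%R) (swap P B)].
Proof.
move=> E al0 XE YE aE.
have Ba k : B (a k) = vacuum k by rewrite -XE.
have Bb l : B (b l) = maya h l by rewrite -YE.
have B0 : B P by rewrite Bb maya_bead.
have B1 : B (P + 1)%R = false by rewrite -aE Ba.
have swa k : swap P B (a (k + 1)%R) = vacuum k.
  have [->|ne] := eqVneq k (- 1)%R; first by rewrite (_ : - 1 + 1 = 0)%R // aE swap_r B0.
  rewrite swap_ne; first by rewrite Ba /vacuum; move: ne; lia.
    by apply/eqP => /(enum_disj E).
  rewrite -aE; apply: contra_neq ne => /(enum_inj E); lia.
have swb l : swap P B (b (l - 1)%R) = maya (join_bar cb (behead al) [::]) l.
  rewrite -behead_join // maya_behead //.
  have [E0|ne] := eqVneq (l - 1)%R (bead h 0).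
    by rewrite E0 swap_l B1 andbF.
  rewrite swap_ne ?Bb ?andbT //; first by apply: contra_neq ne => /(enum_inj (enum_swap E)).
  by rewrite -aE; apply/eqP => /esym/(enum_disj E).
split.
- split; first by rewrite /addable B0 B1.
  (* Above P a removable node would need a bead of I at or after its first gap, below P an addable
     one would need an earlier gap of I. *)
  split=> m.
    rewrite [X in X <= _](_ : _ = 0) //; apply/eqP; rewrite /count_up -leqn0 leqNgt -has_count.
    apply/hasPn => j _; rewrite /removable.
    rewrite (_ : P + (e * j)%:Z + 1 = a 0 + (e * j)%:Z)%R; last by rewrite aE; lia.
    by rewrite -(enum_perN E) Ba /vacuum andbC add0r.
  rewrite [X in X <= _](_ : _ = 0) //; apply/eqP; rewrite /count_dn -leqn0 leqNgt -has_count.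
  apply/hasPn => j; rewrite mem_iota => /andP[j0 _]; rewrite /addable.
  rewrite (_ : P - (e * j)%:Z + 1 = a 0 - (e * j)%:Z)%R; last by rewrite aE; lia.
  by rewrite -(enum_perN' E) Ba /vacuum negb_and negbK orbC; apply/orP; left; nia.
- exact: functional_extensionality.
- exact: functional_extensionality.
move=> k l; rewrite swa swb -behead_join // maya_behead // => /andP[/mayaP[r rE] ne].
rewrite /vacuum -leNgt => k0.
apply: (@le_lt_trans _ _ P); last first.
  have := enum_lt E (k := 0%R) (l := (k + 1)%R); rewrite aE; lia.
by apply: (enum_le (enum_swap E)); rewrite rE bead_leE.
Qed.

End Base.

Lemma mirror_enum_shift1 a : mirror_enum (fun k => a (k + 1)%R) = (fun k => mirror_enum a (k - 1)%R).
Proof. by apply: functional_extensionality => k; rewrite /mirror_enum (_ : - 1 - k + 1 = - 1 - (k - 1))%R //; lia. Qed.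

Lemma mirror_enum_shift2 a : mirror_enum (fun k => a (k - 1)%R) = (fun k => mirror_enum a (k + 1)%R).
Proof. by apply: functional_extensionality => k; rewrite /mirror_enum (_ : - 1 - k - 1 = - 1 - (k + 1))%R //; lia. Qed.

Lemma mirror_enum_0 a : mirror_enum a 0 = (- 1 - a (- 1))%R.
Proof. by rewrite /mirror_enum subr0. Qed.

Lemma mirror_enum_N1 a : mirror_enum a (- 1) = (- 1 - a 0)%R.
Proof. by rewrite /mirror_enum subrr. Qed.

Lemma enum_locate e c cb a b q : 0 < e -> 0 < cb -> enum_pair e c cb a b ->
  (forall l, b l <> q) -> exists l, (b l < q < b (l + 1))%R.
Proof.
move=> e0 cb0 E nq.
pose z0 : int := b 0%R.
have [w [wq1 wq2]] : exists w : nat, (z0 - q < w%:Z)%R /\ (q - z0 < w%:Z)%R.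
  by exists (`|(z0 - q)%R|%N.+1); lia.
have ew : w <= e * w by rewrite leq_pmull.
pose l0 : int := (0 - (cb * w)%:Z)%R.
have l0E : b l0 = (z0 - (e * w)%:Z)%R := enum_perN' (enum_swap E) 0%R w.
have l0q : (b l0 < q)%R by rewrite l0E; lia.
have ex : exists n : nat, (q <= b (l0 + n%:Z))%R.
  exists (cb * (2 * w)).
  have -> : (l0 + (cb * (2 * w))%:Z = 0 + (cb * w)%:Z)%R by rewrite /l0; lia.
  have -> : b (0 + (cb * w)%:Z)%R = (z0 + (e * w)%:Z)%R := enum_perN (enum_swap E) 0%R w.
  by lia.
case: (ex_minnP ex) => -[|n]; first by rewrite addr0 => H; exfalso; lia.
move=> le min_n; exists (l0 + n%:Z)%R.
have lt1 : (b (l0 + n%:Z) < q)%R.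
  by rewrite ltNge; apply/negP => /min_n; lia.
rewrite lt1 lt_neqAle (_ : l0 + n%:Z + 1 = l0 + n.+1%:Z)%R ?le ?andbT; last by lia.
by apply/eqP => /esym; apply: nq.
Qed.

Section BaseReach.
Variables (e c cb : nat).
Hypotheses (e1 : 1 < e) (c0 : 0 < c) (cb0 : 0 < cb).

Lemma reach_base_nil a b B D : enum_pair e c cb a b ->
  config a b B D vacuum vacuum vacuum vacuum -> reach e B D.
Proof.
move=> E [mB mD sB sD XE YE XE' YE'].
have Ba k : B (a k) = vacuum k by rewrite -XE.
have Bb l : B (b l) = vacuum l by rewrite -YE.
have Da k : D (mirror_enum a k) = vacuum k by rewrite -XE'.
have Db k : D (mirror_enum b k) = vacuum k by rewrite -YE'.
have -> : D = mirror B.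
  apply: functional_extensionality => y; rewrite /mirror.
  case: (enum_cover E (- 1 - y)%R) => -[z zE].
    have -> : y = mirror_enum a (- 1 - z)%R by rewrite /mirror_enum subm1K -zE subm1K.
    by rewrite Da /mirror_enum !subm1K Ba /vacuum; lia.
  have -> : y = mirror_enum b (- 1 - z)%R by rewrite /mirror_enum subm1K -zE subm1K.
  by rewrite Db /mirror_enum !subm1K Bb /vacuum; lia.
apply: reach_core => // y; case: (enum_cover E y) => -[z ->].
  by rewrite -(enum_per1 E) !Ba /vacuum; lia.
by rewrite -(enum_per2 E) !Bb /vacuum; lia.
Qed.

(* Reflections that bring I closer to its complement end in the situation of [base_step]. The
   outer induction is on the distance d between the last bead of the complement of I and the
   first gap of I, the inner one on the distance from that gap to the previous position outside
   I. *)
Lemma reach_base al a b B D : is_part al -> enum_pair e c cb a b ->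
  config a b B D vacuum (maya (join_bar cb al [::])) (maya (join_bar c al [::])) vacuum -> reach e B D.
Proof.
elim: al a b B D => [|p0 al' IHal] a b B D alp E C.
  by apply: (reach_base_nil E); move: C; rewrite /join_bar /= maya_vacuum.
set al := p0 :: al' in alp C; set p := part al 0.
have hp := is_part_join cb0 alp is_part_nil.
have hp' := is_part_join c0 alp is_part_nil.
pose d (a b : int -> int) := `|(a 0 - (b (- 1) + (e * p)%:Z) - 1)%R|%N.
have [n] := ubnP (d a b); elim: n a b B D E C => // n IHn a b B D E C lt_d.
have [l] : exists l, (b l < a 0 < b (l + 1))%R.
  by apply: (enum_locate (ltnW e1) cb0 E) => l /esym/(enum_disj E).
have [m] := ubnP `|(a 0 - b l)%R|%N.
elim: m a b B D E C lt_d => // m IHm a b B D E C lt_d lt_m ll.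
have topE : b (bead (join_bar cb al [::]) 0) = (b (- 1) + (e * p)%:Z)%R.
  rewrite -(enum_perN (enum_swap E)) /bead part_join (part_default (h := [::])) //; congr b; lia.
have topE' : mirror_enum a (bead (join_bar c al [::]) 0) = (mirror_enum a (- 1) + (e * p)%:Z)%R.
  rewrite -(enum_perN (enum_swap (enum_mirror_enum E))) /bead part_join (part_default (h := [::])) //; congr (mirror_enum a _); lia.
case: (C) => mB mD sB sD XE YE XE' YE'.
have PQ : (b (- 1) + (e * p)%:Z < a 0)%R.
  rewrite -topE; apply: sB.
    by rewrite (congr1 (fun f => f _) YE) maya_bead.
  by rewrite (congr1 (fun f => f _) XE).
have EO := enum_mirror_enum E.
have [d0|d0] := eqVneq (a 0%R) (b (- 1) + (e * p)%:Z + 1)%R.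
  have [||sP XP YP SP] := base_step e1 c0 cb0 alp E _ XE YE; rewrite ?topE //.
  (* For [D] the distance between last bead and first gap is the same number, a 0 - b (-1) - e p, so
     both sides are ready at the same moment. *)
  have [||sP' XP' YP' SP'] := base_step e1 cb0 c0 alp EO _ YE' XE'; rewrite ?topE' //.
    by rewrite mirror_enum_0 mirror_enum_N1 d0; lia.
  rewrite topE topE' in sP XP YP SP sP' XP' YP' SP'.
  set P := (b (- 1) + (e * p)%:Z)%R in sP XP YP SP d0 PQ.
  set P' := (mirror_enum a (- 1) + (e * p)%:Z)%R in sP' XP' YP' SP'.
  (* The induction hypothesis concerns the larger diagrams with the shorter alpha; [reach_estep]
     then takes the node away again. *)
  have re : reach e (swap P B) (swap P' D).
    apply: IHal (enum_shift E) _; first exact: (is_part_behead alp).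
    split=> //.
    - by apply: ismaya_swapA => //; case: sP.
    - by apply: ismaya_swapA => //; case: sP'.
    - by rewrite mirror_enum_shift1 mirror_enum_shift2.
    - by rewrite mirror_enum_shift1.
    - by rewrite mirror_enum_shift2.
  have [y [cy ey re']] := reach_estep e1 re (fstep_swap e1 sP).
  have yE : y = P'.
    apply: (estep_uniq (ltnW e1) ey (fstep_swap e1 sP')).
    have c2 : congz e (P + P' + 2)%R 0%R.
      apply/congzP; exists p%:Z%R; rewrite /P' mirror_enum_N1 d0 /P; lia.
    have : congz e (P + y + 2)%R (P + P' + 2)%R by apply: congz_trans cy _; rewrite congz_sym.
    by rewrite congzDr ![(P + _)%R]addrC congzDr.
  by move: re'; rewrite yE !swapK.
have [k adj] : exists k, (a k = b l + 1)%R.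
  case: (enum_cover E (b l + 1)%R) => -[z zE]; first by exists z.
  have lt1 : (l < z)%R by rewrite -(enum_ltE (enum_swap E)) -zE; lia.
  have lt2 : (z < l + 1)%R by rewrite -(enum_ltE (enum_swap E)) -zE; lia.
  by lia.
have Pl : (b (- 1) + (e * p)%:Z <= b l)%R.
  rewrite -topE; apply: (enum_le (enum_swap E)).
  have : (bead (join_bar cb al [::]) 0 < l + 1)%R.
    by rewrite -(enum_ltE (enum_swap E)) topE; lia.
  by lia.
set s := class_swap e (b l).
have sb := class_swap_a e1 (enum_swap E) adj; have sa := class_swap_b e1 (enum_swap E) adj.
rewrite -/s in sa sb.
have E' := enum_swap (enum_refl e1 (enum_swap E) adj); rewrite -/s in E'.
(* The order could only be lost if both ends moved. Then a 0 - 1 is congruent to the last bead and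
   different from it, so they are at least e apart. *)
have PQ' : (s (b (- 1)) + (e * p)%:Z < s (a 0))%R.
  rewrite sa sb; case: (boolP (congz e (b (- 1)%R) (b l))) => c1; last by case: congz; lia.
  case: (boolP (congz e (a 0%R - 1)%R (b l))) => c2; last by lia.
  have c3 : congz e (a 0%R - 1)%R (b (- 1) + (e * p)%:Z)%R.
    apply: congz_trans c2 _; rewrite congz_sym; apply: congz_trans c1; exact: congz_shift.
  by have [|j j0 jE] := congz_gt (ltnW e1) c3 _; nia.
have [||B' [D' [C' re]]] := config_unreflect e1 E adj C.
- by apply: (separated_base e1 c0 cb0 alp E') => //; rewrite reflect_comp.
- apply: (separated_base e1 cb0 c0 alp (enum_mirror_enum E')).
  + by rewrite mirror_enum_class_swap // reflect_comp.
  + by rewrite mirror_enum_class_swap // reflect_comp.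
  by rewrite mirror_enum_0 mirror_enum_N1; lia.
apply: re.
(* If one of the two ends moved, d has dropped. Otherwise only [b l] has come closer to [a 0]. *)
have [u0|u0] := boolP (congz e (b (- 1)%R) (b l) || congz e (a 0%R - 1)%R (b l)).
  apply: IHn E' C' _; move: lt_d PQ PQ' u0; rewrite /d sa sb.
  by case: congz; case: congz; lia.
have sa0 : s (a 0%R) = a 0%R by rewrite sa; move: u0; case: congz; case: congz; lia.
have sb1 : s (b (- 1)%R) = b (- 1)%R by rewrite sb; move: u0; case: congz; case: congz; lia.
have sbl : s (b l) = (b l + 1)%R by rewrite sb congz_refl.
have lt2 : (b l + 1 < a 0)%R.
  move: u0; rewrite negb_or => /andP[_]; case: (a 0%R =P b l + 1)%R => [->|]; last by lia.
  by rewrite addrK congz_refl.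
apply: (IHm _ _ _ _ E' C'); rewrite ?sa0 ?sbl.
- by rewrite /d sa0 sb1.
- by lia.
- by rewrite sb; case: congz; lia.
Qed.

End BaseReach.

(** * Building beta and gamma node by node *)

Section Full.
Variables (e c cb : nat) (al : seq nat).

Lemma reach_add (Y Y' : int -> bool) : 1 < e -> 1 < c -> is_part al ->
  (forall a b B D, enum_pair e c cb a b ->
    config a b B D vacuum Y (maya (join_bar c al [::])) Y' -> reach e B D) ->
  forall X X', reach c X X' -> forall h h', is_part h -> is_part h' ->
  X = maya h -> X' = maya h' ->
  forall a b B D, enum_pair e c cb a b ->
    config a b B D (maya h) Y (maya (join_bar c al h')) Y' -> reach e B D.
Proof.
move=> e1 c1 alp base X X'; elim=> [|{}X {}X' x y re IH sx sy xy] h h' hp hp' XE XE' a b B D E.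
  have <- : [::] = h by apply: maya_inj; rewrite ?maya_vacuum.
  have <- : [::] = h' by apply: maya_inj; rewrite ?maya_vacuum.
  by rewrite maya_vacuum; apply: base.
have [h0 [h0' [hp0 hp0' XE0 XE0' _]]] := reach_parts c1 re.
rewrite XE0 XE0' in sx sy XE XE'.
apply: (reach_add_node e1 c1 alp hp0' hp' sx sy xy XE XE' _ E) => a1 b1 B1 D1 E1.
exact: (IH h0 h0').
Qed.

End Full.

(* For c = 1 the crystal operators are meaningless, and the only partition is the empty one. *)
Definition mreach c X X' := if c == 1 then X = vacuum /\ X' = vacuum else reach c X X'.

Lemma reach_full e c cb al h h' k k' a b B D : 1 < e -> 0 < c -> 0 < cb ->
  is_part al -> is_part h -> is_part h' -> is_part k -> is_part k' ->
  mreach c (maya h) (maya h') -> mreach cb (maya k) (maya k') ->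
  enum_pair e c cb a b ->
  config a b B D (maya h) (maya (join_bar cb al k)) (maya (join_bar c al h')) (maya k') ->
  reach e B D.
Proof.
move=> e1 c0 cb0 alp hp hp' kp kp' rh rk.
have nilE g : is_part g -> maya g = vacuum -> g = [::].
  by move=> gp gE; apply: maya_inj; rewrite ?maya_vacuum.
have step1 a1 b1 B1 D1 : enum_pair e c cb a1 b1 ->
    config a1 b1 B1 D1 (maya h) (maya (join_bar cb al [::])) (maya (join_bar c al h')) vacuum ->
    reach e B1 D1.
  have base a2 b2 B2 D2 := @reach_base e c cb e1 c0 cb0 al a2 b2 B2 D2 alp.
  move: rh; rewrite /mreach; case: eqP => [_ [/nilE-> // /nilE-> //]|c1 rh].
    by rewrite maya_vacuum; apply: base.
  by apply: (reach_add e1 _ alp base rh) => //; lia.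
move=> E C; move: rk; rewrite /mreach; case: eqP => [_ [kE kE']|cb1 rk].
  by move: C; rewrite kE' (nilE _ kp kE); apply: step1.
(* Now gamma plays the part of beta: conjugation exchanges I with its complement and lambda with mu,
   and the case of arbitrary beta with empty gamma becomes the starting point. *)
apply: reach_sym; have C' := config_mirror_enum C; have E' := enum_mirror_enum E.
have base a1 b1 B1 D1 : enum_pair e cb c a1 b1 ->
    config a1 b1 B1 D1 vacuum (maya (join_bar c al h')) (maya (join_bar cb al [::])) (maya h) ->
    reach e B1 D1.
  by move=> E1 /config_mirror_enum C1; apply/reach_sym/(step1 _ _ _ _ (enum_mirror_enum E1) C1).
by apply: (reach_add e1 _ alp base (reach_sym rk) kp' kp erefl erefl E' C'); lia.
Qed.

(** * Abacus displays *)

Lemma is_part_join_copies c a b : is_part a -> is_part b -> is_part (join_copies c a b).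
Proof.
move=> /andP[_ /allP ap] /andP[_ /allP bp]; apply/andP; split.
  by apply: sort_sorted => x y; exact: leq_total.
rewrite all_sort all_cat; apply/andP; split; first exact/allP.
by apply/allP => x /flattenP[_ /mapP[y /ap y0 ->]]; rewrite mem_nseq => /andP[_ /eqP->].
Qed.

(** Parts of [conj a] are columns of [a]; repeating each of them c times multiplies every row of [a]
    by c. *)
Lemma conj_join_copies c a b : 0 < c -> is_part a -> is_part b ->
  conj (join_copies c (conj a) b) = join_bar c a (conj b).
Proof.
move=> c0 ap bp; have ap' := is_part_conj ap; have bp' := is_part_conj bp.
have jp := is_part_join_copies c ap' bp.
apply: is_part_inj => [||s]; [exact: is_part_conj | exact: is_part_join |].
rewrite part_conj // part_join part_conj // -[in RHS](conjK ap) part_conj //.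
rewrite /join_copies count_sort count_cat addnC; congr addn.
by elim: (conj a) => [|x l IHl] /=; rewrite ?muln0 // count_cat IHl count_nseq mulnDr mulnC.
Qed.

Lemma restricted_restrictedM c h : 0 < c -> is_part h -> restricted c h -> restrictedM c (maya h).
Proof.
move=> c0 hp /allP rh p /mayaP[r ->]; have le := is_part_le r hp.
exists (part h r - part h r.+1).+1.
  have [lt|ge] := ltnP r (size h); first by have := rh r; rewrite mem_iota lt => /(_ isT); lia.
  by rewrite (part_default ge); lia.
apply/mayaP; exists r.+1; rewrite /bead; lia.
Qed.

Lemma restricted1 h : is_part h -> restricted 1 h -> h = [::].
Proof.
move=> hp /allP rh; apply/eqP; rewrite -size_eq0 -leqn0 leqNgt; apply/negP => h0.
have := rh (size h).-1; rewrite mem_iota prednK // leq_addr add0n leqnn => /(_ isT).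
rewrite (@part_default h (size h)) // subn0.
by have := is_part_gt0 (size h).-1 hp; rewrite prednK // leqnn; lia.
Qed.

Lemma mreach_mullineux c h : 0 < c -> is_part h -> restricted c h ->
  is_part (mullineux c (conj h)) /\ mreach c (maya h) (maya (conj (mullineux c (conj h)))).
Proof.
move=> c0 hp rh; rewrite /mreach; case: eqP => [c1|c1].
  by move: rh; rewrite c1 => /(restricted1 hp) ->; rewrite maya_vacuum.
have c2 : 1 < c by lia.
have [||mp re] := @mullineux_reach c c2 (conj h).
- exact: is_part_conj.
- by rewrite conjK //; apply: restricted_restrictedM.
by rewrite conjK // in re.
Qed.

Lemma count_itv A B n : count (fun j => A <= j < B) (iota 0 n) <= B - A.
Proof.
rewrite -size_filter -(size_iota A (B - A)); apply: uniq_leq_size.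
  by rewrite filter_uniq ?iota_uniq.
by move=> j; rewrite mem_filter !mem_iota => /andP[/andP[] ]; lia.
Qed.

Lemma restrictedM_regular e h : is_part h -> restrictedM e (maya h) -> regular e (conj h).
Proof.
move=> hp rh; apply/allP => x xin.
have x0 : 0 < x.
  by have /andP[_ /allP] := is_part_conj hp; apply.
(* The multiplicity of x in the conjugate is the number of columns j with part h x <= j < part h (x
   - 1). *)
apply: (@leq_ltn_trans (part h x.-1 - part h x)).
  rewrite /conj count_map; apply: leq_trans (count_itv _ _ (head 0 h)).
  apply: sub_count => j /= /eqP jx.
  by rewrite leqNgt -count_gt_part // -count_gt_part // jx; lia.
have [j j_e /mayaP[r rE]] := rh _ (maya_bead h x.-1).
have lt : x.-1 < r by rewrite -(bead_ltE _ _ hp) -rE; lia.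
have : (bead h r <= bead h x)%R by rewrite bead_leE //; lia.
by rewrite -rE /bead; lia.
Qed.

(** * Enumerating a periodic set of positions *)

Section Enumeration.
Variables (e c : nat) (J : int -> bool).
Hypotheses (e0 : 0 < e) (c0 : 0 < c).
Hypothesis per : forall x, J (x + e%:Z)%R = J x.
Hypothesis cE : count (fun r => J (Posz r)) (iota 0 e) = c.
Let JN : pred nat := fun p => J (Posz p).
Let cs := [seq r <- iota 0 e | JN r].

(** With k = q c + r, the value is the r-th residue of [J] moved by q periods. Index 0 is thus the
    first nonnegative element of [J], so on the display [ienum] is inverse to the relabelling
    [rank_in]. *)
Definition ienum (k : int) : int :=
  ((k %/ c%:Z)%Z * e%:Z + (nth 0%N cs `|(k %% c%:Z)%Z|)%:Z)%R.

Let size_cs : size cs = c.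
Proof. by rewrite size_filter. Qed.

Lemma ienumE q r : r < c -> ienum (q * c%:Z + r%:Z)%R = (q * e%:Z + (nth 0%N cs r)%:Z)%R.
Proof.
move=> lt; have cn : (c%:Z != 0)%R by lia.
rewrite /ienum divzMDl // modzMDl divz_small ?modz_small; try by lia.
by rewrite addr0.
Qed.

Lemma zdecomp k : exists q r, r < c /\ k = (q * c%:Z + r%:Z)%R.
Proof.
exists (k %/ c%:Z)%Z, `|(k %% c%:Z)%Z|%N.
have ge : (0 <= (k %% c%:Z)%Z)%R by apply: modz_ge0; lia.
have lt : ((k %% c%:Z)%Z < c%:Z)%R by apply: ltz_pmod; lia.
split; first by lia.
by rewrite gez0_abs // -divz_eq.
Qed.

Lemma nth_cs r : r < c -> JN (nth 0%N cs r) /\ nth 0 cs r < e.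
Proof.
rewrite -size_cs => /(mem_nth 0); rewrite mem_filter mem_iota => /andP[-> /andP[_ ?]].
by split.
Qed.

Lemma perZ x q : J (x + q * e%:Z)%R = J x.
Proof.
have perN y (n : nat) : J (y + n%:Z * e%:Z)%R = J y.
  elim: n => [|n IHn]; first by rewrite mul0r addr0.
  by rewrite -IHn -[RHS]per; congr J; lia.
case: q => n; first exact: perN.
by rewrite -(perN _ n.+1); congr J; lia.
Qed.

Lemma J_ienum k : J (ienum k).
Proof.
have [q [r [lt ->]]] := zdecomp k; rewrite ienumE // addrC perZ.
by have [] := nth_cs lt.
Qed.

Lemma ienum_per k : ienum (k + c%:Z)%R = (ienum k + e%:Z)%R.
Proof.
have [q [r [lt ->]]] := zdecomp k.
rewrite (_ : q * c%:Z + r%:Z + c%:Z = (q + 1) * c%:Z + r%:Z)%R; last by lia.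
by rewrite !ienumE //; lia.
Qed.

Lemma ienum_inc k : (ienum k < ienum (k + 1))%R.
Proof.
have [q [r [lt ->]]] := zdecomp k; have [_ lt1] := nth_cs lt.
have [lt2|ge] := ltnP r.+1 c.
  rewrite (_ : q * c%:Z + r%:Z + 1 = q * c%:Z + r.+1%:Z)%R; last by lia.
  rewrite !ienumE // ltrD2l ltz_nat.
  have srt : sorted ltn cs by apply: sorted_filter; [exact: ltn_trans | exact: iota_ltn_sorted].
  by move/(sortedP 0): srt; apply; rewrite size_cs.
rewrite (_ : q * c%:Z + r%:Z + 1 = (q + 1) * c%:Z + 0%:Z)%R; last by lia.
by rewrite !ienumE //; lia.
Qed.

Lemma ienum_inj : injective ienum.
Proof.
move=> k k' E; have lt := incr_lt ienum_inc.
by case: (ltgtP k k') => // /lt; rewrite E ltxx.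
Qed.

Lemma ienum_neg k : (ienum k < 0)%R = (k < 0)%R.
Proof.
have [q [r [lt ->]]] := zdecomp k; rewrite ienumE //; have [_ lt1] := nth_cs lt.
by case: q => q; [lia | apply/idP/idP => _; nia].
Qed.

Lemma ienum_cover x : J x -> exists k, x = ienum k.
Proof.
move=> Jx; pose r := `|(x %% e%:Z)%Z|%N.
have ge : (0 <= (x %% e%:Z)%Z)%R by apply: modz_ge0; lia.
have lt : ((x %% e%:Z)%Z < e%:Z)%R by apply: ltz_pmod; lia.
have xE : x = ((x %/ e%:Z)%Z * e%:Z + r%:Z)%R by rewrite /r gez0_abs // -divz_eq.
have rcs : r \in cs.
  rewrite mem_filter mem_iota /JN; apply/andP; split; last by rewrite /r; lia.
  by rewrite -(perZ _ (x %/ e%:Z)%Z) addrC -xE.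
exists ((x %/ e%:Z)%Z * c%:Z + (index r cs)%:Z)%R.
by rewrite ienumE ?nth_index // -size_cs index_mem.
Qed.

Lemma rank_cs r : r < e -> JN r -> nth 0 cs (rank_in JN r) = r /\ rank_in JN r < c.
Proof.
move=> lt Jr; have cE' : cs = [seq x <- iota 0 r | JN x] ++ r :: [seq x <- iota r.+1 (e - r.+1) | JN x].
  rewrite /cs {1}(_ : e = r + (1 + (e - r.+1))); last by lia.
  by rewrite !iotaD !filter_cat /= Jr add0n addn1.
have sz : size [seq x <- iota 0 r | JN x] = rank_in JN r by rewrite size_filter.
split; first by rewrite cE' nth_cat sz ltnn subnn.
by rewrite -size_cs cE' size_cat sz /=; lia.
Qed.

Lemma ienum_rank (p : nat) : JN p -> ienum (rank_in JN p)%:Z%R = (p%:Z)%R.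
Proof.
move=> Jp; have pE := divn_eq p e; have lt : p %% e < e by rewrite ltn_pmod.
have J' (q r : nat) : JN (q * e + r) = JN r.
  by rewrite /JN -(perZ r%:Z q%:Z); congr J; lia.
have Jr : JN (p %% e) by rewrite -(J' (p %/ e)) -pE.
have rE (q r : nat) : rank_in JN (q * e + r) = q * c + rank_in JN r.
  elim: q => [|q IHq]; first by [].
  rewrite /rank_in mulSn -addnA iotaD count_cat add0n cE mulSn -addnA -IHq.
  congr addn; rewrite /rank_in -[X in iota X _](addn0 e) iotaDl count_map; apply: eq_count => x /=.
  by rewrite /JN -[RHS]per; congr J; lia.
have [nE lt'] := rank_cs lt Jr.
rewrite pE rE PoszD PoszM ienumE // nE; lia.
Qed.

End Enumeration.

Lemma mem_display n l (p : nat) : is_part l -> size l <= n ->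
  (p \in display n l) = maya l (p%:Z - n%:Z)%R.
Proof.
move=> lp sz; apply/mapP/mayaP => -[r].
  by rewrite mem_iota => lt ->; exists r; rewrite /bead; lia.
move=> rE; have lt : r < n.
  rewrite ltnNge; apply/negP => ge; move: rE; rewrite bead_default ?(leq_trans sz) //; lia.
by exists r; rewrite ?mem_iota //; move: rE; rewrite /bead; lia.
Qed.

Lemma display_uniq n l : is_part l -> uniq (display n l).
Proof.
move=> lp; rewrite map_inj_in_uniq ?iota_uniq // => r s.
rewrite !mem_iota => lt1 lt2 E; apply: (bead_inj lp); move: E; rewrite /bead; lia.
Qed.

Section Beads.
Variable s : seq nat.
Hypothesis us : uniq s.
Let t := sort geq s.
Let N := size s.

Let size_t : size t = N. Proof. exact: size_sort. Qed.

Let t_dec i : i.+1 < N -> nth 0 t i.+1 < nth 0 t i.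
Proof.
move=> lt; have srt : sorted geq t by apply: sort_sorted => x y; exact: leq_total.
have ut : uniq t by rewrite sort_uniq.
rewrite ltn_neqAle nth_uniq ?size_t //; last by lia.
by rewrite (_ : (_ == _) = false) /=; [move/(sortedP 0): srt; apply; rewrite size_t | lia].
Qed.

Let t_ge i : i < N -> N - i.+1 <= nth 0 t i.
Proof.
move=> lt; have [k] := ubnP (N - i); elim: k i lt => // k IHk i lt le.
have [lt1|ge] := ltnP i.+1 N; last by lia.
by have := IHk i.+1 lt1; have := t_dec lt1; lia.
Qed.

Let q := [seq nth 0 t r - (N - r.+1) | r <- iota 0 N].

Let nth_q r : nth 0 q r = nth 0 t r - (N - r.+1).
Proof.
have [lt|ge] := ltnP r N; first by rewrite (nth_map 0) ?size_iota // nth_iota.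
by rewrite !nth_default // ?size_t // size_map size_iota.
Qed.

Let q_dec r : nth 0 q r.+1 <= nth 0 q r.
Proof.
rewrite !nth_q; have [lt|ge] := ltnP r.+1 N; first by have := t_dec lt; lia.
by rewrite (@nth_default _ 0 t) ?size_t.
Qed.

Let pE : part_of_beads s = [seq x <- q | 0 < x].
Proof. by rewrite /part_of_beads /= size_t. Qed.

Lemma bead_of_beads r : r < N -> (bead (part_of_beads s) r + N%:Z = (nth 0%N t r)%:Z)%R.
Proof.
by move=> lt; rewrite /bead pE part_filter_gt0 // /part nth_q; have := t_ge lt; lia.
Qed.

Lemma maya_of_beads_neg (y : int) : (y < 0)%R -> maya (part_of_beads s) (y - N%:Z)%R.
Proof.
move=> y0; apply/mayaP; exists `|(y - N%:Z + 1)%R|%N.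
by rewrite /bead pE part_filter_gt0 // /part nth_q nth_default ?size_t; lia.
Qed.

Lemma maya_of_beads (m : nat) : maya (part_of_beads s) (m%:Z - N%:Z)%R = (m \in s).
Proof.
rewrite -(mem_sort geq) -/t; apply/mayaP/idP => [[r rE]|/(nthP 0)[r]].
  have lt : r < N.
    rewrite ltnNge; apply/negP => ge; move: rE.
    by rewrite /bead pE part_filter_gt0 // /part nth_q nth_default ?size_t; lia.
  have := bead_of_beads lt; rewrite -rE subrK => -[->].
  by rewrite mem_nth ?size_t.
rewrite size_t => lt mE; exists r.
by have := bead_of_beads lt; rewrite mE; lia.
Qed.

End Beads.

Section SubPart.
Variables (e c n u : nat) (J : int -> bool).
Hypotheses (e0 : 0 < e) (c0 : 0 < c).
Hypothesis per : forall x, J (x + e%:Z)%R = J x.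
Hypothesis cE : count (fun r => J (Posz r)) (iota 0 e) = c.
Variable l : seq nat.
Hypotheses (lp : is_part l) (sz : size l <= n).
Let JN : pred nat := fun p => J (Posz p).
Hypothesis uE : count JN (display n l) = u.

(** An n-bead display is the Maya diagram shifted by n, and [sub_part] is read from a display with u
    beads; the two shifts account for this. Negative positions are occupied on both sides. *)
Lemma maya_sub_part k :
  maya l (ienum e c J (k + u%:Z) - n%:Z)%R = maya (sub_part JN n l) k.
Proof.
rewrite /sub_part; set s := [seq rank_in JN p | p <- display n l & JN p].
have rk p : JN p -> ienum e c J (rank_in JN p)%:Z%R = (p%:Z)%R := ienum_rank e0 c0 per cE (p := p).
have us : uniq s.
  rewrite map_inj_in_uniq ?filter_uniq ?display_uniq // => p p'.
  rewrite !mem_filter => /andP[Jp _] /andP[Jp' _] E.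
  by have := rk p Jp; rewrite E rk // => -[].
have ss : size s = u by rewrite size_map size_filter.
have kE : k = (k + u%:Z - (size s)%:Z)%R by rewrite ss addrK.
rewrite [in RHS]kE; case: (ltrP (k + u%:Z)%R 0%R) => [lt|ge].
  rewrite maya_of_beads_neg //; apply/orP; left.
  by have := ienum_neg e0 c0 cE (k + u%:Z)%R; rewrite lt; lia.
move: (k + u%:Z)%R ge => [] // m _; rewrite maya_of_beads //.
have := ienum_neg e0 c0 cE m%:Z; rewrite [(m%:Z < 0)%R]ltNge lez_nat leq0n /=.
case iE: (ienum e c J m) => [p|p] // _.
have Jp : JN p by rewrite /JN -iE J_ienum.
have rp : rank_in JN p = m.
  by have := rk p Jp; rewrite -iE => /(ienum_inj e0 c0 cE) [] ->.
have -> : maya l (p%:Z - n%:Z)%R = (p \in display n l) by rewrite mem_display.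
apply/idP/mapP => [pd|[p' ]].
  by exists p; rewrite ?mem_filter ?Jp.
rewrite mem_filter => /andP[Jp' pd'] mE.
by have := rk p' Jp'; rewrite -mE iE => -[->].
Qed.

End SubPart.

Section Runners.
Variables (e c n u : nat) (I : int -> bool).
Hypotheses (e0 : 0 < e) (c0 : 0 < c) (lt_ce : c < e) (le_un : u <= n).
Hypothesis per : forall x, I (x + e%:Z)%R = I x.
Hypothesis cE : count (fun r => I (Posz r)) (iota 0 e) = c.

Definition runI (k : int) : int := (ienum e c I (k + u%:Z) - n%:Z)%R.
Definition runIc (k : int) : int :=
  (ienum e (e - c) (fun x => ~~ I x) (k + (n - u)%:Z) - n%:Z)%R.

Let perC x : ~~ I (x + e%:Z)%R = ~~ I x. Proof. by rewrite per. Qed.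

Let cEC : count (fun r => ~~ I (Posz r)) (iota 0 e) = e - c.
Proof.
have : c + count (fun r => ~~ I (Posz r)) (iota 0 e) = e.
  by rewrite -{1}cE count_predC size_iota.
by lia.
Qed.

Let ec0 : 0 < e - c. Proof. by lia. Qed.

Lemma enum_run : enum_pair e c (e - c) runI runIc.
Proof.
split; rewrite /runI /runIc.
- move=> k; have := ienum_inc e0 c0 cE (k + u%:Z)%R.
  by rewrite (_ : k + u%:Z + 1 = k + 1 + u%:Z)%R; lia.
- move=> k; have := @ienum_inc e (e - c) (fun x => ~~ I x) e0 ec0 cEC (k + (n - u)%:Z)%R.
  by rewrite (_ : k + (n - u)%:Z + 1 = k + 1 + (n - u)%:Z)%R; lia.
- move=> k; have := ienum_per e0 c0 cE (k + u%:Z)%R.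
  by rewrite (_ : k + u%:Z + c%:Z = k + c%:Z + u%:Z)%R; lia.
- move=> k; have := @ienum_per e (e - c) (fun x => ~~ I x) e0 ec0 cEC (k + (n - u)%:Z)%R.
  by rewrite (_ : k + (n - u)%:Z + (e - c)%:Z = k + (e - c)%:Z + (n - u)%:Z)%R; lia.
- move=> x; case: (boolP (I (x + n%:Z)%R)) => Ix; [left | right].
    have [k kE] := ienum_cover e0 c0 per cE Ix; exists (k - u%:Z)%R.
    by rewrite subrK -kE addrK.
  have [k kE] := @ienum_cover e (e - c) (fun x => ~~ I x) e0 ec0 perC cEC _ Ix; exists (k - (n - u)%:Z)%R.
  by rewrite subrK -kE addrK.
move=> k l /addIr E; have := @J_ienum e (e - c) (fun x => ~~ I x) e0 ec0 perC cEC (l + (n - u)%:Z)%R.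
by rewrite -E J_ienum.
Qed.

Section Display.
Variable l : seq nat.
Hypotheses (lp : is_part l) (sz : size l <= n) (lu : uI_partition I n u l).

Lemma maya_runI k : maya l (runI k) = maya (sub_part (posI I) n l) k.
Proof. by apply: maya_sub_part => //; apply/eqP. Qed.

Lemma maya_runIc k : maya l (runIc k) = maya (sub_part (posIc I) n l) k.
Proof.
apply: (@maya_sub_part e (e - c) n (n - u) (fun x => ~~ I x)) => //.
have : u + count (fun p => ~~ I (Posz p)) (display n l) = n.
  by rewrite -{1}(eqP lu) count_predC size_map size_iota.
by lia.
Qed.

Lemma separated_run : I_separated I n l -> separated runI runIc (maya l).
Proof.
move=> sep k m; rewrite /runI /runIc.
have := J_ienum e0 c0 per cE (k + u%:Z)%R; have := @J_ienum e (e - c) (fun x => ~~ I x) e0 ec0 perC cEC (m + (n - u)%:Z)%R.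
move: (ienum e c I _) (ienum e (e - c) _ _) => q p Ip Iq Bp Bq; rewrite ltrD2r.
(* A gap of I is therefore a genuine display position, and a bead at a negative position precedes it
   anyway. *)
have nonneg z : (z < 0)%R -> maya l (z - n%:Z)%R.
  by move=> z0; apply/orP; left; lia.
case: q Iq Bq => q Iq Bq; last by move: Bq; rewrite nonneg.
case: p Ip Bp => p Ip Bp; last by lia.
rewrite ltz_nat; apply: (sep p q) => //.
  by rewrite mem_display.
by rewrite mem_display.
Qed.

End Display.
End Runners.

Theorem mainTheorem18 :
  forall (e : nat) (I : int -> bool) (c : nat),
    3 <= e ->
    (forall x : int, I (x + Posz e)%R = I x) ->
    c = count (fun r => I (Posz r)) (iota 0 e) ->
    1 <= c <= e - 1 ->
  exists N : nat, forall n u : nat, N <= n -> e %| n -> u <= n ->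
  forall alpha beta gamma : seq nat,
    is_part alpha -> is_part beta -> is_part gamma ->
    restricted c beta -> restricted (e - c) gamma ->
  forall lam mu : seq nat,
    is_part lam -> size lam <= n -> is_part mu -> size mu <= n ->
    uI_partition I n u lam ->
    sub_part (posI I) n lam = beta ->
    sub_part (posIc I) n lam = join_bar (e - c) alpha gamma ->
    uI_partition I n u mu ->
    sub_part (posI I) n mu = join_copies c (conj alpha) (mullineux c (conj beta)) ->
    sub_part (posIc I) n mu = mullineux (e - c) (conj gamma) ->
    I_separated I n lam -> I_separated I n mu ->
    regular e (conj lam) /\ mullineux e (conj lam) = mu.
Proof.
move=> e I c e3 per /esym cE c_e; exists 0 => n u _ _ le_un al be ga alp bep gap rbe rga.
move=> lam mu lamp szl mup szm lu lI lIc mu_u mI mIc sepl sepm.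
have e0 : 0 < e by lia.
have e1 : 1 < e by lia.
have c0 : 0 < c by lia.
have cb0 : 0 < e - c by lia.
have lt_ce : c < e by lia.
have E : enum_pair e c (e - c) (runI e c n u I) (runIc e c n u I) by apply: enum_run.
set a := runI e c n u I in E; set b := runIc e c n u I in E.
have [mbp rb] := mreach_mullineux c0 bep rbe.
have [mgp rg] := mreach_mullineux cb0 gap rga.
set be' := conj (mullineux c (conj be)) in rb.
set ga' := conj (mullineux (e - c) (conj ga)) in rg.
have bep' : is_part be' by apply: is_part_conj.
have gap' : is_part ga' by apply: is_part_conj.
have Ba k : maya lam (a k) = maya be k by rewrite maya_runI // lI.
have Bb k : maya lam (b k) = maya (join_bar (e - c) al ga) k by rewrite maya_runIc // lIc.
have Da k : maya mu (a k) = maya (join_copies c (conj al) (mullineux c (conj be))) k.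
  by rewrite maya_runI // mI.
have Db k : maya mu (b k) = maya (mullineux (e - c) (conj ga)) k by rewrite maya_runIc // mIc.
have jcp := is_part_join_copies c (is_part_conj alp) mbp.
have SB : separated a b (maya lam) by apply: separated_run.
have SD : separated a b (maya mu) by apply: separated_run.
clearbody a b.
(* The partner of lambda is the conjugate of mu, so the data of mu enter conjugated:
   [conj_join_copies] turns its part in I into a row sum with alpha itself, and [mirror_enum]
   accounts for the reversal of positions. *)
have re : reach e (maya lam) (mirror (maya mu)).
  apply: (reach_full e1 c0 cb0 alp bep bep' gap gap' rb rg E); split.
  - by exists lam.
  - by apply: ismaya_mirror; exists mu.
  - exact: SB.
  - move=> k m; rewrite /mirror /mirror_enum !subm1K negbK => nB Bm.
    by rewrite ltrD2l ltrN2; apply: SD.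
  - by apply: functional_extensionality => k; rewrite Ba.
  - by apply: functional_extensionality => k; rewrite Bb.
  - rewrite -conj_join_copies // maya_conj //; apply: functional_extensionality => k.
    by rewrite /mirror /mirror_enum subm1K Da.
  rewrite /ga' maya_conj //; apply: functional_extensionality => k.
  by rewrite /mirror /mirror_enum subm1K Db.
have rM := reach_restr e1 re.
split; first exact: restrictedM_regular.
have [||mlp rl] := @mullineux_reach e e1 (conj lam); rewrite ?is_part_conj ?conjK //.
rewrite conjK // in rl; rewrite maya_conj // in rl.
have := reach_fun e1 rl re => /(congr1 mirror); rewrite !mirrorK.
exact: maya_inj.
Qed.
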